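(* The $\mathrm{MSO}+\forall^{=1}_\pi$-theory of the infinite binary tree (the set of all $\mathrm{MSO}+\forall^{=1}_\pi$ sentences true in the infinite binary tree) is undecidable.
   Context: Formulas of $\mathrm{MSO}+\forall^{=1}_\pi$ are generated by $\varphi::=S_0(x,y)\mid S_1(x,y)\mid x\in X\mid\neg\varphi\mid\varphi_1\wedge\varphi_2\mid\forall x.\varphi\mid\forall X.\varphi\mid\forall^{=1}_\pi X.\varphi$, with first-order variables $x,y$ and set variables $X$. They are interpreted on the infinite binary tree: first-order variables range over $\{0,1\}^*$, set variables over subsets of $\{0,1\}^*$, $S_i(x,y)$ holds iff $y=x\cdot i$, $\in$ is membership, and Boolean connectives and quantifiers are as usual. A set $X\subseteq\{0,1\}^*$ is a path if $\epsilon\in X$, $X$ is prefix-closed, and for every $v\in X$ exactly one of $v0,v1$ is in $X$; paths correspond bijectively to $\{0,1\}^\omega$, and the coin-flipping measure $\mu$ (giving the cone $u\{0,1\}^\omega$ measure $2^{-|u|}$) thus induces a measure $\mu$ on the set of paths. $\forall^{=1}_\pi X.\varphi$ holds iff the set of paths $X$ satisfying $\varphi$ has $\mu$-measure $1$. A sentence is a formula without free variables. *)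

(* Defs.v *)
From Stdlib Require Import Reals List Arith.
Import ListNotations.
Open Scope R_scope.

(* The infinite binary tree: nodes are words in {0,1}^*, 0 = false.   *)
Definition node := list bool.

(* first-order and set variables live in separate name spaces.        *)
Inductive form : Type :=
| FS0 (x y : nat)
| FS1 (x y : nat)
| FMem (x X : nat)
| FNeg (phi : form)
| FAnd (phi psi : form)
| FAllFO (x : nat) (phi : form)
| FAllSO (X : nat) (phi : form)
| FAllPath (X : nat) (phi : form).

Fixpoint fo_free (z : nat) (phi : form) : Prop :=
  match phi with
  | FS0 x y | FS1 x y => z = x \/ z = y
  | FMem x _ => z = x
  | FNeg p => fo_free z p
  | FAnd p q => fo_free z p \/ fo_free z q
  | FAllFO x p => z <> x /\ fo_free z p
  | FAllSO _ p | FAllPath _ p => fo_free z p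
  end.

Fixpoint so_free (Z : nat) (phi : form) : Prop :=
  match phi with
  | FS0 _ _ | FS1 _ _ => False
  | FMem _ X => Z = X
  | FNeg p => so_free Z p
  | FAnd p q => so_free Z p \/ so_free Z q
  | FAllFO _ p => so_free Z p
  | FAllSO X p | FAllPath X p => Z <> X /\ so_free Z p
  end.

Definition sentence (phi : form) : Prop :=
  (forall z, ~ fo_free z phi) /\ (forall Z, ~ so_free Z phi).

Definition prefix (u : list bool) (w : nat -> bool) : Prop :=
  forall i, (i < length u)%nat -> nth i u false = w i.

Definition path_of (w : nat -> bool) : node -> Prop := fun u => prefix u w.

(* Paths as in the paper (the map path_of is a bijection onto these). *)
Definition is_path (P : node -> Prop) : Prop :=
  P [] /\ (forall u v, P (u ++ v) -> P u) /\
  (forall v, P v -> (P (v ++ [false]) <-> ~ P (v ++ [true]))).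

Definition mu_null (N : (nat -> bool) -> Prop) : Prop :=
  forall eps : R, 0 < eps ->
    exists c : nat -> list bool,
      (forall w, N w -> exists n, prefix (c n) w) /\
      (forall m, sum_f_R0 (fun k => (/ 2) ^ length (c k)) m <= eps).

Definition measure_one (A : (nat -> bool) -> Prop) : Prop :=
  mu_null (fun w => ~ A w).

Definition upd {A : Type} (f : nat -> A) (k : nat) (a : A) : nat -> A :=
  fun j => if Nat.eqb j k then a else f j.

Fixpoint sat (fo : nat -> node) (so : nat -> node -> Prop) (phi : form)
  : Prop :=
  match phi with
  | FS0 x y => fo y = fo x ++ [false]
  | FS1 x y => fo y = fo x ++ [true]
  | FMem x X => so X (fo x)
  | FNeg p => ~ sat fo so p
  | FAnd p q => sat fo so p /\ sat fo so q
  | FAllFO x p => forall u : node, sat (upd fo x u) so p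
  | FAllSO X p => forall S : node -> Prop, sat fo (upd so X S) p
  | FAllPath X p =>
      measure_one (fun w => sat fo (upd so X (path_of w)) p)
  end.

(* Truth of a sentence in the infinite binary tree (assignment irrelevant). *)
Definition true_in_tree (phi : form) : Prop :=
  sat (fun _ => []) (fun _ _ => False) phi.

(* Goedel numbering of formulas (Cantor pairing).                      *)
Definition cpair (a b : nat) : nat := ((a + b) * (a + b + 1)) / 2 + b.

Fixpoint code (phi : form) : nat :=
  match phi with
  | FS0 x y => cpair 0 (cpair x y)
  | FS1 x y => cpair 1 (cpair x y)
  | FMem x X => cpair 2 (cpair x X)
  | FNeg p => cpair 3 (code p)
  | FAnd p q => cpair 4 (cpair (code p) (code q))
  | FAllFO x p => cpair 5 (cpair x (code p))
  | FAllSO X p => cpair 6 (cpair X (code p))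
  | FAllPath X p => cpair 7 (cpair X (code p))
  end.

Definition theory (n : nat) : Prop :=
  exists phi, code phi = n /\ sentence phi /\ true_in_tree phi.

Inductive rf : Type :=
| RZero
| RSucc
| RProj (i : nat)
| RComp (f : rf) (gs : list rf)
| RPrec (f g : rf)
| RMu (f : rf).

Inductive eval : rf -> list nat -> nat -> Prop :=
| ev_zero v : eval RZero v 0
| ev_succ x v : eval RSucc (x :: v) (S x)
| ev_proj i v : (i < length v)%nat -> eval (RProj i) v (nth i v 0%nat)
| ev_comp f gs v ys z :
    eval_list gs v ys -> eval f ys z -> eval (RComp f gs) v z
| ev_prec0 f g v z : eval f v z -> eval (RPrec f g) (0%nat :: v) z
| ev_precS f g n v r z :
    eval (RPrec f g) (n :: v) r -> eval g (n :: r :: v) z ->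
    eval (RPrec f g) (S n :: v) z
| ev_mu f v n :
    eval f (n :: v) 0%nat ->
    (forall m, (m < n)%nat -> exists k, eval f (m :: v) (S k)) ->
    eval (RMu f) v n
with eval_list : list rf -> list nat -> list nat -> Prop :=
| evl_nil v : eval_list [] v []
| evl_cons g gs v y ys :
    eval g v y -> eval_list gs v ys -> eval_list (g :: gs) v (y :: ys).

Definition decidable_set (D : nat -> Prop) : Prop :=
  exists f : rf, forall n : nat,
    (D n -> eval f [n] 1%nat) /\ (~ D n -> eval f [n] 0%nat).

(* Main.v *)
(* Read a path as a sequence of rounds [0^j 1 0^i 1], and call the nodes reached after the
   prefixes of [0^j] in a round its cells. A set of marked nodes [c 1 0^l], one behind each
   cell [c], attaches to the cell the number [l]; a cell is hit with probability about
   [2^-l], so almost sure statements of the form "these cells are hit infinitely often iff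
   those are" compare such numbers up to a bounded error. Thus each round may carry a finite
   word whose letters have data values that can be tested for equality, and such a word can
   spell out a computation. Quantifying over all choices of one cell per round forces the
   computations to have bounded length, and to be correct on a "large" set of rounds, where
   largeness is partition regular, so that one correct computation can be extracted.
   Conversely a given computation is written into all rounds, with data value [d] encoded by
   marks at distance [d * r], where [r] is a stage number that slowly tends to infinity.
   Hence for every partial recursive function "[f n = 1]" is expressible, and a decision
   procedure for the theory is refuted by diagonalisation. *)
Require Import Defs.
From Stdlib Require Import Reals List Arith Lia Lra Classical ClassicalEpsilon.
From Stdlib Require Import FunctionalExtensionality PropExtensionality Setoid Morphisms.
Import ListNotations.
Local Open Scope nat_scope.

(** * Weights of sets of nodes *)

(** The quantifier sees only null sets, so no single round can ever be checked: numbers attached to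
    cells are compared up to a bounded error and along infinitely many rounds. Multiplying all data
    by a stage that tends to infinity turns inequality into an unbounded difference, which
    Borel-Cantelli detects, while equal data still give equal distances. The stage must not grow too
    fast, or the rare hits would die out: it advances exactly when the rarest hit, the one behind
    the last active cell, has happened, and every other hit is at least comparably likely. Data
    values are named by positions: value [d] is represented by cell number [d] of the same round, so
    that zero and successor become statements about the start of a run and about neighbouring cells.
    A computation is a list of instances of Horn rules, each justified by later entries, hence it is
    verified from the end of a bounded round towards its start. The input enters as the set of nodes
    at position [n] of their runs. It is a free set variable of the formula, which makes
    self-application a matter of shifting a set. *)

Definition pre (u v : node) : Prop := exists s, v = u ++ s.

Lemma pre_refl u : pre u u.
Proof. exists []. now rewrite app_nil_r. Qed.

Lemma pre_trans u v x : pre u v -> pre v x -> pre u x.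
Proof. intros [s ->] [t ->]. exists (s ++ t). now rewrite app_assoc. Qed.

Lemma pre_app u s : pre u (u ++ s).
Proof. now exists s. Qed.

Lemma pre_length u v : pre u v -> length u <= length v.
Proof. intros [s ->]. rewrite length_app. lia. Qed.

Lemma pre_antisym_length u v : pre u v -> length v <= length u -> u = v.
Proof.
  intros [s ->] H. rewrite length_app in H.
  destruct s; [now rewrite app_nil_r | simpl in H; lia].
Qed.

Lemma pre_total u v x : pre u x -> pre v x -> length u <= length v -> pre u v.
Proof.
  intros [s ->] [t H] Hl.
  exists (skipn (length u) v).
  assert (E : firstn (length u) (u ++ s) = u).
  { rewrite firstn_app, Nat.sub_diag, firstn_all. simpl. apply app_nil_r. }
  rewrite H in E. rewrite firstn_app in E.
  replace (length u - length v) with 0 in E by lia.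
  simpl in E. rewrite app_nil_r in E. rewrite <- E at 1. now rewrite firstn_skipn.
Qed.

Lemma path_pre w u v : path_of w v -> pre u v -> path_of w u.
Proof.
  intros H [s ->] i Hi. rewrite <- H by (rewrite length_app; lia).
  now rewrite app_nth1.
Qed.

Definition take (w : nat -> bool) (n : nat) : node := map w (seq 0 n).

Lemma take_length w n : length (take w n) = n.
Proof. unfold take. now rewrite length_map, length_seq. Qed.

Lemma take_path w n : path_of w (take w n).
Proof.
  intros i Hi. rewrite take_length in Hi. unfold take.
  rewrite nth_indep with (d' := w 0) by (rewrite length_map, length_seq; lia).
  rewrite map_nth, seq_nth by lia. reflexivity.
Qed.

Lemma path_eq_take w u : path_of w u -> u = take w (length u).
Proof.
  intros H. apply nth_ext with (d := false) (d' := false).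
  - now rewrite take_length.
  - intros i Hi. rewrite (H i Hi). symmetry. apply take_path. now rewrite take_length.
Qed.

Lemma path_pre_length w u v :
  path_of w u -> path_of w v -> length u <= length v -> pre u v.
Proof.
  intros Hu Hv Hl. rewrite (path_eq_take _ _ Hu), (path_eq_take _ _ Hv).
  unfold take. replace (length v) with (length u + (length v - length u)) by lia.
  rewrite seq_app, map_app. apply pre_app.
Qed.

Lemma take_S w n : take w (S n) = take w n ++ [w n].
Proof. unfold take. now rewrite seq_S, map_app. Qed.

Definition filt {A : Type} (P : A -> Prop) (l : list A) : list A :=
  filter (fun x => if excluded_middle_informative (P x) then true else false) l.

Lemma filt_In {A : Type} (P : A -> Prop) l x : In x (filt P l) <-> In x l /\ P x.
Proof.
  unfold filt. rewrite filter_In.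
  destruct (excluded_middle_informative (P x)); intuition congruence.
Qed.

Lemma filt_NoDup {A : Type} (P : A -> Prop) l : NoDup l -> NoDup (filt P l).
Proof. apply NoDup_filter. Qed.

Fixpoint sumf {A : Type} (f : A -> R) (l : list A) : R :=
  match l with [] => 0%R | x :: l => (f x + sumf f l)%R end.

Lemma sumf_app {A : Type} (f : A -> R) l1 l2 :
  sumf f (l1 ++ l2) = (sumf f l1 + sumf f l2)%R.
Proof. induction l1; simpl; lra. Qed.

Lemma sumf_filt {A : Type} (f : A -> R) (P : A -> Prop) l :
  sumf f l = (sumf f (filt P l) + sumf f (filt (fun x => ~ P x) l))%R.
Proof.
  induction l as [|x l IH]; simpl; [lra|].
  unfold filt in *. simpl.
  destruct (excluded_middle_informative (P x)), (excluded_middle_informative (~ P x));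
    try tauto; simpl; lra.
Qed.

Lemma sumf_le {A : Type} (f g : A -> R) l :
  (forall x, In x l -> (f x <= g x)%R) -> (sumf f l <= sumf g l)%R.
Proof.
  induction l as [|x l IH]; simpl; intros H; [lra|].
  specialize (IH (fun y Hy => H y (or_intror Hy))). specialize (H x (or_introl eq_refl)). lra.
Qed.

Lemma sumf_scal {A : Type} (f : A -> R) c l :
  sumf (fun x => c * f x)%R l = (c * sumf f l)%R.
Proof. induction l; simpl; lra. Qed.

Lemma sumf_map {A B : Type} (f : B -> R) (h : A -> B) l :
  sumf f (map h l) = sumf (fun x => f (h x)) l.
Proof. induction l; simpl; congruence. Qed.

Lemma sumf_incl {A : Type} (f : A -> R) l l' :
  (forall x, (0 <= f x)%R) -> NoDup l -> incl l l' -> (sumf f l <= sumf f l')%R.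
Proof.
  intros Hf. revert l'. induction l as [|x l IH]; simpl; intros l' Hn Hi.
  - induction l'; simpl; [lra|]. specialize (Hf a).
    assert (incl (@nil A) l') by (intros y []). specialize (IHl' H). lra.
  - inversion_clear Hn. destruct (in_split x l') as (l1 & l2 & ->); [apply Hi; now left|].
    assert (H1 : incl l (l1 ++ l2)).
    { intros y Hy. assert (In y (l1 ++ x :: l2)) by (apply Hi; now right).
      apply in_app_iff in H1. apply in_app_iff. destruct H1 as [|[->|]]; auto. contradiction. }
    specialize (IH _ H0 H1). rewrite sumf_app in *. simpl. lra.
Qed.

Definition wt (u : node) : R := ((/ 2) ^ length u)%R.

Lemma half_pow_pos n : (0 < (/ 2) ^ n)%R.
Proof. apply pow_lt. lra. Qed.

Lemma half_pow_le m n : m <= n -> ((/ 2) ^ n <= (/ 2) ^ m)%R.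
Proof.
  intros H. replace n with (m + (n - m)) by lia. rewrite pow_add.
  pose proof (half_pow_pos m).
  assert ((/ 2) ^ (n - m) <= 1)%R.
  { rewrite <- (pow1 (n - m)). apply pow_incr. lra. }
  nra.
Qed.

Lemma wt_pos u : (0 < wt u)%R.
Proof. apply half_pow_pos. Qed.

Lemma wt_app u v : wt (u ++ v) = (wt u * wt v)%R.
Proof. unfold wt. now rewrite length_app, pow_add. Qed.

Definition antichain (S : node -> Prop) : Prop :=
  forall u v, S u -> S v -> pre u v -> u = v.

(** A bound on a possibly infinite sum, phrased through finite lists so that convergence never
    enters. *)
Definition mass_le {A : Type} (f : A -> R) (S : A -> Prop) (M : R) : Prop :=
  forall l, NoDup l -> (forall x, In x l -> S x) -> (sumf f l <= M)%R.

Lemma mass_le_sub {A : Type} (f : A -> R) (S S' : A -> Prop) M :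
  (forall x, S x -> S' x) -> mass_le f S' M -> mass_le f S M.
Proof. intros H HM l Hn Hl. apply HM; auto. Qed.

Lemma mass_le_single {A : Type} (f : A -> R) (a : A) :
  (0 <= f a)%R -> mass_le f (fun x => x = a) (f a).
Proof.
  intros Hf l Hn Hl. destruct l as [|x [|y l]]; simpl.
  - exact Hf.
  - rewrite (Hl x (or_introl eq_refl)). lra.
  - exfalso. inversion_clear Hn. apply H. left.
    rewrite (Hl x (or_introl eq_refl)), (Hl y); auto. right; now left.
Qed.

(** Either [w] is a member and then the only one, or the list splits by the bit that follows [w].
    The depth [N] is there for the induction. *)
Lemma kraft_depth N w l :
  NoDup l -> antichain (fun x => In x l) ->
  (forall x, In x l -> pre w x /\ length x <= length w + N) ->
  (sumf wt l <= wt w)%R.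
Proof.
  revert w l. induction N as [|N IH]; intros w l Hn Ha Hl.
  - apply (mass_le_single wt w); auto. { pose proof (wt_pos w); lra. }
    intros x Hx. destruct (Hl x Hx). symmetry. apply pre_antisym_length; auto. lia.
  - destruct (classic (In w l)) as [Hw|Hw].
    + apply (mass_le_single wt w); auto. { pose proof (wt_pos w); lra. }
      intros x Hx. symmetry. apply Ha; auto. now apply Hl.
    + set (Q := fun x : node => pre (w ++ [true]) x).
      rewrite (sumf_filt wt Q).
      assert (HT : forall b, (sumf wt (filt (fun x => pre (w ++ [b]) x) l) <= wt w / 2)%R).
      { intros b. replace (wt w / 2)%R with (wt (w ++ [b])).
        2:{ rewrite wt_app. unfold wt at 2. simpl. lra. }
        apply IH.
        - now apply filt_NoDup.
        - intros x y Hx Hy. apply filt_In in Hx, Hy. apply Ha; tauto.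
        - intros x Hx. apply filt_In in Hx. destruct Hx as [Hx Hp]. split; auto.
          rewrite length_app. simpl. destruct (Hl x Hx). lia. }
      assert (H1 := HT true). assert (H0 := HT false).
      assert (H2 : (sumf wt (filt (fun x => ~ Q x) l)
                    <= sumf wt (filt (fun x => pre (w ++ [false]) x) l))%R).
      { apply sumf_incl. { intros; pose proof (wt_pos x); lra. } { now apply filt_NoDup. }
        intros x Hx. apply filt_In in Hx. apply filt_In. destruct Hx as [Hx Hq].
        split; auto. destruct (Hl x Hx) as [[s ->] _]. destruct s as [|b s].
        - rewrite app_nil_r in Hx. contradiction.
        - destruct b.
          + exfalso. apply Hq. exists s. now rewrite <- app_assoc.
          + exists s. now rewrite <- app_assoc. }
      unfold Q in *. lra.
Qed.

Lemma length_bound (l : list node) : exists N, forall x, In x l -> length x <= N.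
Proof.
  induction l as [|a l [N HN]].
  - exists 0. intros x [].
  - exists (length a + N). intros x [->|Hx]; [lia|]. specialize (HN x Hx). lia.
Qed.

Lemma kraft S w :
  antichain S -> (forall x, S x -> pre w x) -> mass_le wt S (wt w).
Proof.
  intros Ha Hw l Hn Hl. destruct (length_bound l) as [N HN].
  apply (kraft_depth N); auto.
  - intros u v Hu Hv. apply Ha; auto.
  - intros x Hx. split; auto. specialize (HN x Hx). lia.
Qed.

(** Finite form of countable subadditivity. The index of the head removes every node that it covers;
    later indices cover some node that survived, so no index is used twice. *)
Lemma grouping {I : Type} (S : I -> Prop) (f : I -> R) (Next : I -> node -> Prop) :
  (forall i, S i -> mass_le wt (Next i) (f i)) ->
  forall l, NoDup l -> (forall b, In b l -> exists i, S i /\ Next i b) ->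
  exists W, NoDup W /\ (forall i, In i W -> S i /\ exists b, In b l /\ Next i b) /\
    (sumf wt l <= sumf f W)%R.
Proof.
  intros HS l. remember (length l) as n eqn:En. revert l En.
  induction n as [n IH] using (well_founded_induction lt_wf). intros l -> Hn Hl.
  destruct l as [|b l].
  - exists []. split; [constructor|split; [intros i []|simpl; lra]].
  - destruct (Hl b (or_introl eq_refl)) as (i & Si & Hib).
    set (l2 := filt (fun x => ~ Next i x) (b :: l)).
    assert (Hlen : length l2 < length (b :: l)).
    { unfold l2, filt. simpl. destruct (excluded_middle_informative (~ Next i b)); [tauto|].
      apply Nat.lt_succ_r. apply filter_length_le. }
    destruct (IH _ Hlen l2 eq_refl) as (W & HW & HWS & Hsum).
    { now apply filt_NoDup. }
    { intros x Hx. apply filt_In in Hx. apply Hl. tauto. }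
    exists (i :: W). split; [|split].
    + constructor; auto. intros Hi. destruct (HWS i Hi) as (_ & x & Hx & Hix).
      apply filt_In in Hx. tauto.
    + intros j [<-|Hj].
      * split; auto. exists b. split; auto. now left.
      * destruct (HWS j Hj) as (Sj & x & Hx & Hjx). split; auto.
        exists x. apply filt_In in Hx. tauto.
    + rewrite (sumf_filt wt (Next i)). cbn [sumf].
      assert (sumf wt (filt (Next i) (b :: l)) <= f i)%R.
      { apply HS; auto. now apply filt_NoDup. intros x Hx. apply filt_In in Hx. tauto. }
      fold l2. lra.
Qed.

Lemma mass_le_union {I : Type} (S : I -> Prop) (f : I -> R) (Next : I -> node -> Prop) M :
  (forall i, S i -> mass_le wt (Next i) (f i)) -> mass_le f S M ->
  mass_le wt (fun b => exists i, S i /\ Next i b) M.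
Proof.
  intros HS HM l Hn Hl. destruct (grouping S f Next HS l Hn Hl) as (W & HW & HWS & Hs).
  assert (sumf f W <= M)%R by (apply HM; auto; intros i Hi; now apply HWS). lra.
Qed.

Lemma repeat_one_pre m n s :
  repeat false m ++ [true] ++ s = repeat false n ++ [true] -> m = n.
Proof.
  revert n. induction m as [|m IH]; intros [|n] H; simpl in *; try discriminate; auto.
  injection H as H. f_equal. now apply IH.
Qed.

(** Kraft's inequality for the prefix code of the words [0^r 1] replaces the geometric series. *)
Lemma mass_le_geometric (P : nat -> Prop) : mass_le (fun r => (/ 2) ^ S r)%R P 1.
Proof.
  intros l Hn _.
  assert (H : (sumf wt (map (fun r => repeat false r ++ [true]) l) <= 1)%R).
  { apply (kraft (fun x => exists r, x = repeat false r ++ [true]) []).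
    - intros u v [m ->] [n ->] [s Hs]. rewrite <- app_assoc in Hs.
      symmetry in Hs. apply repeat_one_pre in Hs. now subst.
    - intros x _. now exists x.
    - apply NoDup_map_NoDup_ForallPairs; auto. intros m n _ _ H.
      apply repeat_one_pre with (s := []). exact H.
    - intros x Hx. apply in_map_iff in Hx. destruct Hx as (r & <- & _). now exists r. }
  rewrite sumf_map in H. eapply Rle_trans; [|exact H].
  apply sumf_le. intros r _. unfold wt. rewrite length_app, repeat_length. simpl.
  replace (r + 1) with (S r) by lia. simpl. lra.
Qed.

Lemma mass_le_pow_union (c : R) (Next : nat -> node -> Prop) :
  (0 < c)%R -> (forall r, mass_le wt (Next r) (c * (/ 2) ^ S r)%R) ->
  mass_le wt (fun b => exists r, Next r b) c.
Proof.
  intros Hc H. apply mass_le_sub with (S' := fun b => exists r, True /\ Next r b).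
  { intros x [r Hr]. now exists r. }
  apply mass_le_union with (f := fun r => (c * (/ 2) ^ S r)%R); auto.
  intros l Hn Hl. rewrite sumf_scal.
  pose proof (mass_le_geometric (fun _ => True) l Hn (fun _ _ => I)). nra.
Qed.

(** * Null sets *)

(** A cover as a set of nodes, which may be finite or empty and comes without the enumeration that
    [mu_null] requires. *)
Definition covered_by (N : (nat -> bool) -> Prop) (eps : R) : Prop :=
  exists S : node -> Prop,
    (forall w, N w -> exists u, S u /\ path_of w u) /\ mass_le wt S eps.

Lemma sumf_seq f m : sumf f (seq 0 (S m)) = sum_f_R0 f m.
Proof.
  induction m as [|m IH]; [simpl; lra|].
  rewrite seq_S, sumf_app, IH. simpl. lra.
Qed.

Lemma null_covered N eps : mu_null N -> (0 < eps)%R -> covered_by N eps.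
Proof.
  intros HN He. destruct (HN eps He) as (c & Hc & Hs).
  exists (fun u => exists n, True /\ u = c n). split.
  - intros w Hw. destruct (Hc w Hw) as [n Hn]. exists (c n). split; auto. now exists n.
  - apply mass_le_union with (f := fun n => wt (c n)).
    + intros n _. apply mass_le_single. pose proof (wt_pos (c n)); lra.
    + intros l Hn _.
      assert (exists m, forall x, In x l -> x <= m) as [m Hm].
      { clear. induction l as [|a l [m Hm]]; [exists 0; intros x []|].
        exists (a + m). intros x [->|Hx]; [lia|]. specialize (Hm x Hx). lia. }
      eapply Rle_trans; [|apply (Hs m)]. rewrite <- sumf_seq.
      apply sumf_incl; auto. { intros x. apply Rlt_le, wt_pos. }
      intros x Hx. apply in_seq. specialize (Hm x Hx). lia.
Qed.

(** Binary value with a leading 1 at the far end, which keeps words apart that differ only in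
    trailing zeros. *)
Fixpoint enc (u : node) : nat :=
  match u with [] => 1 | b :: u => (if b then 1 else 0) + 2 * enc u end.

Lemma enc_pos u : 0 < enc u.
Proof. induction u; simpl; lia. Qed.

Lemma enc_inj u v : enc u = enc v -> u = v.
Proof.
  revert v. induction u as [|a u IH]; intros [|b v]; cbn [enc]; intros H; auto.
  - exfalso. pose proof (enc_pos v). destruct b; lia.
  - exfalso. pose proof (enc_pos u). destruct a; lia.
  - assert (a = b) by (destruct a, b; auto; lia). subst b. f_equal. apply IH. lia.
Qed.

Lemma half_pow_small eps : (0 < eps)%R -> exists K, ((/ 2) ^ K <= eps)%R.
Proof.
  intros He. destruct (pow_lt_1_zero (/ 2)) with (y := eps) as [K HK]; auto.
  { rewrite Rabs_pos_eq; lra. }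
  exists K. specialize (HK K (le_n _)). rewrite Rabs_pos_eq in HK; [lra|].
  pose proof (half_pow_pos K); lra.
Qed.

(** Member [u] of the cover is put at index [enc u]. All other indices receive junk of total weight
    at most [2^-K], which is paid from half of [eps]. *)
Lemma covered_null N : (forall eps, (0 < eps)%R -> covered_by N eps) -> mu_null N.
Proof.
  intros H eps He. destruct (H (eps / 2)%R ltac:(lra)) as (S & HS & HM).
  destruct (half_pow_small (eps / 2)%R ltac:(lra)) as [K HK].
  set (c := fun k => match excluded_middle_informative (exists u, S u /\ enc u = k) with
                     | left e => proj1_sig (constructive_indefinite_description _ e)
                     | right _ => repeat false (K + Datatypes.S k)
                     end).
  exists c. split.
  - intros w Hw. destruct (HS w Hw) as (u & Su & Hu). exists (enc u). unfold c.
    destruct excluded_middle_informative as [e|n].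
    + destruct constructive_indefinite_description as (v & Sv & Hv). simpl.
      apply enc_inj in Hv. now subst.
    + exfalso. apply n. now exists u.
  (* The junk is bounded by the exact partial sum of the geometric series, so that the induction
     closes; [enc x <= m] shows that the next member is new. *)
  - assert (HI : forall m, exists l, NoDup l /\ (forall x, In x l -> S x /\ enc x <= m) /\
       (sum_f_R0 (fun k => wt (c k)) m
        <= sumf wt l + (/ 2) ^ K * (1 - (/ 2) ^ Datatypes.S m))%R).
    { assert (Hstep : forall k, (exists u, S u /\ enc u = k /\ c k = u) \/
                       (wt (c k) = (/ 2) ^ K * (/ 2) ^ Datatypes.S k)%R).
      { intros k. unfold c. destruct excluded_middle_informative as [e|n].
        - left. destruct constructive_indefinite_description as (v & Sv & Hv). simpl.
          exists v. auto.
        - right. unfold wt. rewrite repeat_length. apply pow_add. }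
      pose proof (half_pow_pos K).
      induction m as [|m (l & Hl & Hl2 & Hs)].
      - destruct (Hstep 0) as [(u & Su & Eu & Hu)|Hu].
        + exists [u]. split; [|split].
          * repeat constructor. intros [].
          * intros x [<-|[]]. split; auto. lia.
          * simpl. rewrite Hu. nra.
        + exists []. split; [constructor|split; [intros x []|]]. simpl in *. rewrite Hu. lra.
      - cbn [sum_f_R0]. pose proof (half_pow_pos (Datatypes.S m)).
        assert (E2 : ((/ 2) ^ Datatypes.S (Datatypes.S m) = / 2 * (/ 2) ^ Datatypes.S m)%R)
          by reflexivity.
        destruct (Hstep (Datatypes.S m)) as [(u & Su & Eu & Hu)|Hu].
        + exists (u :: l). split; [|split].
          * constructor; auto. intros Hi. apply Hl2 in Hi. lia.
          * intros x [<-|Hx]; [split; auto; lia|]. destruct (Hl2 x Hx). split; auto.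
          * rewrite Hu. cbn [sumf]. rewrite E2. nra.
        + exists l. split; [|split]; auto.
          * intros x Hx. destruct (Hl2 x Hx). split; auto.
          * rewrite Hu, E2. nra. }
    intros m. destruct (HI m) as (l & Hl & Hl2 & Hs).
    assert (sumf wt l <= eps / 2)%R by (apply HM; auto; intros x Hx; now apply Hl2).
    pose proof (half_pow_pos K). pose proof (half_pow_pos (Datatypes.S m)).
    change (sum_f_R0 (fun k => wt (c k)) m <= eps)%R. nra.
Qed.

Lemma null_sub (N N' : (nat -> bool) -> Prop) :
  (forall w, N w -> N' w) -> mu_null N' -> mu_null N.
Proof.
  intros H HN eps He. destruct (HN eps He) as (c & Hc & Hs). exists c. auto.
Qed.

Lemma null_union (N : nat -> (nat -> bool) -> Prop) :
  (forall n, mu_null (N n)) -> mu_null (fun w => exists n, N n w).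
Proof.
  intros H. apply covered_null. intros eps He.
  assert (HS : forall n, covered_by (N n) (eps * (/ 2) ^ S n)%R).
  { intros n. apply null_covered; auto. pose proof (half_pow_pos (S n)). nra. }
  apply choice in HS. destruct HS as [S HS].
  exists (fun u => exists n, S n u). split.
  - intros w [n Hn]. destruct (HS n) as [Hc _]. destruct (Hc w Hn) as (u & Hu & Hp).
    exists u. split; auto. now exists n.
  - apply mass_le_pow_union; auto. intros n. apply HS.
Qed.

Lemma null_or N N' : mu_null N -> mu_null N' -> mu_null (fun w => N w \/ N' w).
Proof.
  intros H H'. apply null_sub with (N' := fun w => exists n : nat, (if n then N else N') w).
  - intros w [Hw|Hw]; [now exists 0 | now exists 1].
  - apply null_union. intros [|n]; auto.
Qed.

Lemma null_node_union (N : node -> (nat -> bool) -> Prop) :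
  (forall u, mu_null (N u)) -> mu_null (fun w => exists u, N u w).
Proof.
  intros H. apply null_sub with (N' := fun w => exists n, exists u, enc u = n /\ N u w).
  { intros w [u Hu]. exists (enc u), u. auto. }
  apply null_union. intros n.
  destruct (classic (exists u, enc u = n)) as [[u Hu]|Hn].
  - apply null_sub with (N' := N u); auto. intros w (v & Hv & Hw).
    assert (u = v) by (apply enc_inj; congruence). now subst.
  - apply null_sub with (N' := N []); auto. intros w (v & Hv & _). exfalso. eauto.
Qed.

(** Induction on the depth: the lists found beyond the two children are disjoint and each has half
    of the weight of [w]. The first alternative catches a proper prefix of [w] that covers both
    children at once. *)
Lemma full_cover_mass (S : node -> Prop) N w :
  (forall x, pre w x -> length x = length w + N -> exists s, S s /\ pre s x) ->
  (exists s, S s /\ pre s w /\ s <> w) \/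
  exists l, NoDup l /\ (forall x, In x l -> S x /\ pre w x) /\ sumf wt l = wt w.
Proof.
  revert w. induction N as [|N IH]; intros w Hc;
    (destruct (classic (S w)) as [Hw|Hw];
      [right; exists [w]; split; [repeat constructor; intros []|split;
        [intros x [<-|[]]; split; auto using pre_refl | simpl; lra]] |]).
  - destruct (Hc w (pre_refl w)) as (s & Hs & Hp); [lia|].
    left. exists s. repeat split; auto. congruence.
  - assert (HI : forall b, (exists s, S s /\ pre s w /\ s <> w) \/
      exists l, NoDup l /\ (forall x, In x l -> S x /\ pre (w ++ [b]) x) /\
        sumf wt l = (wt w / 2)%R).
    { intros b. destruct (IH (w ++ [b])) as [(s & Hs & Hp & Hne)|(l & Hl & Hx & Hsum)].
      - intros x Hx Hlx. apply Hc.
        + apply pre_trans with (w ++ [b]); auto using pre_app.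
        + rewrite length_app in Hlx. simpl in Hlx. lia.
      - left. exists s. assert (length s <= length w).
        { destruct (le_lt_dec (length s) (length w)) as [|Hlt]; auto.
          exfalso. apply Hne. apply pre_antisym_length; auto. rewrite length_app. simpl. lia. }
        split; auto. split; [|congruence].
        apply pre_total with (w ++ [b]); auto using pre_app.
      - right. exists l. split; [|split]; auto. rewrite Hsum, wt_app. unfold wt at 2. simpl. lra. }
    destruct (HI false) as [Hp|(l0 & Hl0 & Hx0 & Hs0)]; [now left|].
    destruct (HI true) as [Hp|(l1 & Hl1 & Hx1 & Hs1)]; [now left|].
    right. exists (l0 ++ l1). split; [|split].
    + apply NoDup_app; auto. intros x H0 H1.
      destruct (Hx0 x H0) as [_ [s ->]]. destruct (Hx1 _ H1) as [_ [t Ht]].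
      rewrite <- !app_assoc in Ht. apply app_inv_head in Ht. discriminate.
    + intros x Hx. apply in_app_iff in Hx.
      destruct Hx as [Hx|Hx]; [destruct (Hx0 x Hx)|destruct (Hx1 x Hx)];
        split; auto; eapply pre_trans; eauto using pre_app.
    + rewrite sumf_app. lra.
Qed.

(** Compactness through König's lemma: a node that is not covered within any finite depth has a
    child of the same kind, and the branch built in this way would avoid the cover. A cover of
    finite depth contains a list of weight one. *)
Lemma full_not_null : ~ mu_null (fun _ => True).
Proof.
  intros H. destruct (null_covered _ (/ 2)%R H ltac:(lra)) as (S & HS & HM).
  set (cov := fun w => exists N, forall x, pre w x -> length x = length w + N ->
                exists s, S s /\ pre s x).
  assert (Hc : cov []).
  { apply NNPP. intros Hn.
    assert (Hstep : forall w, ~ cov w -> exists b, ~ cov (w ++ [b])).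
    { intros w Hw. apply NNPP. intros Hb. apply Hw.
      destruct (NNPP (cov (w ++ [false]))) as [N0 H0]; [intros ?; apply Hb; eauto|].
      destruct (NNPP (cov (w ++ [true]))) as [N1 H1]; [intros ?; apply Hb; eauto|].
      exists (Datatypes.S (N0 + N1)). intros x [s ->] Hl. rewrite length_app in Hl.
      destruct s as [|b s]; [simpl in Hl; lia|].
      assert (Hsub : forall Nb, length s >= Nb ->
        (forall x, pre (w ++ [b]) x -> length x = length (w ++ [b]) + Nb ->
           exists s, S s /\ pre s x) -> exists s', S s' /\ pre s' (w ++ b :: s)).
      { intros Nb Hge Hcov. destruct (Hcov (w ++ [b] ++ firstn Nb s)) as (s' & Hs' & Hp).
        - exists (firstn Nb s). now rewrite <- app_assoc.
        - rewrite !length_app, firstn_length_le by lia. simpl. lia.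
        - exists s'. split; auto. eapply pre_trans; [exact Hp|].
          exists (skipn Nb s). rewrite <- !app_assoc. simpl. now rewrite firstn_skipn. }
      simpl in Hl. destruct b; [apply (Hsub N1)|apply (Hsub N0)]; auto; lia. }
    set (f := fun w => match excluded_middle_informative (cov (w ++ [false])) with
                       | left _ => true | right _ => false end).
    assert (Hf : forall w, ~ cov w -> ~ cov (w ++ [f w])).
    { intros w Hw. unfold f. destruct excluded_middle_informative as [e|n]; auto.
      destruct (Hstep w Hw) as [[|] Hb]; auto. }
    set (p := fix p n := match n with 0 => [] | Datatypes.S n => p n ++ [f (p n)] end).
    assert (Hp : forall n, ~ cov (p n)).
    { induction n; simpl; auto. }
    set (w := fun n => f (p n)).
    assert (Ht : forall n, take w n = p n).
    { induction n; auto. rewrite take_S, IHn. reflexivity. }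
    destruct (HS w I) as (u & Hu & Hpu).
    apply (Hp (length u)). rewrite <- Ht, <- (path_eq_take _ _ Hpu).
    exists 0. intros x Hx _. now exists u. }
  destruct Hc as [N HN]. destruct (full_cover_mass S N [] HN) as [(s & _ & [t Ht] & Hne)|(l & Hl & Hx & Hs)].
  - destruct s; [congruence|discriminate].
  - assert (sumf wt l <= / 2)%R by (apply HM; auto; intros x Hi; now apply Hx).
    unfold wt in Hs at 2. simpl in Hs. lra.
Qed.

(** * Sets visited infinitely often, and Borel-Cantelli *)

Definition io (S : node -> Prop) (w : nat -> bool) : Prop :=
  forall n, exists t, n <= length t /\ path_of w t /\ S t.

Lemma io_sub (S S' : node -> Prop) w : (forall t, S t -> S' t) -> io S w -> io S' w.
Proof. intros H Hi n. destruct (Hi n) as (t & ? & ? & ?). exists t; auto. Qed.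

Lemma io_or (S S' : node -> Prop) w : io (fun t => S t \/ S' t) w -> io S w \/ io S' w.
Proof.
  intros H. apply NNPP. intros Hn. apply not_or_and in Hn. destruct Hn as [H1 H2].
  apply not_all_ex_not in H1, H2. destruct H1 as [n H1], H2 as [m H2].
  destruct (H (n + m)) as (t & Hl & Hp & [Hs|Hs]); [apply H1|apply H2]; exists t; repeat split; auto; lia.
Qed.

(* Layer [r] is hit with probability at most [2^-r]: Borel-Cantelli. *)
Lemma null_layers (G : nat -> node -> node -> Prop) :
  (forall r, antichain (fun x => exists y, G r x y)) ->
  (forall r x y y', G r x y -> G r x y' -> y = y') ->
  (forall r x y, G r x y -> length x + r <= length y) ->
  mu_null (fun w => forall n, exists r x y, n <= r /\ G r x y /\ path_of w y).
Proof.
  intros Ha Hf Hl. apply covered_null. intros eps He.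
  destruct (half_pow_small (eps / 2)%R ltac:(lra)) as [K HK].
  exists (fun y => exists r, exists x, G (K + S r) x y). split.
  - intros w Hw. destruct (Hw (S K)) as (r & x & y & Hr & Hg & Hp).
    exists y. split; auto. exists (r - S K), x. now replace (K + S (r - S K)) with r by lia.
  - apply mass_le_pow_union; auto. intros r.
    apply mass_le_sub with (S' := fun b => exists x, (exists y, G (K + S r) x y) /\ G (K + S r) x b).
    { intros b [x Hx]. eauto. }
    apply mass_le_union with (f := fun x => (wt x * (/ 2) ^ (K + S r))%R).
    2:{ intros l Hn Hx.
        assert (sumf (fun x => (/ 2) ^ (K + S r) * wt x) l <= eps * (/ 2) ^ S r)%R.
        2:{ eapply Rle_trans; [|exact H]. apply sumf_le. intros; lra. }
        rewrite sumf_scal.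
        assert (sumf wt l <= 1)%R.
        { apply (kraft (fun x => exists y, G (K + S r) x y) []); auto. intros x _. now exists x. }
        rewrite pow_add. pose proof (half_pow_pos (S r)). pose proof (half_pow_pos K).
        assert ((/ 2) ^ K * (/ 2) ^ S r > 0)%R by nra.
        apply Rle_trans with ((/ 2) ^ K * (/ 2) ^ S r)%R; nra. }
    intros x [y Hy]. apply mass_le_sub with (S' := fun z => z = y).
    { intros z Hz. eauto. }
    intros l Hn Hx. eapply Rle_trans; [eapply (mass_le_single wt y)|]; auto.
    { pose proof (wt_pos y); lra. }
    unfold wt. rewrite <- pow_add. apply half_pow_le. eauto.
Qed.

(** * Almost sure comparison of two nodes per round *)

Section Comparison.

(** [F u a b] names two nodes [a] and [b] of the round that starts at [u]; being at most [C] longer,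
    [a] has at least [2^-C] times the weight of [b]. By [F_nest] no other round begins on the way to
    them. *)
Variables (F : node -> node -> node -> Prop) (C : nat).
Hypothesis F_fun : forall u a b a' b', F u a b -> F u a' b' -> a = a' /\ b = b'.
Hypothesis F_pre : forall u a b, F u a b -> pre u a /\ pre u b.
Hypothesis F_len : forall u a b, F u a b -> length a <= length b + C.
Hypothesis F_dis : forall u a b, F u a b -> a = b \/ (~ pre a b /\ ~ pre b a).
Hypothesis F_nest : forall u a b u' a' b', F u a b -> F u' a' b' ->
  pre u u' -> u <> u' -> ~ pre u' a /\ ~ pre u' b.

(** Round [u] is a candidate for the next visit after [w]: no node of an earlier round is passed on
    the way to it. Rounds with [a = b] are left out, as there a visit to [b] is a visit to [a]. *)
Definition first_after (w u a b : node) : Prop :=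
  F u a b /\ a <> b /\ pre w u /\
  forall u' a' b', F u' a' b' -> pre w u' -> pre u' u -> u' <> u ->
    ~ pre a' u /\ ~ pre b' u.

Lemma pre_incomparable a b x y : ~ pre a b -> ~ pre b a -> pre a x -> pre b y -> ~ pre x y.
Proof.
  intros H1 H2 Ha Hb Hxy.
  assert (pre a y) by eauto using pre_trans.
  destruct (le_lt_dec (length a) (length b)).
  - apply H1. now apply pre_total with y.
  - apply H2. apply pre_total with y; auto. lia.
Qed.

(** Comparable nodes come from comparable starts. For equal starts [F_dis] applies. For nested ones,
    minimality keeps the earlier nodes off the way to the later start, and [F_nest] keeps the later
    start off the way to the earlier nodes. *)
Lemma first_after_antichain w :
  antichain (fun x => exists u a b, first_after w u a b /\ (x = a \/ x = b)).
Proof.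
  assert (Hlt : forall u a b u' a' b', first_after w u a b -> first_after w u' a' b' ->
    pre u u' -> u <> u' -> forall x y, x = a \/ x = b -> y = a' \/ y = b' ->
    ~ pre x y /\ ~ pre y x).
  { intros u a b u' a' b' (H & Hab & Hw & Hmin) (H' & Hab' & Hw' & Hmin') Hp Hne x y Hx Hy.
    destruct (F_nest _ _ _ _ _ _ H H' Hp Hne) as [N1 N2].
    destruct (Hmin' _ _ _ H Hw Hp Hne) as [M1 M2].
    assert (Hy' : pre u' y) by (destruct (F_pre _ _ _ H'); destruct Hy as [->| ->]; auto).
    assert (I1 : ~ pre x u') by (destruct Hx as [->| ->]; auto).
    assert (I2 : ~ pre u' x) by (destruct Hx as [->| ->]; auto).
    split.
    - apply (pre_incomparable x u'); auto using pre_refl.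
    - apply (pre_incomparable u' x); auto using pre_refl. }
  intros x y (u & a & b & H & Hx) (u' & a' & b' & H' & Hy) Hp.
  assert (Hux : pre u x).
  { destruct H as (H & _). destruct (F_pre _ _ _ H). destruct Hx as [->| ->]; auto. }
  assert (Huy : pre u' y).
  { destruct H' as (H' & _). destruct (F_pre _ _ _ H'). destruct Hy as [->| ->]; auto. }
  destruct (classic (u = u')) as [<-|Hne].
  - pose proof H as (K & Hab & _). pose proof H' as (K' & _).
    destruct (F_fun _ _ _ _ _ K K') as [<- <-].
    destruct (F_dis _ _ _ K) as [|[D1 D2]]; [contradiction|].
    destruct Hx as [->| ->], Hy as [->| ->]; auto; contradiction.
  - exfalso. assert (pre u y) by eauto using pre_trans.
    destruct (le_lt_dec (length u) (length u')).
    + assert (pre u u') by (apply pre_total with y; auto).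
      destruct (Hlt _ _ _ _ _ _ H H' H1 Hne x y); auto.
    + assert (pre u' u) by (apply pre_total with y; auto; lia).
      destruct (Hlt _ _ _ _ _ _ H' H H1 (not_eq_sym Hne) y x); auto.
Qed.

(** The largest share that [b] can have in the joint weight of [a] and [b] when [a] weighs at least
    [2^-C] times as much. *)
Definition theta : R := (/ (1 + (/ 2) ^ C))%R.

(** Adding to each listed [b] its partner [a] still gives an antichain beyond [w], so Kraft bounds
    the joint weight, of which the partners make up a fixed share. *)
Lemma first_after_mass w :
  mass_le wt (fun b => exists u a, first_after w u a b) (theta * wt w)%R.
Proof.
  intros l Hn Hl.
  assert (HA : forall b, exists a, In b l -> exists u, first_after w u a b).
  { intros b. destruct (classic (In b l)) as [Hb|Hb].
    - destruct (Hl b Hb) as (u & a & H). exists a. eauto.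
    - exists []. contradiction. }
  apply choice in HA. destruct HA as [f Hf].
  assert (Hu : forall u a b u' a' b' x, first_after w u a b -> first_after w u' a' b' ->
             x = a \/ x = b -> x = a' \/ x = b' -> u = u').
  { intros u a b u' a' b' x (H & _ & Hw & Hm) (H' & _ & Hw' & Hm') Hx Hx'.
    apply NNPP. intros Hne.
    assert (P : pre u x) by (destruct (F_pre _ _ _ H), Hx; subst; auto).
    assert (P' : pre u' x) by (destruct (F_pre _ _ _ H'), Hx'; subst; auto).
    destruct (le_lt_dec (length u) (length u')).
    - assert (Q : pre u u') by (apply pre_total with x; auto).
      destruct (F_nest _ _ _ _ _ _ H H' Q Hne). destruct Hx; subst; auto.
    - assert (Q : pre u' u) by (apply pre_total with x; auto; lia).
      destruct (F_nest _ _ _ _ _ _ H' H Q (not_eq_sym Hne)). destruct Hx'; subst; auto. }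
  assert (Hinj : forall b b', In b l -> In b' l -> f b = f b' -> b = b').
  { intros b b' Hb Hb' E. destruct (Hf b Hb) as [u H], (Hf b' Hb') as [u' H'].
    assert (u = u') by (eapply (Hu _ _ _ _ _ _ (f b)); eauto). subst u'.
    destruct H as (H & _), H' as (H' & _). now destruct (F_fun _ _ _ _ _ H H'). }
  assert (Hk : (sumf wt (l ++ map f l) <= wt w)%R).
  { apply (kraft _ w (first_after_antichain w)).
    - intros x (u & a & b & (H & _ & Hw & _) & Hx). destruct (F_pre _ _ _ H).
      destruct Hx as [->| ->]; eauto using pre_trans.
    - apply NoDup_app; auto.
      + apply NoDup_map_NoDup_ForallPairs; auto.
      + intros x Hx Hi. apply in_map_iff in Hi. destruct Hi as (b & E & Hb).
        destruct (Hf b Hb) as [u H]. destruct (Hf x Hx) as [u' H'].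
        assert (u = u') by (eapply (Hu _ _ _ _ _ _ x); eauto). subst u'.
        destruct H as (H & Hne & _), H' as (H' & _).
        destruct (F_fun _ _ _ _ _ H H'). congruence.
    - intros x Hx. apply in_app_iff in Hx. destruct Hx as [Hx|Hx].
      + destruct (Hf x Hx) as [u H]. eauto 6.
      + apply in_map_iff in Hx. destruct Hx as (b & <- & Hb).
        destruct (Hf b Hb) as [u H]. eauto 6. }
  rewrite sumf_app, sumf_map in Hk.
  assert (Hge : (sumf (fun b => (/ 2) ^ C * wt b) l <= sumf (fun b => wt (f b)) l)%R).
  { apply sumf_le. intros b Hb. unfold wt. rewrite <- pow_add. apply half_pow_le.
    destruct (Hf b Hb) as [u [H _]]. apply F_len in H. lia. }
  rewrite sumf_scal in Hge. unfold theta. pose proof (half_pow_pos C).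
  apply (Rmult_le_reg_l (1 + (/ 2) ^ C)); [lra|].
  rewrite <- Rmult_assoc, Rinv_r by lra. lra.
Qed.

(** A path that visits nodes [b] infinitely often but no [a] of a round beyond level [n] has a
    prefix of this kind for every [t], namely after [t] candidate rounds that all ended in [b]. *)
Fixpoint bad_prefix (n t : nat) : node -> Prop :=
  match t with
  | 0 => fun x => length x = n
  | S t => fun b => exists w, bad_prefix n t w /\ n <= length w /\ exists u a, first_after w u a b
  end.

Lemma bad_prefix_mass n t : mass_le wt (bad_prefix n t) (theta ^ t).
Proof.
  assert (Ht : (0 < theta)%R).
  { unfold theta. apply Rinv_0_lt_compat. pose proof (half_pow_pos C). lra. }
  induction t as [|t IH].
  - apply (kraft (bad_prefix n 0) []).
    + intros u v Hu Hv Hp. simpl in *. apply pre_antisym_length; auto. lia.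
    + intros x _. now exists x.
  - apply mass_le_sub with
      (S' := fun b => exists w, bad_prefix n t w /\ exists u a, first_after w u a b).
    { intros b (w & H & _ & H'). eauto. }
    apply mass_le_union with (f := fun w => (theta * wt w)%R).
    + intros w _. apply first_after_mass.
    + intros l Hn Hl. rewrite sumf_scal. cbn [pow].
      apply Rmult_le_compat_l; [lra|]. apply IH; auto.
Qed.

Lemma min_length (P : node -> Prop) :
  (exists u, P u) -> exists u, P u /\ forall v, P v -> length u <= length v.
Proof.
  intros [u Hu]. remember (length u) as n eqn:E. revert u E Hu.
  induction n as [n IH] using (well_founded_induction lt_wf). intros u -> Hu.
  destruct (classic (exists v, P v /\ length v < length u)) as [(v & Hv & Hl)|Hn].
  - eapply IH; eauto.
  - exists u. split; auto. intros v Hv. destruct (le_lt_dec (length u) (length v)); auto.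
    exfalso. eauto.
Qed.

(* After every visited [b(u)], the next of the two kinds of nodes to be visited is an
   [a(u)] with conditional probability at least [1 - theta]. *)
Lemma null_comparison :
  mu_null (fun w => (forall n, exists u a b, F u a b /\ n <= length u /\ path_of w b) /\
                    ~ (forall n, exists u a b, F u a b /\ n <= length u /\ path_of w a)).
Proof.
  apply null_sub with (N' := fun w => exists n,
    (forall m, exists u a b, F u a b /\ m <= length u /\ path_of w b) /\
    (forall u a b, F u a b -> n <= length u -> ~ path_of w a)).
  { intros w [H1 H2]. apply not_all_ex_not in H2. destruct H2 as [n Hn]. exists n.
    split; auto. intros u a b H Hl Hp. apply Hn. eauto 6. }
  apply null_union. intros n. apply covered_null. intros eps He.
  assert (Ht : (0 < theta < 1)%R).
  { unfold theta. pose proof (half_pow_pos C). split.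
    - apply Rinv_0_lt_compat. lra.
    - rewrite <- Rinv_1 at 2. apply Rinv_lt_contravar; lra. }
  destruct (pow_lt_1_zero theta) with (y := eps) as [T HT]; auto.
  { rewrite Rabs_pos_eq; lra. }
  specialize (HT T (le_n _)). rewrite Rabs_pos_eq in HT by (apply pow_le; lra).
  exists (bad_prefix n T). split.
  2:{ intros l Hn Hl. pose proof (bad_prefix_mass n T l Hn Hl). lra. }
  intros w [Hb Ha].
  enough (forall t, exists x, bad_prefix n t x /\ n <= length x /\ path_of w x) as H.
  { destruct (H T) as (x & ? & ? & ?). eauto. }
  induction t as [|t (x & Hx & Hl & Hp)].
  - exists (take w n). simpl. rewrite take_length. auto using take_path.
  (* The shortest later start whose [b] is visited is a candidate: an earlier visited [b]
     contradicts minimality, an earlier visited [a] the choice of [n]. *)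
  - destruct (min_length (fun u => exists a b, F u a b /\ length x <= length u /\ path_of w b))
      as (u & (a & b & H & Hlu & Hpb) & Hmin).
    { destruct (Hb (length x)) as (u & a & b & ?). eauto. }
    destruct (F_pre _ _ _ H) as [Hua Hub].
    assert (Hpu : path_of w u) by eauto using path_pre.
    exists b. split; [|split]; auto; [|apply pre_length in Hub; lia].
    exists x. split; [|split]; auto. exists u, a. split; [|split; [|split]]; auto.
    + intros <-. apply (Ha u a a); auto. lia.
    + eapply path_pre_length; eauto.
    + intros u' a' b' H' Hxu Huu Hne. split; intros Hp'.
      * apply (Ha _ _ _ H'); [apply pre_length in Hxu; lia|]. eauto using path_pre.
      * apply Hne. apply pre_antisym_length; auto. apply Hmin.
        exists a', b'. split; [|split]; auto. { now apply pre_length. } { eauto using path_pre. }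
Qed.

End Comparison.

(** * Labellings and soundness *)

Fixpoint odd_ones (u : node) : bool :=
  match u with [] => false | b :: u => xorb b (odd_ones u) end.

Definition even (u : node) : Prop := odd_ones u = false.

Lemma odd_ones_app u v : odd_ones (u ++ v) = xorb (odd_ones u) (odd_ones v).
Proof. induction u as [|[] u IH]; simpl; auto. rewrite IH. now destruct (odd_ones u), (odd_ones v). Qed.

Notation zeros i := (repeat false i).

Lemma odd_ones_zeros i : odd_ones (zeros i) = false.
Proof. induction i; auto. Qed.

Lemma even_zeros u i : even (u ++ zeros i) <-> even u.
Proof. unfold even. rewrite odd_ones_app, odd_ones_zeros. now destruct (odd_ones u). Qed.

Lemma zeros_S u i : u ++ zeros (S i) = (u ++ zeros i) ++ [false].
Proof. rewrite <- app_assoc. f_equal. now rewrite <- repeat_cons. Qed.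

Lemma zeros_add (u : node) i j : u ++ zeros (i + j) = (u ++ zeros i) ++ zeros j.
Proof. now rewrite repeat_app, app_assoc. Qed.

Definition zr (x y : node) : Prop := exists i, y = x ++ zeros i.

(** Beginning of a maximal zero run of either parity; [is_start] adds that the run consists of
    cells. *)
Definition start (u : node) : Prop := forall y, u <> y ++ [false].

Lemma zr_refl x : zr x x.
Proof. exists 0. now rewrite app_nil_r. Qed.

Lemma start_unique u u' i j :
  start u -> start u' -> u ++ zeros i = u' ++ zeros j -> u = u' /\ i = j.
Proof.
  intros Hu Hu'. revert j. induction i as [|i IH]; intros [|j] H.
  - rewrite !app_nil_r in H. auto.
  - rewrite zeros_S, app_nil_r in H. exfalso. eapply Hu; eauto.
  - rewrite zeros_S, app_nil_r in H. exfalso. eapply Hu'; eauto.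
  - rewrite !zeros_S in H. apply app_inj_tail in H. destruct H as [H _].
    destruct (IH _ H). auto.
Qed.

Lemma app_zeros_inj (u : node) i j : u ++ zeros i = u ++ zeros j -> i = j.
Proof. intros H. apply app_inv_head in H. apply (f_equal (@length bool)) in H. now rewrite !repeat_length in H. Qed.

Lemma start_exists x : exists u i, start u /\ x = u ++ zeros i.
Proof.
  induction x as [|b x IH] using rev_ind.
  - exists [], 0. split; auto. intros [|] H; discriminate.
  - destruct b.
    + exists (x ++ [true]), 0. split; [|now rewrite app_nil_r].
      intros y H. apply app_inj_tail in H. destruct H; discriminate.
    + destruct IH as (u & i & Hu & ->). exists u, (S i). split; auto. now rewrite zeros_S.
Qed.

Definition is_start (u : node) : Prop := even u /\ start u.

(** A union of whole zero runs; on the even nodes this amounts to a selection of rounds. *)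
Definition unif (Z : node -> Prop) : Prop := forall x, Z x <-> Z (x ++ [false]).

Definition runs (U : node -> Prop) (x : node) : Prop := exists u, U u /\ zr u x.

Lemma runs_unif U : (forall u, U u -> start u) -> unif (runs U).
Proof.
  intros HU x. split; intros (u & Uu & i & E).
  - exists u. split; auto. exists (S i). now rewrite zeros_S, E.
  - exists u. split; auto. destruct i as [|i].
    + rewrite app_nil_r in E. subst u. exfalso. eapply HU; eauto.
    + rewrite zeros_S in E. apply app_inj_tail in E. exists i. tauto.
Qed.

Lemma unif_zeros Z x i : unif Z -> (Z x <-> Z (x ++ zeros i)).
Proof.
  intros HZ. induction i as [|i IH]; [now rewrite app_nil_r|].
  rewrite zeros_S. rewrite <- (HZ (x ++ zeros i)). exact IH.
Qed.

Definition at_pos (U : node -> Prop) (p : nat) (c : node) : Prop :=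
  exists u, U u /\ c = u ++ zeros p.

Definition section (X : node -> Prop) : Prop :=
  forall x i, X x -> X (x ++ zeros i) -> i = 0.

Definition same_run (x y : node) : Prop := zr x y \/ zr y x.

Lemma same_run_start u i c : start u -> same_run (u ++ zeros i) c -> exists j, c = u ++ zeros j.
Proof.
  intros Hu [[k ->]|[k E]].
  - exists (i + k). now rewrite zeros_add.
  - destruct (start_exists c) as (v & j & Hv & ->). rewrite <- zeros_add in E.
    apply start_unique in E; auto. destruct E as [<- _]. eauto.
Qed.

Lemma at_pos_section U p : (forall u, U u -> start u) -> section (at_pos U p).
Proof.
  intros HU x i (u & Uu & ->) (v & Uv & E). rewrite <- zeros_add in E.
  apply start_unique in E; auto. lia.
Qed.

Lemma section_at_pos U X p : (forall u, U u -> start u) -> section X ->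
  (forall u, U u -> X (u ++ zeros p)) ->
  forall c, X c /\ runs U c <-> at_pos U p c.
Proof.
  intros HU HX Hp c. split.
  - intros [Xc (u & Uu & i & ->)]. exists u. split; auto. f_equal. f_equal.
    destruct (le_lt_dec p i).
    + replace i with (p + (i - p)) in Xc by lia. rewrite zeros_add in Xc.
      pose proof (HX _ _ (Hp u Uu) Xc). lia.
    + specialize (Hp u Uu). replace p with (i + (p - i)) in Hp by lia. rewrite zeros_add in Hp.
      pose proof (HX _ _ Xc Hp). lia.
  - intros (u & Uu & ->). split; auto. exists u. split; auto. now exists p.
Qed.

(* The cell [c] is hit by a path through [c] that turns right there and then goes
   left until a marked node. *)
Definition hit (Thr X : node -> Prop) (t : node) : Prop :=
  Thr t /\ exists c, X c /\ zr (c ++ [true]) t.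

Definition restr (X Z : node -> Prop) (c : node) : Prop := X c /\ Z c.

(** Meant to say that, round by round, the distances attached to [X] by [Thr] and to [Y] by [ThrM]
    agree up to a bounded error. Without [Z] the two events could both hold for unrelated
    reasons. *)
Definition eqv (Thr ThrM X Y : node -> Prop) : Prop :=
  forall Z, unif Z ->
    mu_null (fun w => ~ (io (hit Thr (restr X Z)) w <-> io (hit ThrM (restr Y Z)) w)).

(** [runs U] is uniform, so the restriction to these runs is absorbed by the quantified [Z]. *)
Lemma eqv_restr Thr ThrM X Y X' Y' U :
  (forall u, U u -> start u) -> eqv Thr ThrM X Y ->
  (forall c, X c /\ runs U c <-> X' c) -> (forall c, Y c /\ runs U c <-> Y' c) ->
  eqv Thr ThrM X' Y'.
Proof.
  intros HU H HX HY Z HZ.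
  assert (HZ' : unif (restr Z (runs U))).
  { intros x. unfold restr. rewrite (HZ x), (runs_unif U HU x). reflexivity. }
  apply null_sub with (2 := H _ HZ'). intros w Hw Hw'. apply Hw.
  assert (EX : restr X' Z = restr X (restr Z (runs U))).
  { apply functional_extensionality. intros c. apply propositional_extensionality.
    unfold restr. rewrite <- HX. tauto. }
  assert (EY : restr Y' Z = restr Y (restr Z (runs U))).
  { apply functional_extensionality. intros c. apply propositional_extensionality.
    unfold restr. rewrite <- HY. tauto. }
  now rewrite EX, EY.
Qed.

(** The exceptional paths, on which a round never ends. Off this null set a deep visited node forces
    a deep start of its round. *)
Definition zero_tail (w : nat -> bool) : Prop :=
  exists n, forall m, n <= m -> w m = false.

Lemma null_zero_tail : mu_null zero_tail.
Proof.
  apply null_sub with (N' := fun w => exists u, path_of w u /\ forall m, length u <= m -> w m = false).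
  { intros w [n Hn]. exists (take w n). split; [apply take_path|]. now rewrite take_length. }
  apply null_node_union. intros u. apply covered_null. intros eps He.
  destruct (half_pow_small eps He) as [K HK].
  exists (fun x => x = u ++ zeros K). split.
  - intros w [Hp Hz]. eexists. split; [reflexivity|]. intros i Hi.
    destruct (le_lt_dec (length u) i).
    + rewrite Hz, app_nth2 by auto. apply nth_repeat.
    + rewrite app_nth1 by auto. now apply Hp.
  - intros l Hn Hl. eapply Rle_trans; [apply (mass_le_single wt (u ++ zeros K)); auto; apply Rlt_le, wt_pos|].
    eapply Rle_trans; [|exact HK]. unfold wt. apply half_pow_le.
    rewrite length_app, repeat_length. lia.
Qed.

Lemma not_zero_tail w n : ~ zero_tail w -> exists p, n <= p /\ w p = true.
Proof.
  intros H. apply NNPP. intros Hn. apply H. exists n. intros m Hm.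
  destruct (w m) eqn:E; auto. exfalso. eauto.
Qed.

Lemma path_zeros_length w p c i :
  path_of w (c ++ zeros i) -> w p = true -> p < length (c ++ zeros i) -> p < length c.
Proof.
  intros Hp E Hl. destruct (le_lt_dec (length c) p); auto.
  specialize (Hp p Hl). rewrite app_nth2, nth_repeat in Hp by auto. congruence.
Qed.

(** Only zeros follow the turn, so a hit beyond a late [1] of the path has a turn that is at least
    as late as this [1]. *)
Lemma io_hit w Thr X : ~ zero_tail w -> io (hit Thr X) w -> io X w.
Proof.
  intros Hz H n. destruct (not_zero_tail w n Hz) as (p & Hp & E).
  destruct (H (S p)) as (t & Hl & Ht & _ & c & Xc & i & ->).
  exists c. pose proof (path_zeros_length _ _ _ _ Ht E ltac:(lia)) as Hc.
  rewrite length_app in Hc. simpl in Hc. split; [lia|]. split; auto.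
  apply path_pre with (1 := Ht). rewrite <- app_assoc. apply pre_app.
Qed.

(** * Horn rules and the conditions on a labelling *)

Inductive con : Type := CZero (v : nat) | CSucc (v w : nat) | CIn (v : nat).

(* A Horn rule over the natural numbers, whose variables are indices into an environment. *)
Record rule (T : Type) : Type := Rule
  { htag : T; hvars : list nat; body : list (T * list nat); cons_of : list con }.
Arguments Rule {T}.
Arguments htag {T}.
Arguments hvars {T}.
Arguments body {T}.
Arguments cons_of {T}.

Definition con_holds (n : nat) (env : nat -> nat) (c : con) : Prop :=
  match c with
  | CZero v => env v = 0
  | CSucc v w => env w = S (env v)
  | CIn v => env v = n
  end.

Definition input_set (n : nat) (c : node) : Prop := at_pos start n c.

Definition con_sem (P : node -> Prop) (M : nat -> node -> Prop) (c : con) : Prop :=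
  match c with
  | CZero v => forall x, M v x -> start x
  | CSucc v w => forall x y, M v x -> M w y -> same_run x y -> y = x ++ [false]
  | CIn v => forall x, M v x -> P x
  end.

Section Semantics.

Context {T : Type}.
Variables (rules : list (rule T)) (V : nat) (P : node -> Prop).
Variables (Act ThrM : node -> Prop) (Thr L : nat -> node -> Prop).

(** [B] contains the cells that justify a body atom. They lie strictly behind the cells of [Y],
    which makes justification well founded; their data must match the values of the variables. *)
Definition atom_sem (Y : node -> Prop) (M : nat -> node -> Prop) (B : node -> Prop)
    (at_ : T * list nat) : Prop :=
  section B /\
  (forall c, B c -> exists i r, nth_error rules i = Some r /\ htag r = fst at_ /\
                      length (hvars r) = length (snd at_) /\ L i c) /\
  (forall y, Y y -> exists i, B (y ++ zeros (S i))) /\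
  (forall a v, nth_error (snd at_) a = Some v -> eqv (Thr a) ThrM B (M v)).

(** [Y] takes at most one cell per run, since [eqv] can only compare single cells. [M v] gives the
    value of variable [v] as a cell of the same run, and [B k] the justification of the atom number
    [k]. *)
Definition clause_sem (i : nat) (r : rule T) : Prop :=
  forall Y, (forall y, Y y -> L i y) -> section Y ->
  exists M B : nat -> node -> Prop,
    (forall v, v < V -> section (M v) /\ (forall c, M v c -> Act c) /\
       (forall y, Y y -> exists c, M v c /\ same_run y c)) /\
    (forall k at_, nth_error (body r) k = Some at_ -> atom_sem Y M (B k) at_) /\
    (forall c, In c (cons_of r) -> con_sem P M c) /\
    (forall a v, nth_error (hvars r) a = Some v -> eqv (Thr a) ThrM Y (M v)).

(** Excludes active parts of growing length: by Borel-Cantelli a path would get past only finitely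
    many of them to an inactive cell. *)
Definition bounded_cond : Prop :=
  forall Z, unif Z ->
    mu_null (fun w => io (restr even Z) w /\ ~ io (fun c => restr even Z c /\ ~ Act c) w).

(** Makes the set of all starts large in the sense used for soundness, with the whole space as the
    witness. *)
Definition thick_cond : Prop :=
  forall Y, (forall y, Y y -> Act y) -> (forall u, is_start u -> exists y, Y y /\ zr u y) ->
    mu_null (fun w => ~ io (hit ThrM Y) w).

(** Two positions that [eqv] cannot tell apart are hit infinitely often with probability zero only,
    which largeness will exclude. This lets a position serve as the name of a value. *)
Definition distinct_cond : Prop :=
  forall X Y, (forall x, X x -> Act x) -> (forall y, Y y -> Act y) -> section X -> section Y ->
    (forall x, X x -> exists i, Y (x ++ zeros (S i))) ->
    (forall Z, unif Z ->
       mu_null (fun w => ~ (io (hit ThrM (restr X Z)) w -> io (hit ThrM (restr Y Z)) w))) ->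
    mu_null (io (hit ThrM X)).

Record labelling_ok : Prop := {
  act_even : forall c, Act c -> even c;
  act_closed : forall x, Act (x ++ [false]) -> Act x;
  act_finite : forall x, even x -> exists i, ~ Act (x ++ zeros i);
  label_act : forall i c, i < length rules -> L i c -> Act c;
  label_goal : forall u, is_start u -> L 0 u;
  ok_bounded : bounded_cond;
  ok_thick : thick_cond;
  ok_distinct : distinct_cond;
  ok_clause : forall i r, nth_error rules i = Some r -> clause_sem i r }.

Definition vars_bounded : Prop :=
  forall r, In r rules ->
    (forall v, In v (hvars r) -> v < V) /\
    (forall at_, In at_ (body r) -> forall v, In v (snd at_) -> v < V) /\
    (forall c, In c (cons_of r) ->
       match c with CZero v | CIn v => v < V | CSucc v w => v < V /\ w < V end).

End Semantics.

(** * Soundness: a derivation extracted from a labelling *)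

Section Soundness.

Context {T : Type}.
Variables (rules : list (rule T)) (V n : nat).
Variables (Act ThrM : node -> Prop) (Thr L : nat -> node -> Prop).
Hypothesis ok : labelling_ok rules V (input_set n) Act ThrM Thr L.
Hypothesis Hvars : vars_bounded rules V.

(* The family of large sets of runs behaves like an ultrafilter: if a large set is split
   into finitely many pieces, one of the pieces is large. *)
Definition large (U : node -> Prop) : Prop :=
  (forall u, U u -> is_start u) /\
  exists G : (nat -> bool) -> Prop, ~ mu_null G /\
    forall Y, (forall y, Y y -> Act y) -> (forall u, U u -> exists y, Y y /\ zr u y) ->
      mu_null (fun w => G w /\ ~ io (hit ThrM Y) w).

Lemma io_hit_or X Y w :
  io (hit ThrM (fun c => X c \/ Y c)) w -> io (hit ThrM X) w \/ io (hit ThrM Y) w.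
Proof.
  intros H. apply io_or. apply io_sub with (2 := H).
  intros t [Ht (c & [Hc|Hc] & Hz)]; [left|right]; split; eauto.
Qed.

Lemma large_inhabited U : large U -> exists u, U u.
Proof.
  intros (_ & G & HG & H). apply NNPP. intros Hn. apply HG.
  apply null_sub with (2 := H (fun _ => False) ltac:(intros y []) ltac:(intros u Hu; exfalso; eauto)).
  intros w Hw. split; auto. intros Hi. destruct (Hi 0) as (t & _ & _ & _ & c & [] & _).
Qed.

(** If a choice [Y1] on the first piece fails on a non-null part of [G], this part witnesses that
    the second piece is large: [Y1] and any [Y2] form a choice on [U], and where [Y1] fails the hits
    come from [Y2]. *)
Lemma large_split U U1 U2 :
  large U -> (forall u, U u -> U1 u \/ U2 u) ->
  large (restr U U1) \/ large (restr U U2).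
Proof.
  intros (HU & G & HG & H) Hs.
  destruct (classic (large (restr U U1))) as [|Hn]; [now left|right].
  split; [intros u [Hu _]; auto|].
  apply NNPP. intros Hn2. apply Hn. split; [intros u [Hu _]; auto|].
  exists G. split; auto. intros Y1 HA1 HY1.
  apply NNPP. intros HG1. apply Hn2. eexists. split; [exact HG1|].
  intros Y2 HA2 HY2. simpl.
  apply null_sub with (2 := H (fun c => Y1 c \/ Y2 c) ltac:(intros y [|]; auto)
    ltac:(intros u Hu; destruct (Hs u Hu);
          [destruct (HY1 u (conj Hu H0)) as (y & ? & ?)|destruct (HY2 u (conj Hu H0)) as (y & ? & ?)];
          eauto)).
  intros w [[Hg H1] H2]. split; auto. intros Hi. apply io_hit_or in Hi. tauto.
Qed.

Lemma large_refine (Q : node -> nat -> Prop) K U :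
  large U -> (forall u, U u -> exists j, j < K /\ Q u j) ->
  exists j, j < K /\ large (fun u => U u /\ Q u j).
Proof.
  revert U. induction K as [|K IH]; intros U HU HQ.
  - destruct (large_inhabited U HU) as [u Hu]. destruct (HQ u Hu) as (j & Hj & _). lia.
  - destruct (large_split U (fun u => exists j, j < K /\ Q u j) (fun u => Q u K) HU) as [H|H].
    + intros u Hu. destruct (HQ u Hu) as (j & Hj & Hq).
      destruct (Nat.eq_dec j K) as [->|]; [now right|left]. exists j. split; auto. lia.
    + destruct (IH _ H) as (j & Hj & Hl). { intros u [_ Hu]. auto. }
      exists j. split; [lia|]. destruct Hl as (Hl & G & HG & Hl2).
      split; [intros u [Hu _]; apply HU; auto|]. exists G. split; auto.
      intros Y HA HY. apply Hl2; auto. intros u [[Hu _] Hq]. apply HY. auto.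
    + exists K. split; auto.
Qed.

Definition longer (K : nat) (u : node) : Prop := is_start u /\ Act (u ++ zeros K).

(** Each path meets a layer at most once, and the required active length grows with the layer, so
    that Borel-Cantelli applies to the runs of [r] zeros from layer [r]. *)
Fixpoint layer (r : nat) : node -> Prop :=
  match r with
  | 0 => fun u => u = []
  | S r => fun u => longer (S r) u /\ exists v, layer r v /\ pre v u /\ v <> u /\
             forall x, longer (S r) x -> pre v x -> x <> v -> pre x u -> x = u
  end.

Lemma root_is_start : is_start [].
Proof. split; [reflexivity|]. intros [|] H; discriminate. Qed.

Lemma goal_act u : rules <> [] -> is_start u -> Act u.
Proof.
  intros Hr Hu. apply (label_act _ _ _ _ _ _ _ ok 0); [|now apply (label_goal _ _ _ _ _ _ _ ok)].
  destruct rules; [congruence|simpl; lia].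
Qed.

Lemma layer_longer r u : rules <> [] -> layer r u -> longer r u.
Proof.
  intros Hr H. destruct r; simpl in H; [|tauto]. subst u.
  split; [apply root_is_start|]. apply goal_act; auto. apply root_is_start.
Qed.

Lemma layer_antichain r : antichain (layer r).
Proof.
  induction r as [|r IH]; intros u u'.
  - simpl. congruence.
  - intros (Hu & v & Hv & Hp & Hne & Hm) (Hu' & v' & Hv' & Hp' & Hne' & Hm') Hpre.
    assert (v = v').
    { assert (Hvu : pre v u') by eauto using pre_trans.
      destruct (le_lt_dec (length v) (length v')).
      - apply IH; auto. now apply pre_total with u'.
      - symmetry. apply IH; auto. apply pre_total with u'; auto. lia. }
    subst v'. apply Hm'; auto.
Qed.

Lemma layer_ancestor r m v : layer (S r + m) v -> exists u, layer r u /\ pre u v /\ u <> v.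
Proof.
  revert v. induction m as [|m IH]; intros v.
  - rewrite Nat.add_0_r. intros (_ & u & Hu & Hp & Hne & _). eauto.
  - replace (S r + S m) with (S (S r + m)) by lia. intros (_ & x & Hx & Hp & Hne & _).
    destruct (IH x Hx) as (u & Hu & Hpu & Hneu). exists u. split; auto.
    split; [eauto using pre_trans|]. intros ->. apply Hne. apply pre_antisym_length; auto.
    now apply pre_length.
Qed.

Lemma layer_on_path w r :
  (forall K, io (longer K) w) -> exists u, layer r u /\ path_of w u /\ r <= length u.
Proof.
  intros Hw. induction r as [|r (v & Hv & Hp & Hl)].
  - exists []. split; [reflexivity|]. split; [|auto]. intros i Hi. simpl in Hi. lia.
  - destruct (min_length (fun u => longer (S r) u /\ path_of w u /\ S (length v) <= length u))
      as (u & (Hu & Hpu & Hlu) & Hm).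
    { destruct (Hw (S r) (S (length v))) as (u & ? & ? & ?). eauto. }
    exists u. split; [|split; auto; lia]. split; auto. exists v. split; auto.
    split; [apply path_pre_length with w; auto; lia|].
    split; [intros ->; lia|].
    intros x Hx Hvx Hne Hxu. apply pre_antisym_length; auto. apply Hm.
    split; [auto|split]; [eauto using path_pre|].
    destruct (le_lt_dec (length x) (length v)); auto.
    exfalso. apply Hne. symmetry. now apply pre_antisym_length.
Qed.

Lemma act_below u i j : Act (u ++ zeros i) -> ~ Act (u ++ zeros j) -> i < j.
Proof.
  intros Hi Hj. destruct (le_lt_dec j i); auto. exfalso. apply Hj. revert Hi.
  replace i with (j + (i - j)) by lia. rewrite zeros_add.
  generalize (i - j) (u ++ zeros j). clear - ok. intros k y.
  induction k as [|k IH]; [now rewrite app_nil_r|]. rewrite zeros_S. intros H.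
  apply IH. now apply (act_closed _ _ _ _ _ _ _ ok).
Qed.

(** Otherwise almost every path meets all layers. By Borel-Cantelli only finitely many visited
    starts of a layer [r] are followed by [r] zeros, while [bounded_cond] asks for inactive cells
    behind infinitely many of them, and these lie beyond [r] zeros. *)
Lemma long_runs_null :
  rules <> [] -> ~ (forall K, mu_null (fun w => ~ io (longer K) w)).
Proof.
  intros Hr Hlong. apply full_not_null.
  set (Z := runs (fun u => exists r, layer r u)).
  assert (HZs : forall u, (exists r, layer r u) -> is_start u).
  { intros u [r Hu]. now destruct (layer_longer r u Hr Hu). }
  assert (HZ : unif Z). { apply runs_unif. intros u Hu. now apply HZs. }
  pose proof (ok_bounded _ _ _ _ _ _ _ ok Z HZ) as HK.
  assert (HL : mu_null (fun w => forall m, exists r x y,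
             m <= r /\ (layer r x /\ y = x ++ zeros r) /\ path_of w y)).
  { apply (null_layers (fun r x y => layer r x /\ y = x ++ zeros r)).
    - intros r u v (y & Hu & _) (z & Hv & _). now apply (layer_antichain r).
    - intros r x y y' [_ ->] [_ ->]. auto.
    - intros r x y [_ ->]. rewrite length_app, repeat_length. lia. }
  apply null_sub with (2 := null_or _ _ (null_or _ _ (null_union _ Hlong) null_zero_tail) (null_or _ _ HK HL)).
  intros w _. apply NNPP. intros Hn. apply not_or_and in Hn. destruct Hn as [Hn1 Hn2].
  apply not_or_and in Hn1, Hn2. destruct Hn1 as [Hn1 Hz], Hn2 as [Hn2 Hn3].
  assert (Hio : forall K, io (longer K) w).
  { intros K. apply NNPP. intros H. apply Hn1. now exists K. }
  apply Hn3. intros m.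
  destruct (layer_on_path w m Hio) as (v & Hv & Hpv & _).
  destruct (not_zero_tail w (length v) Hz) as (p & Hp & Ep).
  assert (HioZ : io (fun c => restr even Z c /\ ~ Act c) w).
  { apply NNPP. intros H. apply Hn2. split; auto. intros k.
    destruct (layer_on_path w k Hio) as (u & Hu & Hpu & Hlu). exists u.
    split; auto. split; auto. split.
    - apply HZs. eauto.
    - exists u. split; [eauto|apply zr_refl]. }
  destruct (HioZ (S p)) as (x & Hlx & Hpx & [_ (u & [r Hu] & i & ->)] & Hna).
  pose proof (path_zeros_length _ _ _ _ Hpx Ep Hlx) as Hpu.
  (* A visited start deeper than the member [v] of layer [m] cannot belong to a lower layer, as that
     layer was already met before [v]. *)
  assert (Hmr : m <= r).
  { destruct (le_lt_dec m r); auto. exfalso.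
    replace m with (S r + (m - S r)) in Hv by lia.
    destruct (layer_ancestor _ _ _ Hv) as (u' & Hu' & Hp' & _).
    assert (Hpu2 : path_of w u) by (eapply path_pre; eauto using pre_app).
    assert (pre u' u).
    { apply path_pre_length with w; eauto using path_pre. apply pre_length in Hp'. lia. }
    assert (u' = u) by (apply (layer_antichain r); auto). subst u'.
    apply pre_length in Hp'. lia. }
  assert (Hri : r <= i).
  { destruct (layer_longer r u Hr Hu) as [_ Ha]. apply Nat.lt_le_incl. now apply (act_below u). }
  exists r, u, (u ++ zeros r). split; auto. split; auto.
  apply path_pre with (1 := Hpx). replace i with (r + (i - r)) by lia.
  rewrite zeros_add. apply pre_app.
Qed.

(** The witness [G] consists of the paths that meet only finitely many starts with active length
    beyond [K]. A choice on the short runs is completed by the starts of the long ones, whose hits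
    do not recur on [G]. *)
Lemma large_bounded : rules <> [] -> exists K, large (fun u => is_start u /\ ~ Act (u ++ zeros K)).
Proof.
  intros Hr. apply NNPP. intros Hn. apply (long_runs_null Hr). intros K.
  apply NNPP. intros HG. apply Hn. exists K. split; [tauto|].
  eexists. split; [exact HG|]. intros Y HA HY. simpl.
  assert (HT : mu_null (fun w => ~ io (hit ThrM (fun c => Y c \/ longer K c)) w)).
  { apply (ok_thick _ _ _ _ _ _ _ ok).
    - intros y [Hy|[Hy _]]; auto. now apply goal_act.
    - intros u Hu. destruct (classic (Act (u ++ zeros K))) as [Ha|Ha].
      + exists u. split; [right; split; auto|apply zr_refl].
      + destruct (HY u (conj Hu Ha)) as (y & ? & ?). eauto. }
  apply null_sub with (2 := null_or _ _ HT null_zero_tail).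
  intros w [H1 H2]. destruct (classic (zero_tail w)) as [|Hz]; [now right|left].
  intros Hi. apply io_hit_or in Hi. destruct Hi as [Hi|Hi]; auto.
  apply H1. now apply io_hit with (2 := Hi).
Qed.

Lemma large_sub_start U u : large U -> U u -> start u.
Proof. intros [H _] Hu. now apply H. Qed.

(** Both positions are equivalent to the same cells and hence to each other; [ok_distinct] then
    contradicts largeness at the smaller one. *)
Lemma eqv_unique Thr' U p j j' :
  large U -> (forall u, U u -> Act (u ++ zeros j)) -> (forall u, U u -> Act (u ++ zeros j')) ->
  eqv Thr' ThrM (at_pos U p) (at_pos U j) -> eqv Thr' ThrM (at_pos U p) (at_pos U j') -> j = j'.
Proof.
  intros HU.
  assert (Hlt : forall j j', j < j' -> (forall u, U u -> Act (u ++ zeros j)) ->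
    (forall u, U u -> Act (u ++ zeros j')) ->
    eqv Thr' ThrM (at_pos U p) (at_pos U j) -> eqv Thr' ThrM (at_pos U p) (at_pos U j') -> False).
  { clear j j'. intros j j' Hjj Ha Ha' He He'.
    assert (Hio : mu_null (io (hit ThrM (at_pos U j)))).
    { apply (ok_distinct _ _ _ _ _ _ _ ok) with (Y := at_pos U j').
      - intros x (u & Uu & ->). auto.
      - intros x (u & Uu & ->). auto.
      - apply at_pos_section. eauto using large_sub_start.
      - apply at_pos_section. eauto using large_sub_start.
      - intros x (u & Uu & ->). exists (j' - S j). rewrite <- zeros_add. exists u.
        split; auto. do 2 f_equal. lia.
      - intros Z HZ. apply null_sub with (2 := null_or _ _ (He Z HZ) (He' Z HZ)).
        intros w Hw. tauto. }
    destruct HU as (_ & G & HG & H). apply HG.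
    apply null_sub with (2 := null_or _ _ Hio (H (at_pos U j)
      ltac:(intros x (u & Uu & ->); auto)
      ltac:(intros u Hu; exists (u ++ zeros j); split; [exists u; auto|exists j; auto]))).
    intros w Hw. destruct (classic (io (hit ThrM (at_pos U j)) w)); auto. }
  intros Ha Ha' He He'. destruct (lt_eq_lt_dec j j') as [[H|H]|H]; auto; exfalso; eauto.
Qed.

(** An arbitrary model of the rules; it will be instantiated by the intended meaning of the tags. *)
Variable I : T -> list nat -> Prop.
Hypothesis I_closed : forall r env, In r rules ->
  (forall c, In c (cons_of r) -> con_holds n env c) ->
  (forall at_, In at_ (body r) -> I (fst at_) (map env (snd at_))) ->
  I (htag r) (map env (hvars r)).

(** One application of the pigeonhole principle per variable makes its value constant on a large
    subset. *)
Lemma large_env (M : nat -> node -> Prop) K m U :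
  large U -> (forall u v, U u -> v < m -> exists j, j < K /\ M v (u ++ zeros j)) ->
  exists U' env, large U' /\ (forall u, U' u -> U u) /\
    forall v, v < m -> forall u, U' u -> M v (u ++ zeros (env v)).
Proof.
  revert U. induction m as [|m IH]; intros U HU HM.
  - exists U, (fun _ => 0). split; auto. split; auto. intros; lia.
  - destruct (large_refine (fun u j => M m (u ++ zeros j)) K U HU) as (j & Hj & HU1).
    { intros u Hu. apply HM; auto. }
    destruct (IH _ HU1) as (U' & env & HU' & Hs & He).
    { intros u v [Hu _] Hv. apply HM; auto. }
    exists U', (fun v => if Nat.eqb v m then j else env v). split; auto. split.
    + intros u Hu. now apply Hs.
    + intros v Hv u Hu. destruct (Nat.eqb_spec v m) as [->|Hne].
      * now apply Hs.
      * apply He; auto. lia.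
Qed.

Section Induction.

Variable K : nat.

(** Quantified over [U], because every use of the induction hypothesis happens on a smaller large
    set. The induction runs downwards from [K], body atoms being found at larger positions. *)
Definition derives (x : nat) : Prop :=
  forall i r U, nth_error rules i = Some r -> large U ->
    (forall u, U u -> ~ Act (u ++ zeros K)) ->
    (forall u, U u -> L i (u ++ zeros x)) ->
    exists U' vals, large U' /\ (forall u, U' u -> U u) /\ length vals = length (hvars r) /\
      (forall a j, nth_error vals a = Some j ->
         eqv (Thr a) ThrM (at_pos U' x) (at_pos U' j) /\ forall u, U' u -> Act (u ++ zeros j)) /\
      I (htag r) vals.

(** The pigeonhole principle fixes the position [p] and the rule of the justifying cell. The
    induction hypothesis gives the values of its head, and [eqv_unique] identifies them with those
    of [env]. *)
Lemma atoms_derived x r M B env atoms U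
  (IH : forall y, x < y -> y < K -> derives y) :
  In r rules -> (forall at_, In at_ atoms -> In at_ (body r)) ->
  large U -> (forall u, U u -> ~ Act (u ++ zeros K)) ->
  (forall v, v < V -> section (M v) /\ (forall c, M v c -> Act c)) ->
  (forall v, v < V -> forall u, U u -> M v (u ++ zeros (env v))) ->
  (forall k at_, nth_error atoms k = Some at_ ->
     atom_sem rules ThrM Thr L (at_pos U x) M (B k) at_) ->
  forall at_, In at_ atoms -> I (fst at_) (map env (snd at_)).
Proof.
  intros Hr Hat HU HK HM Henv HB [tg vs] Hin.
  destruct (In_nth_error _ _ Hin) as [k Hk]. destruct (HB k _ Hk) as (Hsec & Hlab & Htot & Heq).
  cbn [fst snd] in *.
  destruct (large_refine (fun u j => x < j /\ B k (u ++ zeros j)) K U HU) as (p & Hp & HU1).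
  { intros u Hu. destruct (Htot (u ++ zeros x)) as [j Hj]. { now exists u. }
    rewrite <- zeros_add in Hj. exists (x + S j). split; [|split; [lia|auto]].
    apply (act_below u); auto. destruct (Hlab _ Hj) as (i' & r' & Hi' & _ & _ & HL).
    eapply (label_act _ _ _ _ _ _ _ ok); [|exact HL].
    apply nth_error_Some. congruence. }
  destruct (large_inhabited _ HU1) as (u0 & _ & Hxp & _).
  destruct (large_refine (fun u i => exists r', nth_error rules i = Some r' /\ htag r' = tg /\
              length (hvars r') = length vs /\ L i (u ++ zeros p)) (length rules) _ HU1)
    as (i & Hi & HU2).
  { intros u (_ & _ & Hu). destruct (Hlab _ Hu) as (i & r' & Hi & H). exists i.
    split; [|now exists r']. apply nth_error_Some. congruence. }
  destruct (large_inhabited _ HU2) as (u1 & _ & r' & Hr' & <- & Hlen & _).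
  destruct (IH p Hxp Hp i r' _ Hr' HU2) as (U' & vals & HU' & Hs & Hlv & Hv & HI).
  { intros u [[Hu _] _]. auto. }
  { intros u [_ (r2 & _ & _ & _ & H)]. auto. }
  assert (HsU : forall u, U' u -> U u).
  { intros u Hu. now apply Hs in Hu. }
  replace (map env vs) with vals; auto.
  apply nth_error_ext. intros a. rewrite nth_error_map.
  destruct (nth_error vs a) as [v|] eqn:Ev.
  2:{ simpl. apply nth_error_None. apply nth_error_None in Ev. lia. }
  simpl. destruct (nth_error vals a) as [j|] eqn:Ej.
  2:{ exfalso. apply nth_error_None in Ej. assert (a < length vs) by (apply nth_error_Some; congruence). lia. }
  f_equal. destruct (Hv a j Ej) as [He Ha].
  assert (HvV : v < V).
  { destruct (Hvars r Hr) as (_ & Hb & _). apply (Hb (htag r', vs)); auto.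
    now apply nth_error_In with a. }
  destruct (HM v HvV) as [Hsv Hav].
  apply eqv_unique with (Thr' := Thr a) (U := U') (p := p); auto.
  apply eqv_restr with (X := B k) (Y := M v) (U := U'); eauto using large_sub_start.
  - apply section_at_pos; eauto using large_sub_start.
    intros u Hu. apply Hs in Hu. destruct Hu as [(_ & _ & Hu) _]. exact Hu.
  - apply section_at_pos; eauto using large_sub_start.
Qed.

Lemma derives_all x : derives x.
Proof.
  remember (K - x) as d eqn:Ed. revert x Ed.
  induction d as [d IHd] using (well_founded_induction lt_wf). intros x Ed.
  assert (IH : forall y, x < y -> y < K -> derives y).
  { intros y H1 H2. apply (IHd (K - y)); auto. lia. }
  clear IHd Ed. intros i r U Hi HU HK HL.
  assert (Hst : forall u, U u -> start u) by eauto using large_sub_start.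
  destruct (ok_clause _ _ _ _ _ _ _ ok i r Hi (at_pos U x)) as (M & B & HM & HB & HC & HE).
  { intros y (u & Uu & ->). auto. }
  { now apply at_pos_section. }
  assert (Hr : In r rules) by (eapply nth_error_In; eauto).
  destruct (large_env M K V U HU) as (U' & env & HU' & Hs & Henv).
  { intros u v Hu Hv. destruct (HM v Hv) as (_ & Ha & Ht).
    destruct (Ht (u ++ zeros x)) as (c & Hc & Hsr). { now exists u. }
    destruct (same_run_start _ _ _ (Hst u Hu) Hsr) as [j ->]. exists j. split; auto.
    apply (act_below u); auto. }
  assert (HsecM : forall v, v < V -> section (M v)) by (intros v Hv; now apply HM).
  assert (Hst' : forall u, U' u -> start u) by eauto.
  exists U', (map env (hvars r)). split; auto. split; auto. split; [apply length_map|].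
  split.
  - intros a j Hj. rewrite nth_error_map in Hj.
    destruct (nth_error (hvars r) a) as [v|] eqn:Ev; [|discriminate]. simpl in Hj.
    injection Hj as <-.
    assert (HvV : v < V).
    { destruct (Hvars r Hr) as (Hb & _). apply Hb. now apply nth_error_In with a. }
    split.
    + apply eqv_restr with (X := at_pos U x) (Y := M v) (U := U'); auto.
      * apply section_at_pos; auto. { now apply at_pos_section. }
        intros u Hu. exists u. auto.
      * apply section_at_pos; auto.
    + intros u Hu. destruct (HM v HvV) as (_ & Ha & _). auto.
  - apply I_closed; auto.
    + intros c Hc. specialize (HC c Hc). destruct (Hvars r Hr) as (_ & _ & Hb).
      specialize (Hb c Hc). destruct (large_inhabited _ HU') as [u Hu].
      destruct c as [v|v v'|v]; simpl in *.
      * specialize (HC _ (Henv v Hb u Hu)). destruct (env v) as [|j]; auto.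
        exfalso. rewrite zeros_S in HC. eapply HC; eauto.
      * destruct Hb as [Hv Hv'].
        assert (E : u ++ zeros (env v') = (u ++ zeros (env v)) ++ [false]).
        { apply HC; auto. destruct (le_lt_dec (env v) (env v')).
          - left. exists (env v' - env v). rewrite <- zeros_add. do 2 f_equal. lia.
          - right. exists (env v - env v'). rewrite <- zeros_add. do 2 f_equal. lia. }
        rewrite <- zeros_S in E. now apply app_zeros_inj in E.
      * destruct (HC _ (Henv v Hb u Hu)) as (u' & Hu' & E).
        apply start_unique in E; auto. tauto.
    + apply (atoms_derived x r M B env (body r) U' IH); auto.
      * intros v Hv. destruct (HM v Hv) as (? & ? & _). auto.
      * intros k at_ Hk. destruct (HB k at_ Hk) as (H1 & H2 & H3 & H4).
        split; [auto|split; [auto|split; auto]].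
        intros y (u & Hu & ->). apply H3. exists u. auto.
Qed.

End Induction.

Theorem soundness r0 :
  nth_error rules 0 = Some r0 -> exists vals, length vals = length (hvars r0) /\ I (htag r0) vals.
Proof.
  intros H0. destruct large_bounded as [K HK]. { intros E. rewrite E in H0. discriminate. }
  destruct (derives_all K 0 0 r0 _ H0 HK) as (U' & vals & _ & _ & Hl & _ & HI).
  - tauto.
  - intros u [Hu _]. rewrite app_nil_r. now apply (label_goal _ _ _ _ _ _ _ ok).
  - eauto.
Qed.

End Soundness.

(** * Labellings built from certificates *)

Lemma pre_zeros u s x i : pre x (u ++ zeros i) -> x = u ++ s -> exists j, x = u ++ zeros j.
Proof.
  intros [t Ht] ->. exists (length s). f_equal.
  rewrite <- app_assoc in Ht. apply app_inv_head in Ht.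
  revert s Ht. induction i as [|i IH]; intros [|b s] H; simpl in *; try discriminate; auto.
  injection H as <- H. f_equal. now apply IH.
Qed.

Lemma pre_app_inv x c t : pre x (c ++ t) -> pre x c \/ pre c x.
Proof.
  intros Hx. destruct (le_lt_dec (length x) (length c)).
  - left. apply pre_total with (c ++ t); auto using pre_app.
  - right. apply pre_total with (c ++ t); auto using pre_app. lia.
Qed.

Lemma start_between u x i : start x -> pre u x -> pre x (u ++ zeros i) -> x = u.
Proof.
  intros Hx [s Hs] Hp. destruct (pre_zeros u s x i Hp Hs) as [j ->].
  destruct j; [apply app_nil_r|]. rewrite zeros_S in Hx. exfalso. eapply Hx; eauto.
Qed.

Lemma even_one c : even c -> ~ even (c ++ [true]).
Proof. unfold even. rewrite odd_ones_app. intros ->. discriminate. Qed.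

(** Parity: after the turn the nodes of the arm are odd, and before it every cell other than the
    first ends in zero. *)
Lemma round_nest u u' j i :
  is_start u -> is_start u' -> pre u u' -> pre u' ((u ++ zeros j ++ [true]) ++ zeros i) -> u' = u.
Proof.
  intros [Eu Su] [Eu' Su'] Hp H.
  destruct (pre_app_inv u' (u ++ zeros j ++ [true]) (zeros i) H) as [Hq|Hq].
  - assert (H' : pre u' (u ++ zeros j)).
    { destruct Hq as [s Hs]. destruct s as [|b s] using rev_ind.
      - rewrite app_nil_r, app_assoc in Hs. subst u'. exfalso.
        revert Eu'. apply even_one. now apply even_zeros.
      - rewrite !app_assoc in Hs. apply app_inj_tail in Hs. destruct Hs as [-> _]. apply pre_app. }
    now apply start_between with j.
  - assert (E : u' = u ++ zeros j ++ [true]) by now apply start_between with i.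
    subst u'. exfalso. rewrite app_assoc in Eu'. revert Eu'. apply even_one. now apply even_zeros.
Qed.

Lemma node_round x :
  exists u j, is_start u /\
    (x = u ++ zeros j \/ exists i, x = (u ++ zeros j ++ [true]) ++ zeros i).
Proof.
  induction x as [|b x IH] using rev_ind.
  - exists [], 0. split; [apply root_is_start|]. now left.
  - destruct IH as (u & j & Hu & [->|[i ->]]).
    + destruct b.
      * exists u, j. split; auto. right. exists 0. now rewrite app_nil_r, app_assoc.
      * exists u, (S j). split; auto. left. now rewrite zeros_S.
    + destruct b.
      * eexists (_ ++ [true]), 0. split; [|left; now rewrite app_nil_r]. split.
        -- destruct Hu as [Eu _]. unfold even in *.
           rewrite !odd_ones_app, !odd_ones_zeros, Eu. reflexivity.
        -- intros y E. apply app_inj_tail in E. destruct E; discriminate.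
      * exists u, j. split; auto. right. exists (S i). now rewrite zeros_S.
Qed.

Lemma even_round x : even x -> exists u j, is_start u /\ x = u ++ zeros j.
Proof.
  intros Hx. destruct (node_round x) as (u & j & Hu & [->|[i ->]]); [eauto|].
  exfalso. apply even_zeros in Hx. rewrite app_assoc in Hx. revert Hx. apply even_one.
  apply even_zeros. apply Hu.
Qed.

(** The node after a late [1] is an even start, or it is odd and the first even node beyond it ends
    in [1]. *)
Lemma io_start w : ~ zero_tail w -> io is_start w.
Proof.
  intros Hz n. destruct (not_zero_tail w n Hz) as (p & Hp & Ep).
  destruct (classic (even (take w (S p)))) as [He|Ho].
  - exists (take w (S p)). rewrite take_length. split; [lia|]. split; [apply take_path|].
    split; auto. rewrite take_S, Ep. intros y E. apply app_inj_tail in E. destruct E; discriminate.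
  - destruct (not_zero_tail w (S p) Hz) as (q & Hq & Eq).
    destruct (min_length (fun u => even u /\ path_of w u /\ S p <= length u))
      as (u & (Eu & Pu & Lu) & Hm).
    { destruct (classic (even (take w q))) as [He'|Ho'].
      - exists (take w q). rewrite take_length. auto using take_path.
      - exists (take w (S q)). rewrite take_length. repeat split; auto using take_path.
        rewrite take_S, Eq. unfold even in *. rewrite odd_ones_app.
        destruct (odd_ones (take w q)); simpl in *; congruence. }
    exists u. split; [lia|]. split; auto. split; auto. intros y ->.
    assert (Ey : even y). { apply (even_zeros y 1). exact Eu. }
    assert (Py : path_of w y) by eauto using path_pre, pre_app.
    rewrite length_app in Lu. simpl in Lu.
    destruct (Nat.eq_dec (length y) p) as [E|E].
    + assert (path_of w (y ++ [false])) by auto.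
      specialize (H p). rewrite length_app, app_nth2, E, Nat.sub_diag in H by lia.
      simpl in H. specialize (H ltac:(lia)). congruence.
    + specialize (Hm y ltac:(split; auto; split; auto; lia)). rewrite length_app in Hm. simpl in Hm. lia.
Qed.

(** A node of a round has at most one [1] after the start, so a node beyond two late ones has its
    start beyond the first of them. *)
Lemma far_start w n : ~ zero_tail w -> exists m, forall u j i x,
  (x = u ++ zeros j \/ x = (u ++ zeros j ++ [true]) ++ zeros i) ->
  path_of w x -> m <= length x -> n <= length u.
Proof.
  intros Hz. destruct (not_zero_tail w n Hz) as (p & Hp & Ep).
  destruct (not_zero_tail w (S p) Hz) as (q & Hq & Eq).
  exists (S q). intros u j i x [->| ->] Px Lx.
  - pose proof (path_zeros_length _ _ _ _ Px Ep ltac:(lia)). lia.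
  - pose proof (path_zeros_length _ _ _ _ Px Eq ltac:(lia)) as H.
    rewrite app_assoc, length_app in H. simpl in H.
    assert (Pu : path_of w (u ++ zeros j)).
    { apply path_pre with (1 := Px). rewrite app_assoc, <- app_assoc. apply pre_app. }
    pose proof (path_zeros_length _ _ _ _ Pu Ep ltac:(lia)). lia.
Qed.

(** Depth is measured at the start of the round, as the comparison lemma requires. *)
Definition vis (a : node -> node) (W : node -> Prop) (w : nat -> bool) : Prop :=
  forall n, exists u, W u /\ n <= length u /\ path_of w (a u).

Lemma vis_comparison (W : node -> Prop) (a b : node -> node) C :
  (forall u, W u -> is_start u) ->
  (forall u, W u -> pre u (a u) /\ pre u (b u)) ->
  (forall u, W u -> length (a u) <= length (b u) + C) ->
  (forall u, W u -> a u = b u \/ (~ pre (a u) (b u) /\ ~ pre (b u) (a u))) ->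
  (forall u u', W u -> is_start u' -> pre u u' -> u <> u' -> ~ pre u' (a u) /\ ~ pre u' (b u)) ->
  mu_null (fun w => vis b W w /\ ~ vis a W w).
Proof.
  intros HW Hp Hl Hd Hn.
  apply null_sub with (2 := null_comparison (fun u x y => W u /\ x = a u /\ y = b u) C
    ltac:(intros u x y x' y' (_ & -> & ->) (_ & -> & ->); auto) ltac:(intros u x y (Hu & -> & ->); auto)
    ltac:(intros u x y (Hu & -> & ->); auto) ltac:(intros u x y (Hu & -> & ->); auto)
    ltac:(intros u x y u' x' y' (Hu & -> & ->) (Hu' & _); auto)).
  intros w [Hb Ha]. split.
  - intros n. destruct (Hb n) as (u & Hu & Hlu & Hpu). exists u, (a u), (b u). auto.
  - intros H. apply Ha. intros n. destruct (H n) as (u & x & y & (Hu & -> & ->) & ? & ?).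
    exists u. auto.
Qed.

(** Each visited start continues by [0] or [1]. One comparison yields infinitely many continuations
    by [1]; a second one compares these with [a u], which begins with [0] and is thus incomparable
    to them. *)
Lemma vis_bounded (W : node -> Prop) (a : node -> node) C :
  (forall u, W u -> is_start u) ->
  (forall u, W u -> pre (u ++ [false]) (a u)) ->
  (forall u, W u -> length (a u) <= length u + C) ->
  (forall u u', W u -> is_start u' -> pre u u' -> u <> u' -> ~ pre u' (a u)) ->
  mu_null (fun w => io W w /\ ~ vis a W w).
Proof.
  intros HW Hp Hl Hn.
  assert (Hinc : forall u x, pre (u ++ [false]) x -> ~ pre x (u ++ [true]) /\ ~ pre (u ++ [true]) x).
  { intros u x Hx. split; intros H.
    - assert (E : pre (u ++ [false]) (u ++ [true])) by eauto using pre_trans.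
      apply pre_antisym_length in E; [|rewrite !length_app; auto].
      apply app_inv_head in E. discriminate.
    - assert (E : pre (u ++ [false]) (u ++ [true])).
      { apply pre_total with x; auto. rewrite !length_app; auto. }
      apply pre_antisym_length in E; [|rewrite !length_app; auto].
      apply app_inv_head in E. discriminate. }
  assert (Hns : forall u u' b, W u -> is_start u' -> pre u u' -> u <> u' -> ~ pre u' (u ++ [b])).
  { intros u u' b Hu Hu' H1 Hne H2. apply Hne. symmetry. destruct b.
    - apply round_nest with (j := 0) (i := 0); auto. now rewrite app_nil_r.
    - apply start_between with 1; auto. apply Hu'. }
  assert (H1 : mu_null (fun w => vis (fun u => u ++ [false]) W w /\ ~ vis (fun u => u ++ [true]) W w)).
  { apply vis_comparison with 0; auto using pre_app.
    - intros u _. rewrite !length_app. simpl. lia.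
    - intros u _. right. destruct (Hinc u (u ++ [false]) (pre_refl _)). auto. }
  assert (H2 : mu_null (fun w => vis (fun u => u ++ [true]) W w /\ ~ vis a W w)).
  { apply vis_comparison with C.
    - exact HW.
    - intros u Hu. split; [|apply pre_app]. eapply pre_trans; [apply pre_app|]; auto.
    - intros u Hu. specialize (Hl u Hu). rewrite length_app. lia.
    - intros u Hu. right. destruct (Hinc u (a u)); auto.
    - auto. }
  apply null_sub with (2 := null_or _ _ H1 H2). intros w [Hio Ha].
  destruct (classic (vis (fun u => u ++ [true]) W w)) as [|Hv]; [now right|left].
  split; auto. intros n. apply not_all_ex_not in Hv. destruct Hv as [m Hm].
  destruct (Hio (n + m)) as (u & Hlu & Pu & Wu). exists u. split; auto. split; [lia|].
  destruct (w (length u)) eqn:E.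
  - exfalso. apply Hm. exists u. split; auto. split; [lia|].
    rewrite (path_eq_take _ _ Pu). rewrite <- E, <- take_S. apply take_path.
  - rewrite (path_eq_take _ _ Pu). rewrite <- E, <- take_S. apply take_path.
Qed.

(** * Completeness: a certificate written into every round *)

Section Completeness.

Context {T : Type}.
Variables (rules : list (rule T)) (V n : nat).

(** An entry [(i, env)] is an instance of rule [i]; the entry at index [p] will label cell [p] of
    every round. *)
Variable cert : list (nat * (nat -> nat)).

Definition entry_ok (p i : nat) (env : nat -> nat) : Prop :=
  exists r, nth_error rules i = Some r /\
    (forall c, In c (cons_of r) -> con_holds n env c) /\
    (forall at_, In at_ (body r) -> exists q i' env' r',
       nth_error cert (p + S q) = Some (i', env') /\ nth_error rules i' = Some r' /\
       htag r' = fst at_ /\ map env' (hvars r') = map env (snd at_)).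

Hypothesis cert_ok : forall p i env, nth_error cert p = Some (i, env) -> entry_ok p i env.
Hypothesis cert_goal : exists env, nth_error cert 0 = Some (0, env).

(** The number of active cells per round. It exceeds all values, because values are named by
    positions; [2 <= k] keeps the reference cell [k - 1] away from the start. *)
Variable k : nat.
Hypothesis k_ge : 2 <= k.
Hypothesis k_len : length cert <= k.
Hypothesis k_env : forall p i env v, nth_error cert p = Some (i, env) -> v < V -> env v < k.
Hypothesis Hvars : vars_bounded rules V.

(** State of a counter machine that reads the path: [pos] counts the zeros before the turn of the
    current round, [cnt] those after it. *)
Record state : Type := St { stg : nat; odd_phase : bool; pos : nat; cnt : nat }.

(** The stage grows at the end of a round that passed the mark behind cell [k - 1], the rarest hit
    of the stage. The test is [leb] because an arm may continue beyond its mark. *)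
Definition step (s : state) (b : bool) : state :=
  match odd_phase s, b with
  | false, false => St (stg s) false (S (pos s)) 0
  | false, true => St (stg s) true (pos s) 0
  | true, false => St (stg s) true (pos s) (S (cnt s))
  | true, true =>
      St (if andb (Nat.eqb (pos s) (k - 1)) (Nat.leb ((k - 1) * stg s) (cnt s))
          then S (stg s) else stg s) false 0 0
  end.

Definition run (u : node) : state := fold_left step u (St 0 false 0 0).

Lemma run_snoc u b : run (u ++ [b]) = step (run u) b.
Proof. unfold run. now rewrite fold_left_app. Qed.

Definition stage (u : node) : nat := stg (run u).

Lemma run_even_zeros u r i j : run u = St r false i 0 -> run (u ++ zeros j) = St r false (i + j) 0.
Proof.
  intros H. induction j as [|j IH].
  - now rewrite app_nil_r, Nat.add_0_r.
  - rewrite zeros_S, run_snoc, IH. unfold step; simpl; f_equal; lia.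
Qed.

Lemma run_odd_zeros u r p i j : run u = St r true p i -> run (u ++ zeros j) = St r true p (i + j).
Proof.
  intros H. induction j as [|j IH].
  - now rewrite app_nil_r, Nat.add_0_r.
  - rewrite zeros_S, run_snoc, IH. unfold step; simpl; f_equal; lia.
Qed.

Lemma run_phase u : odd_phase (run u) = odd_ones u.
Proof.
  induction u as [|b u IH] using rev_ind; auto.
  rewrite run_snoc, odd_ones_app, <- IH. simpl. unfold step.
  destruct (odd_phase (run u)), b; reflexivity.
Qed.

Lemma run_start u : is_start u -> run u = St (stage u) false 0 0.
Proof.
  intros [Eu Su]. destruct u as [|b u] using rev_ind; auto.
  destruct b; [|exfalso; eapply Su; eauto].
  unfold stage. rewrite run_snoc. unfold step.
  assert (H : odd_phase (run u) = true).
  { rewrite run_phase. unfold even in Eu. rewrite odd_ones_app in Eu.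
    destruct (odd_ones u); auto. }
  rewrite H. reflexivity.
Qed.

Lemma run_cell u j : is_start u -> run (u ++ zeros j) = St (stage u) false j 0.
Proof. intros Hu. now rewrite (run_even_zeros u _ _ j (run_start u Hu)). Qed.

Lemma run_arm u j i :
  is_start u -> run ((u ++ zeros j ++ [true]) ++ zeros i) = St (stage u) true j i.
Proof.
  intros Hu. apply run_odd_zeros with (i := 0). rewrite app_assoc, run_snoc, run_cell by auto.
  reflexivity.
Qed.

Definition marks (f : nat -> nat) (t : node) : Prop :=
  odd_phase (run t) = true /\ cnt (run t) = f (pos (run t)) * stage t.

Definition arg_value (a p : nat) : nat :=
  match nth_error cert p with
  | Some (i, env) =>
      match nth_error rules i with Some r => env (nth a (hvars r) 0) | None => 0 end
  | None => 0
  end.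

Definition cert_act (c : node) : Prop := even c /\ pos (run c) < k.
Definition cert_label (i : nat) (c : node) : Prop :=
  even c /\ exists env, nth_error cert (pos (run c)) = Some (i, env).
(** Cell [j] carries the datum [j]: the scale against which all other data are read. *)
Definition cert_thrM : node -> Prop := marks (fun j => j).
Definition cert_thr (a : nat) : node -> Prop := marks (arg_value a).

(** The node at which cell [j] of round [u] is hit if its datum is [d]. *)
Definition arm (u : node) (j d : nat) : node := (u ++ zeros j ++ [true]) ++ zeros (d * stage u).

Lemma arm_length u j d : length (arm u j d) = length u + j + 1 + d * stage u.
Proof. unfold arm. rewrite !length_app, !repeat_length. simpl. lia. Qed.

Lemma arm_pre u j d : pre u (arm u j d).
Proof. unfold arm. rewrite <- app_assoc. apply pre_app. Qed.

Lemma arm_nest u u' j d :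
  is_start u -> is_start u' -> pre u u' -> u <> u' -> ~ pre u' (arm u j d).
Proof. intros Hu Hu' Hp Hne H. apply Hne. symmetry. eapply round_nest; eauto. Qed.

Lemma arm_incomparable u j d j' d' : j <> j' -> ~ pre (arm u j d) (arm u j' d').
Proof.
  intros Hne [s H]. unfold arm in H. rewrite <- !app_assoc in H. apply app_inv_head in H.
  revert j' Hne H. induction j as [|j IH]; intros [|j'] Hne H; simpl in H; try discriminate; auto.
  injection H as H. apply (IH j'); auto.
Qed.

Lemma hit_arm f X u j : is_start u -> X (u ++ zeros j) -> hit (marks f) X (arm u j (f j)).
Proof.
  intros Hu HX. split.
  - unfold marks, arm, stage. rewrite run_arm by auto. simpl. auto.
  - exists (u ++ zeros j). split; auto. unfold arm. rewrite app_assoc. now eexists.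
Qed.

Lemma hit_inv f X t : (forall c, X c -> even c) -> hit (marks f) X t ->
  exists u j, is_start u /\ X (u ++ zeros j) /\ t = arm u j (f j).
Proof.
  intros HX [[Ho Hc] (c & Xc & i & ->)].
  destruct (even_round c (HX c Xc)) as (u & j & Hu & ->).
  exists u, j. split; auto. split; auto.
  assert (E : run (((u ++ zeros j) ++ [true]) ++ zeros i) = St (stage u) true j i).
  { rewrite <- (app_assoc u). now apply run_arm. }
  unfold stage in Hc. rewrite E in Hc. simpl in Hc. subst i. unfold arm. now rewrite app_assoc.
Qed.

Definition pos_of (X : node -> Prop) (u : node) : nat :=
  epsilon (inhabits 0) (fun j => X (u ++ zeros j)).

Lemma pos_of_spec X u j : X (u ++ zeros j) -> X (u ++ zeros (pos_of X u)).
Proof. intros H. unfold pos_of. apply epsilon_spec. now exists j. Qed.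

Lemma section_pos X u i j : section X -> X (u ++ zeros i) -> X (u ++ zeros j) -> i = j.
Proof.
  intros HX Hi Hj. destruct (le_lt_dec i j).
  - replace j with (i + (j - i)) in * by lia. rewrite zeros_add in Hj.
    pose proof (HX _ _ Hi Hj). lia.
  - replace i with (j + (i - j)) in * by lia. rewrite zeros_add in Hi.
    pose proof (HX _ _ Hj Hi). lia.
Qed.

Lemma pos_of_section X u j : section X -> X (u ++ zeros j) -> pos_of X u = j.
Proof. intros HX H. apply (section_pos X u); auto. eapply pos_of_spec; eauto. Qed.

Definition touched (X : node -> Prop) (u : node) : Prop :=
  is_start u /\ exists j, X (u ++ zeros j).

Lemma io_hit_vis f X w : (forall c, X c -> even c) -> section X -> ~ zero_tail w ->
  io (hit (marks f) X) w -> vis (fun u => arm u (pos_of X u) (f (pos_of X u))) (touched X) w.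
Proof.
  intros HE HX Hz H m. destruct (far_start w m Hz) as [N HN].
  destruct (H N) as (t & Hl & Ht & Hh).
  destruct (hit_inv _ _ _ HE Hh) as (u & j & Hu & Xu & ->).
  exists u. split; [split; eauto|]. rewrite (pos_of_section X u j) by auto. split; auto.
  apply (HN u j (f j * stage u) (arm u j (f j))); auto.
Qed.

Lemma vis_io_hit f X w (W : node -> Prop) (q : node -> nat) :
  (forall u, W u -> is_start u /\ X (u ++ zeros (q u))) ->
  vis (fun u => arm u (q u) (f (q u))) W w -> io (hit (marks f) X) w.
Proof.
  intros HW H m. destruct (H m) as (u & Wu & Hl & Hp). destruct (HW u Wu) as [Hu HX].
  eexists. split; [|split; [exact Hp|]].
  - rewrite arm_length. lia.
  - now apply hit_arm.
Qed.

(** A datum that is not larger gives an arm that is longer by at most [k], whatever the stage. Where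
    the two cells coincide the arms are comparable, so there the data have to be equal. *)
Lemma null_cells f g X Y :
  (forall c, X c -> even c) -> section X ->
  (forall u j, is_start u -> X (u ++ zeros j) -> exists j',
     Y (u ++ zeros j') /\ j' < k /\ g j' <= f j /\ (j = j' -> f j = g j')) ->
  mu_null (fun w => io (hit (marks f) X) w /\ ~ io (hit (marks g) Y) w).
Proof.
  intros HE HX HY.
  set (q := fun u => epsilon (inhabits 0) (fun j' => Y (u ++ zeros j') /\ j' < k /\
     g j' <= f (pos_of X u) /\ (pos_of X u = j' -> f (pos_of X u) = g j'))).
  assert (Hq : forall u, touched X u -> Y (u ++ zeros (q u)) /\ q u < k /\
     g (q u) <= f (pos_of X u) /\ (pos_of X u = q u -> f (pos_of X u) = g (q u))).
  { intros u [Hu [j Hj]]. unfold q. apply epsilon_spec. apply HY; auto.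
    eapply pos_of_spec; eauto. }
  assert (H : mu_null (fun w =>
     vis (fun u => arm u (pos_of X u) (f (pos_of X u))) (touched X) w /\
     ~ vis (fun u => arm u (q u) (g (q u))) (touched X) w)).
  { apply vis_comparison with k.
    - now intros u [Hu _].
    - auto using arm_pre.
    - intros u Hu. rewrite !arm_length. destruct (Hq u Hu) as (_ & Hk & Hle & _).
      assert (g (q u) * stage u <= f (pos_of X u) * stage u) by now apply Nat.mul_le_mono_r. lia.
    - intros u Hu. destruct (Nat.eq_dec (pos_of X u) (q u)) as [E|E].
      + left. destruct (Hq u Hu) as (_ & _ & _ & He). rewrite He by auto. now rewrite E.
      + right. split; apply arm_incomparable; auto.
    - intros u u' [Hu _] Hu' Hp Hne. split; apply arm_nest; auto. }
  apply null_sub with (2 := null_or _ _ H null_zero_tail). intros w [H1 H2].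
  destruct (classic (zero_tail w)) as [|Hz]; [now right|left].
  split; [now apply io_hit_vis|]. intros Hv. apply H2. revert Hv.
  apply vis_io_hit. intros u Hu. split; [apply Hu|]. now apply Hq.
Qed.

Lemma act_pos u j : is_start u -> cert_act (u ++ zeros j) <-> j < k.
Proof.
  intros Hu. unfold cert_act. rewrite run_cell by auto. simpl. rewrite even_zeros.
  destruct Hu. tauto.
Qed.

Lemma eqv_cells f g X Y :
  (forall c, X c -> cert_act c) -> (forall c, Y c -> cert_act c) -> section X -> section Y ->
  (forall u j, is_start u -> X (u ++ zeros j) -> exists j', Y (u ++ zeros j') /\ f j = g j') ->
  (forall u j, is_start u -> Y (u ++ zeros j) -> exists j', X (u ++ zeros j') /\ g j = f j') ->
  eqv (marks f) (marks g) X Y.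
Proof.
  intros AX AY SX SY HXY HYX Z HZ.
  assert (Hhalf : forall f g X Y, (forall c, X c -> cert_act c) -> (forall c, Y c -> cert_act c) ->
    section X -> 
    (forall u j, is_start u -> X (u ++ zeros j) -> exists j', Y (u ++ zeros j') /\ f j = g j') ->
    mu_null (fun w => io (hit (marks f) (restr X Z)) w /\ ~ io (hit (marks g) (restr Y Z)) w)).
  { clear f g X Y AX AY SX SY HXY HYX. intros f g X Y AX AY SX H. apply null_cells.
    - intros c [Xc _]. now apply AX.
    - intros x i [Hx _] [Hi _]. now apply (SX x).
    - intros u j Hu [Xu Zu]. destruct (H u j Hu Xu) as (j' & Yu & E). exists j'.
      split; [split; auto|].
      + apply unif_zeros; auto. now apply unif_zeros in Zu.
      + rewrite E. split; [now apply (act_pos u), AY|]. split; auto. }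
  apply null_sub with (2 := null_or _ _ (Hhalf f g X Y AX AY SX HXY) (Hhalf g f Y X AY AX SY HYX)).
  intros w Hw. tauto.
Qed.

Definition ref_cells : node -> Prop := at_pos is_start (k - 1).

Lemma ref_cells_act c : ref_cells c -> cert_act c.
Proof. intros (u & Hu & ->). apply act_pos; auto. lia. Qed.

Lemma ref_cells_section : section ref_cells.
Proof. apply at_pos_section. now intros u [_ Hu]. Qed.

Lemma stage_mono u v : pre u v -> stage u <= stage v.
Proof.
  intros [s ->]. induction s as [|b s IH] using rev_ind; [now rewrite app_nil_r|].
  rewrite app_assoc. unfold stage at 2. rewrite run_snoc. unfold stage in *. unfold step.
  destruct (odd_phase (run (u ++ s))), b; simpl; try lia.
  destruct (andb _ _); simpl; lia.
Qed.

(** To advance the stage, the path must have passed the mark of a reference cell, that is, a hit. *)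
Lemma stage_const w m u v :
  (forall t, m <= length t -> path_of w t -> ~ hit cert_thrM ref_cells t) ->
  is_start u -> m <= length u -> pre u v -> path_of w v -> stage v = stage u.
Proof.
  intros Hno Hu Hm [s ->]. induction s as [|b s IH] using rev_ind; [now rewrite app_nil_r|].
  rewrite app_assoc. intros Hp.
  assert (Hp' : path_of w (u ++ s)) by eauto using path_pre, pre_app.
  rewrite <- IH by auto. unfold stage. rewrite run_snoc.
  destruct (node_round (u ++ s)) as (u' & j & Hu' & [E|[i E]]); rewrite E.
  { rewrite run_cell by auto. now destruct b. }
  rewrite run_arm by auto. unfold step. simpl.
  destruct b; auto. simpl.
  destruct (Nat.eqb_spec j (k - 1)) as [->|]; auto.
  destruct (Nat.leb_spec ((k - 1) * stage u') i) as [Hle|]; auto.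
  exfalso.
  assert (Hpa : pre (arm u' (k - 1) (k - 1)) (u ++ s)).
  { rewrite E. unfold arm. replace i with ((k - 1) * stage u' + (i - (k - 1) * stage u')) by lia.
    rewrite zeros_add. apply pre_app. }
  apply (Hno (arm u' (k - 1) (k - 1))).
  - rewrite arm_length. generalize ((k - 1) * stage u'). intros z.
    enough (length u <= length u') by lia.
    destruct (le_lt_dec (length u) (length u')) as [|Hlt]; auto. exfalso.
    assert (pre u' u).
    { apply pre_total with (u ++ s); auto using pre_app; [|lia].
      rewrite E, <- app_assoc. apply pre_app. }
    assert (u = u') by (apply (round_nest u' u (k - 1) i); auto; rewrite <- E; apply pre_app).
    subst. lia.
  - eauto using path_pre.
  - apply hit_arm with (f := fun j => j); auto. now exists u'.
Qed.

(** Without such hits the stage is eventually a constant [r]; then the arms of the reference cells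
    have bounded length and [vis_bounded] provides infinitely many hits after all. *)
Lemma null_no_ref : mu_null (fun w => ~ io (hit cert_thrM ref_cells) w).
Proof.
  set (W := fun r u => is_start u /\ stage u = r).
  assert (H : forall r, mu_null (fun w => io (W r) w /\
                          ~ vis (fun u => arm u (k - 1) (k - 1)) (W r) w)).
  { intros r. apply vis_bounded with (k + (k - 1) * r).
    - now intros u [Hu _].
    - intros u _. unfold arm. exists (zeros (k - 2) ++ [true] ++ zeros ((k - 1) * stage u)).
      replace (k - 1) with (S (k - 2)) at 1 by lia. rewrite <- !app_assoc. reflexivity.
    - intros u [_ <-]. rewrite arm_length. lia.
    - intros u u' [Hu _] Hu' Hp Hne. now apply arm_nest. }
  apply null_sub with (2 := null_or _ _ (null_union _ H) null_zero_tail).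
  intros w Hw. destruct (classic (zero_tail w)) as [|Hz]; [now right|left].
  apply not_all_ex_not in Hw. destruct Hw as [m Hm].
  assert (Hno : forall t, m <= length t -> path_of w t -> ~ hit cert_thrM ref_cells t).
  { intros t Ht Pt Hh. apply Hm. eauto. }
  destruct (io_start w Hz m) as (u0 & Hl0 & Hp0 & Hu0).
  exists (stage u0). split.
  - intros p. destruct (io_start w Hz (p + length u0)) as (u & Hl & Hp & Hu).
    exists u. split; [lia|]. split; auto. split; auto.
    apply stage_const with w m; auto. apply path_pre_length with w; auto. lia.
  - intros Hv. destruct (Hv m) as (u & [Hu _] & Hl & Hp). apply (Hno _ (Nat.le_trans _ _ _ Hl (pre_length _ _ (arm_pre u _ _))) Hp).
    apply hit_arm with (f := fun j => j); auto. now exists u.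
Qed.

Lemma cert_bounded : bounded_cond cert_act.
Proof.
  intros Z HZ.
  assert (H : mu_null (fun w => io (restr is_start Z) w /\
                         ~ vis (fun u => u ++ zeros k) (restr is_start Z) w)).
  { apply vis_bounded with k.
    - now intros u [Hu _].
    - intros u _. exists (zeros (k - 1)). rewrite <- app_assoc. f_equal.
      replace k with (S (k - 1)) at 1 by lia. reflexivity.
    - intros u _. rewrite length_app, repeat_length. lia.
    - intros u u' _ [_ Hs] Hp Hne Hq. apply Hne. symmetry. now apply start_between with k. }
  apply null_sub with (2 := null_or _ _ H null_zero_tail). intros w [H1 H2].
  destruct (classic (zero_tail w)) as [|Hz]; [now right|left]. split.
  - intros m. destruct (far_start w m Hz) as [N HN]. destruct (H1 N) as (x & Hl & Hp & He & Zx).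
    destruct (even_round x He) as (u & j & Hu & ->).
    exists u. split; [apply (HN u j 0 (u ++ zeros j)); auto|].
    split; [apply path_pre with (1 := Hp), pre_app|]. split; auto.
    now apply unif_zeros in Zx.
  - intros Hv. apply H2. intros m. destruct (Hv m) as (u & [Hu Zu] & Hl & Hp).
    exists (u ++ zeros k). split; [rewrite length_app; lia|]. split; auto. split; [split|].
    + apply even_zeros. apply Hu.
    + now apply unif_zeros.
    + rewrite act_pos by auto. lia.
Qed.

(** The reference cell has the largest datum of all active cells, so any other choice compares
    favourably with it. *)
Lemma cert_thick : thick_cond cert_act cert_thrM.
Proof.
  intros Y AY HY.
  assert (H : mu_null (fun w => io (hit cert_thrM ref_cells) w /\ ~ io (hit cert_thrM Y) w)).
  { apply null_cells.
    - intros c Hc. now apply ref_cells_act.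
    - apply ref_cells_section.
    - intros u j Hu (u' & Hu' & E). destruct (HY u Hu) as (y & Yy & j' & ->).
      apply start_unique in E; [|apply Hu|apply Hu']. destruct E as [_ ->].
      exists j'. split; auto. assert (j' < k) by now apply (act_pos u), AY.
      split; auto. split; [lia|auto]. }
  apply null_sub with (2 := null_or _ _ H null_no_ref). intros w Hw. tauto.
Qed.

Lemma stage_unbounded w m : ~ zero_tail w -> io (hit cert_thrM ref_cells) w ->
  exists N, forall u, N <= length u -> path_of w u -> m <= stage u.
Proof.
  intros Hz Hio. induction m as [|m [N HN]].
  - exists 0. lia.
  - destruct (far_start w N Hz) as [N' HN']. destruct (Hio N') as (t & Hl & Hp & Hh).
    destruct (hit_inv (fun j => j) ref_cells t) as (u & j & Hu & (u' & Hu' & E) & Et); auto.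
    { intros c Hc. now apply ref_cells_act. }
    apply start_unique in E; [|apply Hu|apply Hu']. destruct E as [<- ->].
    assert (Hlu : N <= length u).
    { apply (HN' u (k - 1) ((k - 1) * stage u) t); auto. }
    destruct (not_zero_tail w (length t) Hz) as (p & Hpt & Ep).
    (* [x] is the end of the arm through [t]; the [1] that follows it closes the round and raises
       the stage. *)
    destruct (min_length (fun x => path_of w x /\ length t <= length x /\ w (length x) = true))
      as (x & (Px & Lx & Ex) & Hmin).
    { exists (take w p). rewrite take_length. auto using take_path. }
    exists (S (length x)). intros y Hly Py.
    assert (Htx : exists i, x = t ++ zeros i).
    { assert (Htx : pre t x) by (apply path_pre_length with w; auto).
      destruct Htx as [s ->]. exists (length s). f_equal.
      apply nth_ext with false false; [now rewrite repeat_length|].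
      intros i Hi. rewrite nth_repeat.
      assert (Hlt : length t + i < length (t ++ s)) by (rewrite length_app; lia).
      pose proof (Px _ Hlt) as Hni. rewrite app_nth2_plus in Hni. rewrite Hni.
      destruct (w (length t + i)) eqn:Ew; auto.
      specialize (Hmin (take w (length t + i))). rewrite take_length in Hmin.
      specialize (Hmin (conj (take_path _ _) (conj (Nat.le_add_r _ _) Ew))). lia. }
    assert (Hx : stage (x ++ [true]) = S (stage u)).
    { destruct Htx as [i ->]. rewrite Et. unfold arm. rewrite <- zeros_add.
      unfold stage at 1. rewrite run_snoc, run_arm by auto. unfold step. simpl.
      rewrite Nat.eqb_refl. replace (Nat.leb _ _) with true; auto.
      symmetry. apply Nat.leb_le. lia. }
    assert (pre (x ++ [true]) y).
    { apply path_pre_length with w; auto; [|rewrite length_app; simpl; lia].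
      rewrite (path_eq_take _ _ Px), <- Ex, <- take_S. apply take_path. }
    apply stage_mono in H. rewrite Hx in H.
    assert (m <= stage u); [|lia]. apply HN; auto. eauto using path_pre, arm_pre.
    apply path_pre with (1 := Hp). rewrite Et. apply arm_pre.
Qed.

(** [Z0] keeps the rounds before which [X] has not yet been hit in the same stage. In stage [r]
    their [X]-arms form an antichain and the [Y]-arms are longer by at least [r], so almost surely
    [Y] is hit in [Z0] finitely often. But if [X] is hit infinitely often, then first hits occur in
    infinitely many stages and [X] is hit infinitely often within [Z0]. *)
Lemma cert_distinct : distinct_cond cert_act cert_thrM.
Proof.
  intros X Y AX AY SX SY HXY Heq.
  assert (EX : forall c, X c -> even c) by (intros c Hc; now apply AX).
  assert (EY : forall c, Y c -> even c) by (intros c Hc; now apply AY).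
  set (aX := fun u => arm u (pos_of X u) (pos_of X u)).
  set (aY := fun u => arm u (pos_of Y u) (pos_of Y u)).
  set (Z0 := fun u => touched X u /\ forall u', touched X u' -> pre u' u -> stage u' = stage u ->
                        ~ pre (aX u') u).
  assert (Hlt : forall u, touched X u -> pos_of X u < pos_of Y u /\ Y (u ++ zeros (pos_of Y u))).
  { intros u [Hu [j Hj]]. rewrite (pos_of_section X u j) by auto.
    destruct (HXY _ Hj) as [i Hi]. rewrite <- zeros_add in Hi.
    rewrite (pos_of_section Y u (j + S i)) by auto. split; auto. lia. }
  assert (HZ : unif (runs Z0)).
  { apply runs_unif. now intros u [[[_ Hu] _] _]. }
  assert (Hrun : forall u i, is_start u -> runs Z0 (u ++ zeros i) -> Z0 u).
  { intros u i Hu (v & Hv & j & E). apply start_unique in E; [|apply Hu|apply Hv].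
    now destruct E as [-> _]. }
  assert (HL : mu_null (fun w => forall m, exists r x y,
      m <= r /\ (exists u, Z0 u /\ stage u = r /\ x = aX u /\ y = aY u) /\ path_of w y)).
  { assert (Hinj : forall u u', is_start u -> is_start u' -> pre (aX u) (aX u') -> pre u u' ->
                    u <> u' -> pre (aX u) u').
    { intros u u' Hu Hu' Hp Hpu Hne. destruct (le_lt_dec (length (aX u)) (length u')).
      - apply pre_total with (aX u'); auto. apply arm_pre.
      - exfalso. apply (arm_nest u u' (pos_of X u) (pos_of X u)); auto.
        apply pre_total with (aX u'); auto; [apply arm_pre|unfold aX in *; lia]. }
    assert (Hlow : forall u u', is_start u -> is_start u' -> pre (aX u) (aX u') -> pre u' u -> u = u').
    { intros u u' Hu Hu' Hp Hpu. apply NNPP. intros Hne.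
      apply (arm_nest u' u (pos_of X u') (pos_of X u')); auto.
      apply pre_trans with (aX u); auto. apply arm_pre. }
    assert (Htot : forall u u', pre (aX u) (aX u') -> pre u u' \/ pre u' u).
    { intros u u' Hp. assert (pre u (aX u')) by (eapply pre_trans; [apply arm_pre|exact Hp]).
      destruct (le_lt_dec (length u) (length u')).
      - left. apply pre_total with (aX u'); auto. apply arm_pre.
      - right. apply pre_total with (aX u'); auto; [apply arm_pre|lia]. }
    apply (null_layers (fun r x y => exists u, Z0 u /\ stage u = r /\ x = aX u /\ y = aY u)).
    - intros r x x' (y & u & (Hu & Hz) & Hr & -> & _) (y' & u' & (Hu' & Hz') & Hr' & -> & _) Hp.
      f_equal. apply NNPP. intros Hne.
      destruct (Htot _ _ Hp) as [Hpu|Hpu].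
      + apply (Hz' u); auto; [congruence|]. apply Hinj; auto; [apply Hu|apply Hu'].
      + apply Hne. apply Hlow; auto; [apply Hu|apply Hu'].
    - intros r x y y' (u & (Hu & _) & _ & -> & ->) (u' & (Hu' & _) & _ & E & ->).
      assert (u = u'); [|congruence].
      assert (Hp : pre (aX u) (aX u')) by (rewrite E; apply pre_refl).
      assert (Hp' : pre (aX u') (aX u)) by (rewrite E; apply pre_refl).
      destruct (Htot _ _ Hp) as [Hpu|Hpu].
      + symmetry. apply Hlow; auto; [apply Hu'|apply Hu].
      + apply Hlow; auto; [apply Hu|apply Hu'].
    - intros r x y (u & (Hu & _) & <- & -> & ->). unfold aX, aY. rewrite !arm_length.
      destruct (Hlt u Hu) as [Hpq _].
      assert (S (pos_of X u) * stage u <= pos_of Y u * stage u) by (apply Nat.mul_le_mono_r; lia).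
      lia. }
  apply null_sub with (2 := null_or _ _ (null_or _ _ (Heq (runs Z0) HZ) HL)
                                        (null_or _ _ null_no_ref null_zero_tail)).
  intros w HX. apply NNPP. intros Hn. apply not_or_and in Hn. destruct Hn as [Hn1 Hn2].
  apply not_or_and in Hn1, Hn2. destruct Hn1 as [Hn1 Hnl], Hn2 as [Href Hz].
  apply NNPP in Href. apply NNPP in Hn1.
  assert (HXZ : io (hit cert_thrM (restr X (runs Z0))) w).
  { apply (vis_io_hit (fun j => j)) with (W := Z0) (q := pos_of X).
    { intros u Hu. split; [apply Hu|]. destruct Hu as ((Hu & j & Hj) & Hu'). split.
      - eapply pos_of_spec; eauto.
      - exists u. split; [split; auto; split; eauto|]. now eexists. }
    apply io_hit_vis in HX; auto. intros N.
    destruct (io_start w Hz N) as (u1 & Hl1 & Hp1 & Hu1).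
    destruct (stage_unbounded w (S (stage u1)) Hz Href) as [M HM].
    destruct (HX M) as (u2 & Hu2 & Hl2 & Hp2).
    assert (Hr2 : stage u1 < stage u2).
    { apply HM; auto. apply path_pre with (1 := Hp2). apply arm_pre. }
    (* The first hit in the stage of [u2] belongs to [Z0]; as this stage exceeds that of [u1], the
       hit is in a round deeper than [u1]. *)
    destruct (min_length (fun u => touched X u /\ stage u = stage u2 /\ path_of w (aX u)))
      as (u & (Hu & Hr & Hp) & Hmin).
    { exists u2. auto. }
    assert (Pu : path_of w u) by (apply path_pre with (1 := Hp); apply arm_pre).
    exists u. split; [split; auto|split; auto].
    - intros u' Hu' Hpu Hr' Hpa.
      assert (length u <= length u').
      { apply Hmin. split; auto. split; [congruence|]. eauto using path_pre. }
      apply pre_length in Hpa. unfold aX in Hpa. rewrite arm_length in Hpa. lia.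
    - destruct (le_lt_dec (length u) (length u1)) as [Hle|]; [exfalso|lia].
      assert (pre u u1) by (apply path_pre_length with w; auto).
      apply stage_mono in H. lia. }
  apply Hnl. apply Hn1 in HXZ. apply io_hit_vis in HXZ; auto.
  2:{ intros c [Hc _]. auto. }
  2:{ intros x i [Hx _] [Hi _]. now apply (SY x). }
  intros m. destruct (stage_unbounded w m Hz Href) as [N HN].
  destruct (HXZ N) as (u & (Hu & j & Yj & Zj) & Hl & Hp).
  assert (HZu : Z0 u) by now apply Hrun with j.
  assert (Epos : pos_of (restr Y (runs Z0)) u = pos_of Y u).
  { rewrite (pos_of_section Y u j) by auto. apply pos_of_section; [|split; auto].
    intros x i [Hx _] [Hi _]. now apply (SY x). }
  rewrite Epos in Hp. exists (stage u), (aX u), (aY u). split; [|split; auto].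
  - apply HN; auto. apply path_pre with (1 := Hp). apply arm_pre.
  - exists u. auto.
Qed.

Lemma label_pos u j i : is_start u ->
  cert_label i (u ++ zeros j) <-> exists env, nth_error cert j = Some (i, env).
Proof.
  intros Hu. unfold cert_label. rewrite run_cell by auto. simpl. rewrite even_zeros.
  destruct Hu. tauto.
Qed.

(** If [Y] selects cell [p] in a round, then variable [v] is realised by the cell at position
    [envp p v], and a body atom by the cell of the later entry that justifies it. *)
Lemma cert_clause i r : nth_error rules i = Some r ->
  clause_sem rules V (input_set n) cert_act cert_thrM cert_thr cert_label i r.
Proof.
  intros Hr Y HYL HYs.
  (* Offsets of the justifying entries, chosen once for all rounds; 0 is a default for positions
     that hold no instance of rule [i]. *)
  assert (HB : forall pk : nat * nat, exists q, forall env at_,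
      nth_error cert (fst pk) = Some (i, env) -> nth_error (body r) (snd pk) = Some at_ ->
      exists i' env' r', nth_error cert (fst pk + S q) = Some (i', env') /\
        nth_error rules i' = Some r' /\ htag r' = fst at_ /\ map env' (hvars r') = map env (snd at_)).
  { intros [p kk]. simpl. destruct (nth_error cert p) as [[i0 env]|] eqn:E.
    2:{ exists 0. discriminate. }
    destruct (nth_error (body r) kk) as [at_|] eqn:E2; [|exists 0; discriminate].
    destruct (cert_ok p i0 env E) as (r0 & Hr0 & _ & Hb).
    destruct (Nat.eq_dec i0 i) as [->|Hne].
    - rewrite Hr in Hr0. injection Hr0 as <-.
      destruct (Hb at_ (nth_error_In _ _ E2)) as (q & Hq). exists q.
      intros env1 at1 H1 H2. injection H1 as <-. injection H2 as <-. exact Hq.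
    - exists 0. intros env1 at1 H1. congruence. }
  apply choice in HB. destruct HB as [bp Hbp].
  set (envp := fun p => match nth_error cert p with Some (_, env) => env | None => fun _ => 0 end).
  assert (HYp : forall u p, is_start u -> Y (u ++ zeros p) -> nth_error cert p = Some (i, envp p)).
  { intros u p Hu Hy. apply HYL, label_pos in Hy; auto. destruct Hy as [env Hy].
    unfold envp. now rewrite Hy. }
  assert (HYe : forall y, Y y -> exists u p, is_start u /\ y = u ++ zeros p).
  { intros y Hy. apply even_round. exact (proj1 (HYL y Hy)). }
  set (sel := fun (h : nat -> nat) c => exists u p, is_start u /\ Y (u ++ zeros p) /\ c = u ++ zeros (h p)).
  assert (Hsel_sec : forall h, section (sel h)).
  { intros h x j (u & p & Hu & Hy & ->) (u' & p' & Hu' & Hy' & E). rewrite <- zeros_add in E.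
    apply start_unique in E; [|apply Hu|apply Hu']. destruct E as [<- E].
    rewrite (section_pos Y u p' p) in E by auto. lia. }
  assert (Hsel : forall h u j, is_start u -> sel h (u ++ zeros j) ->
             exists p, Y (u ++ zeros p) /\ j = h p).
  { intros h u j Hu (u' & p & Hu' & Hy & E). apply start_unique in E; [|apply Hu|apply Hu'].
    destruct E as [<- ->]. eauto. }
  assert (Hsel_act : forall h, (forall u p, is_start u -> Y (u ++ zeros p) -> h p < k) ->
             forall c, sel h c -> cert_act c).
  { intros h Hh c (u & p & Hu & Hy & ->). apply act_pos; eauto. }
  assert (Henv : forall v, v < V -> forall u p, is_start u -> Y (u ++ zeros p) -> envp p v < k).
  { intros v Hv u p Hu Hy. eapply k_env; eauto. }
  assert (HYact : forall y, Y y -> cert_act y).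
  { intros y Hy. destruct (HYe y Hy) as (u & p & Hu & ->). apply act_pos; auto.
    specialize (HYp u p Hu Hy). assert (p < length cert) by (apply nth_error_Some; congruence). lia. }
  assert (Hargs : forall p i' env' r' a v, nth_error cert p = Some (i', env') ->
     nth_error rules i' = Some r' -> nth_error (hvars r') a = Some v -> arg_value a p = env' v).
  { intros p i' env' r' a v H1 H2 H3. unfold arg_value. rewrite H1, H2. f_equal.
    now apply nth_error_nth. }
  assert (Hin : In r rules) by (eapply nth_error_In; eauto).
  destruct (Hvars r Hin) as (Hv1 & Hv2 & Hv3).
  exists (fun v => sel (fun p => envp p v)), (fun kk => sel (fun p => p + S (bp (p, kk)))).
  split; [|split; [|split]].
  - intros v Hv. split; auto. split; [exact (Hsel_act _ (Henv v Hv))|].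
    intros y Hy. destruct (HYe y Hy) as (u & p & Hu & ->).
    exists (u ++ zeros (envp p v)). split; [exists u, p; auto|].
    destruct (le_lt_dec p (envp p v)).
    + left. exists (envp p v - p). rewrite <- zeros_add. do 2 f_equal. lia.
    + right. exists (p - envp p v). rewrite <- zeros_add. do 2 f_equal. lia.
  - intros kk [tg vs] Hk.
    assert (Hb : forall u p, is_start u -> Y (u ++ zeros p) -> exists i' env' r',
      nth_error cert (p + S (bp (p, kk))) = Some (i', env') /\ nth_error rules i' = Some r' /\
      htag r' = tg /\ map env' (hvars r') = map (envp p) vs).
    { intros u p Hu Hy. exact (Hbp (p, kk) _ _ (HYp u p Hu Hy) Hk). }
    split; auto. split; [|split].
    + intros c (u & p & Hu & Hy & ->). destruct (Hb u p Hu Hy) as (i' & env' & r' & H1 & H2 & H3 & H4).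
      exists i', r'. split; auto. split; auto. split.
      * apply (f_equal (@length nat)) in H4. now rewrite !length_map in H4.
      * apply label_pos; eauto.
    + intros y Hy. destruct (HYe y Hy) as (u & p & Hu & ->).
      exists (bp (p, kk)). rewrite <- zeros_add. exists u, p. auto.
    + simpl. intros a v Ha.
      assert (Hval : forall u p, is_start u -> Y (u ++ zeros p) ->
                arg_value a (p + S (bp (p, kk))) = envp p v).
      { intros u p Hu Hy. destruct (Hb u p Hu Hy) as (i' & env' & r' & H1 & H2 & _ & H4).
        apply (f_equal (fun l => nth_error l a)) in H4. rewrite !nth_error_map, Ha in H4.
        destruct (nth_error (hvars r') a) as [v'|] eqn:Ev; [|discriminate].
        simpl in H4. injection H4 as <-. eauto. }
      assert (HvV : v < V) by (apply (Hv2 (tg, vs)); [eapply nth_error_In|eapply nth_error_In]; eauto).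
      apply eqv_cells.
      * apply Hsel_act. intros u p Hu Hy. destruct (Hb u p Hu Hy) as (i' & env' & r' & H1 & _).
        assert (p + S (bp (p, kk)) < length cert) by (apply nth_error_Some; congruence). lia.
      * exact (Hsel_act _ (Henv v HvV)).
      * auto.
      * auto.
      * intros u j Hu Hs. destruct (Hsel _ _ _ Hu Hs) as (p & Hy & ->).
        exists (envp p v). split; [exists u, p; auto|]. eauto.
      * intros u j Hu Hs. destruct (Hsel _ _ _ Hu Hs) as (p & Hy & ->).
        eexists. split; [exists u, p; auto|]. symmetry. eauto.
  - intros c Hc. specialize (Hv3 c Hc).
    assert (Hcon : forall u p, is_start u -> Y (u ++ zeros p) -> con_holds n (envp p) c).
    { intros u p Hu Hy. destruct (cert_ok _ _ _ (HYp u p Hu Hy)) as (r' & Hr' & Hc' & _).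
      rewrite Hr in Hr'. injection Hr' as <-. auto. }
    destruct c as [v|v v'|v]; simpl.
    + intros x (u & p & Hu & Hy & ->). specialize (Hcon u p Hu Hy). simpl in Hcon.
      rewrite Hcon, app_nil_r. apply Hu.
    + intros x y (u & p & Hu & Hy & ->) (u' & p' & Hu' & Hy' & ->) Hs.
      destruct (same_run_start _ _ _ (proj2 Hu) Hs) as [j E].
      apply start_unique in E; [|apply Hu'|apply Hu]. destruct E as [-> _].
      rewrite (section_pos Y u p' p) by auto. specialize (Hcon u p Hu Hy). simpl in Hcon.
      rewrite Hcon, zeros_S. reflexivity.
    + intros x (u & p & Hu & Hy & ->). specialize (Hcon u p Hu Hy). simpl in Hcon.
      rewrite Hcon. exists u. split; auto. apply Hu.
  - intros a v Ha.
    assert (HvV : v < V) by (apply Hv1; eapply nth_error_In; eauto).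
    apply eqv_cells; auto.
    + exact (Hsel_act _ (Henv v HvV)).
    + intros u j Hu Hy. exists (envp j v). split; [exists u, j; auto|].
      eapply Hargs; eauto.
    + intros u j Hu Hs. destruct (Hsel _ _ _ Hu Hs) as (p & Hy & ->).
      exists p. split; auto. symmetry. eapply Hargs; eauto.
Qed.

Theorem completeness :
  labelling_ok rules V (input_set n) cert_act cert_thrM cert_thr cert_label.
Proof.
  split.
  - now intros c [Hc _].
  - intros x [He Hp]. assert (Hx : even x) by (apply (even_zeros x 1); exact He).
    split; auto. destruct (even_round x Hx) as (u & j & Hu & ->).
    change [false] with (zeros 1) in Hp. rewrite <- zeros_add, run_cell in Hp by auto.
    rewrite run_cell by auto. simpl in *. lia.
  - intros x Hx. destruct (even_round x Hx) as (u & j & Hu & ->).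
    exists k. rewrite <- zeros_add, act_pos by auto. lia.
  - intros i c _ [He [env Hc]]. split; auto.
    assert (pos (run c) < length cert) by (apply nth_error_Some; congruence). lia.
  - intros u Hu. rewrite <- (app_nil_r u). apply (label_pos u 0 0); auto.
  - apply cert_bounded.
  - apply cert_thick.
  - apply cert_distinct.
  - apply cert_clause.
Qed.

End Completeness.

(** * Definable predicates *)

Definition assign_pred : Type := (nat -> node) -> (nat -> node -> Prop) -> Prop.

(** Definability by meaning: closure lemmas assemble the formulas, which are never written out. *)
Definition definable (Q : assign_pred) : Prop :=
  exists phi, forall fo so, sat fo so phi <-> Q fo so.

Fixpoint below (b : nat) (phi : form) : Prop :=
  match phi with
  | FS0 x y | FS1 x y => x < b /\ y < b
  | FMem x X => x < b /\ X < b
  | FNeg p => below b p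
  | FAnd p q => below b p /\ below b q
  | FAllFO x p | FAllSO x p | FAllPath x p => x < b /\ below b p
  end.

Lemma below_mono b b' phi : b <= b' -> below b phi -> below b' phi.
Proof. intros Hb. induction phi; simpl; intuition lia. Qed.

Lemma below_exists phi : exists b, below b phi.
Proof.
  induction phi as [x y|x y|x y|p [b IH]|p [b IH] q [b' IH']|x p [b IH]|x p [b IH]|x p [b IH]].
  1-3: exists (S (x + y)); simpl; lia.
  - exists b. auto.
  - exists (b + b'). simpl. split; [apply below_mono with b|apply below_mono with b']; auto; lia.
  - exists (S (x + b)). simpl. split; [lia|apply below_mono with b; auto; lia].
  - exists (S (x + b)). simpl. split; [lia|apply below_mono with b; auto; lia].
  - exists (S (x + b)). simpl. split; [lia|apply below_mono with b; auto; lia].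
Qed.

Lemma upd_agree {A : Type} (f g : nat -> A) b x a :
  (forall j, j < b -> f j = g j) -> forall j, j < b -> upd f x a j = upd g x a j.
Proof. intros H j Hj. unfold upd. destruct (Nat.eqb j x); auto. Qed.

Lemma sat_agree b phi fo fo' so so' :
  below b phi -> (forall j, j < b -> fo j = fo' j) -> (forall j, j < b -> so j = so' j) ->
  (sat fo so phi <-> sat fo' so' phi).
Proof.
  revert fo fo' so so'.
  induction phi as [x y|x y|x X|p IH|p IHp q IHq|x p IH|x p IH|x p IH];
    intros fo fo' so so' Hb Hf Hs; simpl in *.
  - destruct Hb. now rewrite !Hf by auto.
  - destruct Hb. now rewrite !Hf by auto.
  - destruct Hb. rewrite Hf, Hs by auto. reflexivity.
  - rewrite (IH fo fo' so so') by auto. reflexivity.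
  - destruct Hb. rewrite (IHp fo fo' so so'), (IHq fo fo' so so') by auto. reflexivity.
  - assert (E : forall u, sat (upd fo x u) so p <-> sat (upd fo' x u) so' p).
    { intros u. apply IH; [tauto|now apply upd_agree|auto]. }
    split; intros H u; [apply -> E|apply <- E]; apply H.
  - assert (E : forall S, sat fo (upd so x S) p <-> sat fo' (upd so' x S) p).
    { intros S. apply IH; [tauto|auto|now apply upd_agree]. }
    split; intros H S; [apply -> E|apply <- E]; apply H.
  - assert (E : forall S, sat fo (upd so x S) p <-> sat fo' (upd so' x S) p).
    { intros S. apply IH; [tauto|auto|now apply upd_agree]. }
    unfold measure_one. split; apply null_sub; intros w H H'; apply H; now apply E.
Qed.

Lemma upd_same {A : Type} (f : nat -> A) x a : upd f x a x = a.
Proof. unfold upd. now rewrite Nat.eqb_refl. Qed.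

Lemma def_ext (Q Q' : assign_pred) :
  (forall fo so, Q fo so <-> Q' fo so) -> definable Q -> definable Q'.
Proof. intros H [phi Hp]. exists phi. intros fo so. now rewrite Hp. Qed.

Lemma def_S0 x y : definable (fun fo so => fo y = fo x ++ [false]).
Proof. exists (FS0 x y). reflexivity. Qed.

Lemma def_S1 x y : definable (fun fo so => fo y = fo x ++ [true]).
Proof. exists (FS1 x y). reflexivity. Qed.

Lemma def_mem x X : definable (fun fo so => so X (fo x)).
Proof. exists (FMem x X). reflexivity. Qed.

Lemma def_not Q : definable Q -> definable (fun fo so => ~ Q fo so).
Proof. intros [p Hp]. exists (FNeg p). intros. simpl. now rewrite Hp. Qed.

Lemma def_and Q Q' : definable Q -> definable Q' -> definable (fun fo so => Q fo so /\ Q' fo so).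
Proof. intros [p Hp] [q Hq]. exists (FAnd p q). intros. simpl. now rewrite Hp, Hq. Qed.

Lemma def_or Q Q' : definable Q -> definable Q' -> definable (fun fo so => Q fo so \/ Q' fo so).
Proof.
  intros H H'. apply def_ext with (fun fo so => ~ (~ Q fo so /\ ~ Q' fo so)).
  - intros. tauto.
  - auto using def_not, def_and.
Qed.

Lemma def_imp Q Q' : definable Q -> definable Q' -> definable (fun fo so => Q fo so -> Q' fo so).
Proof.
  intros H H'. apply def_ext with (fun fo so => ~ (Q fo so /\ ~ Q' fo so)).
  - intros. tauto.
  - auto using def_not, def_and.
Qed.

Lemma def_iff Q Q' : definable Q -> definable Q' -> definable (fun fo so => Q fo so <-> Q' fo so).
Proof. intros. apply def_and; auto using def_imp. Qed.

(** Lets side conditions about the fixed program, such as lookups in the list of rules, occur inside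
    definable predicates. *)
Lemma def_const (C : Prop) : definable (fun _ _ => C).
Proof.
  assert (H : definable (fun fo so => so 0 (fo 0) /\ ~ so 0 (fo 0))).
  { auto using def_and, def_not, def_mem. }
  destruct (classic C) as [HC|HC].
  - apply def_ext with (2 := def_not _ H). tauto.
  - apply def_ext with (2 := H). tauto.
Qed.

(* Bound variables are numerals, so that the freshness conditions hold by conversion. *)
Lemma def_all x (Q : node -> assign_pred) :
  definable (fun fo so => Q (fo x) fo so) ->
  (forall u fo so, Q u (upd fo x u) so <-> Q u fo so) ->
  definable (fun fo so => forall u, Q u fo so).
Proof.
  intros [p Hp] Hf. exists (FAllFO x p). intros fo so. simpl.
  assert (E : forall u, sat (upd fo x u) so p <-> Q u fo so).
  { intros u. rewrite Hp, upd_same. apply Hf. }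
  split; intros H u; apply E, H.
Qed.

Lemma def_all_set X (Q : (node -> Prop) -> assign_pred) :
  definable (fun fo so => Q (so X) fo so) ->
  (forall S fo so, Q S fo (upd so X S) <-> Q S fo so) ->
  definable (fun fo so => forall S, Q S fo so).
Proof.
  intros [p Hp] Hf. exists (FAllSO X p). intros fo so. simpl.
  assert (E : forall S, sat fo (upd so X S) p <-> Q S fo so).
  { intros S. rewrite Hp, upd_same. apply Hf. }
  split; intros H S; apply E, H.
Qed.

Lemma def_ex x (Q : node -> assign_pred) :
  definable (fun fo so => Q (fo x) fo so) ->
  (forall u fo so, Q u (upd fo x u) so <-> Q u fo so) ->
  definable (fun fo so => exists u, Q u fo so).
Proof.
  intros H Hf. apply def_ext with (fun fo so => ~ forall u, ~ Q u fo so).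
  - intros fo so. split; [apply not_all_not_ex|intros [u Hu] Hn; now apply (Hn u)].
  - apply def_not. apply (def_all x (fun u fo so => ~ Q u fo so)).
    + now apply def_not.
    + intros. now rewrite Hf.
Qed.

Lemma def_ex_set X (Q : (node -> Prop) -> assign_pred) :
  definable (fun fo so => Q (so X) fo so) ->
  (forall S fo so, Q S fo (upd so X S) <-> Q S fo so) ->
  definable (fun fo so => exists S, Q S fo so).
Proof.
  intros H Hf. apply def_ext with (fun fo so => ~ forall S, ~ Q S fo so).
  - intros fo so. split; [apply not_all_not_ex|intros [u Hu] Hn; now apply (Hn u)].
  - apply def_not. apply (def_all_set X (fun u fo so => ~ Q u fo so)).
    + now apply def_not.
    + intros. now rewrite Hf.
Qed.

Lemma def_null X (Q : (node -> Prop) -> assign_pred) :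
  definable (fun fo so => Q (so X) fo so) ->
  (forall S fo so, Q S fo (upd so X S) <-> Q S fo so) ->
  definable (fun fo so => mu_null (fun w => Q (path_of w) fo so)).
Proof.
  intros [p Hp] Hf. exists (FAllPath X (FNeg p)). intros fo so. simpl. unfold measure_one.
  assert (E : forall S, sat fo (upd so X S) p <-> Q S fo so).
  { intros S. rewrite Hp, upd_same. apply Hf. }
  split; apply null_sub; intros w H; [|apply NNPP in H]; apply E in H; auto.
Qed.

Lemma def_forall_nth {A : Type} (l : list A) (Q : nat -> A -> assign_pred) :
  (forall k a, nth_error l k = Some a -> definable (Q k a)) ->
  definable (fun fo so => forall k a, nth_error l k = Some a -> Q k a fo so).
Proof.
  revert Q. induction l as [|a l IH]; intros Q H.
  - apply def_ext with (2 := def_const True). intros fo so. split; auto. intros _ [|] a; discriminate.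
  - apply def_ext with (fun fo so => Q 0 a fo so /\
      forall k a, nth_error l k = Some a -> Q (S k) a fo so).
    + intros fo so. split.
      * intros [H0 HS] [|k] b E; [now injection E as <-|auto].
      * intros HQ. split; [now apply HQ|]. intros k b E. now apply (HQ (S k)).
    + apply def_and; [now apply H|]. apply (IH (fun k => Q (S k))). intros k b E. now apply H.
Qed.

Lemma def_exists_nth {A : Type} (l : list A) (Q : nat -> A -> assign_pred) :
  (forall k a, definable (Q k a)) ->
  definable (fun fo so => exists k a, nth_error l k = Some a /\ Q k a fo so).
Proof.
  intros H.
  apply def_ext with (fun fo so => ~ forall k a, nth_error l k = Some a -> ~ Q k a fo so).
  - intros fo so. split.
    + intros Hn. apply NNPP. intros He. apply Hn. intros k a E HQa. apply He. eauto.
    + intros (k & a & E & Hq) Hn. now apply (Hn k a).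
  - apply def_not. apply def_forall_nth. auto using def_not.
Qed.

Lemma def_forall_In {A : Type} (l : list A) (Q : A -> assign_pred) :
  (forall a, In a l -> definable (Q a)) ->
  definable (fun fo so => forall a, In a l -> Q a fo so).
Proof.
  intros H. apply def_ext with (fun fo so => forall k a, nth_error l k = Some a -> Q a fo so).
  - intros fo so. split.
    + intros HQ a Ha. destruct (In_nth_error _ _ Ha) as [k Hk]. eauto.
    + intros HQ k a Ha. apply HQ. eapply nth_error_In; eauto.
  - apply def_forall_nth. intros k a Ha. apply H. eapply nth_error_In; eauto.
Qed.

Lemma def_forall_lt n (Q : nat -> assign_pred) :
  (forall v, definable (Q v)) -> definable (fun fo so => forall v, v < n -> Q v fo so).
Proof.
  intros H. apply def_ext with (fun fo so => forall a, In a (seq 0 n) -> Q a fo so).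
  - intros fo so. split; intros HQ v Hv; apply HQ; apply in_seq in Hv || apply in_seq; lia.
  - apply def_forall_In. auto.
Qed.

(* Families of sets: two infinite disjoint blocks of set variables, of which a formula
   uses only a finite part. *)
Definition set_fam {A : Type} (s : bool) (so : nat -> A) (W : nat -> A) (k : nat) : A :=
  if Nat.ltb k 10 then so k else
  if Bool.eqb (Nat.odd k) s then W (Nat.div2 (k - 10)) else so k.

(** Indices below 10 stay free for single sets; parity separates the two blocks. *)
Definition fam_index (s : bool) (j : nat) : nat := 10 + Nat.b2n s + 2 * j.

Definition fam {A : Type} (s : bool) (so : nat -> A) (j : nat) : A := so (fam_index s j).

Lemma fam_index_odd s j : Nat.odd (fam_index s j) = s.
Proof.
  unfold fam_index. rewrite Nat.odd_add_mul_2. destruct s; reflexivity.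
Qed.

Lemma fam_index_inv k : 10 <= k -> k = fam_index (Nat.odd k) (Nat.div2 (k - 10)).
Proof.
  intros H. unfold fam_index. pose proof (Nat.div2_odd (k - 10)) as E.
  replace (Nat.odd (k - 10)) with (Nat.odd k) in E by (now rewrite Nat.odd_sub, Bool.xorb_false_r by lia).
  lia.
Qed.

Lemma set_fam_index {A : Type} s s' (so W : nat -> A) j :
  set_fam s so W (fam_index s' j) = if Bool.eqb s' s then W j else so (fam_index s' j).
Proof.
  unfold set_fam. rewrite fam_index_odd.
  replace (Nat.ltb (fam_index s' j) 10) with false.
  2:{ symmetry. apply Nat.ltb_ge. unfold fam_index. lia. }
  replace (Nat.div2 (fam_index s' j - 10)) with j; auto.
  unfold fam_index. destruct s'.
  - replace (10 + Nat.b2n true + 2 * j - 10) with (S (2 * j)) by (simpl; lia).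
    now rewrite Nat.div2_succ_double.
  - replace (10 + Nat.b2n false + 2 * j - 10) with (2 * j) by (simpl; lia).
    now rewrite Nat.div2_double.
Qed.

Lemma fam_set_other {A : Type} s (so W : nat -> A) : fam (negb s) (set_fam s so W) = fam (negb s) so.
Proof.
  apply functional_extensionality. intros j. unfold fam. rewrite set_fam_index.
  now destruct s.
Qed.

Definition exists_sets (l : list nat) (phi : form) : form :=
  fold_right (fun X p => FNeg (FAllSO X (FNeg p))) phi l.

Lemma sat_exists_sets l phi fo so :
  sat fo so (exists_sets l phi) <->
  exists so', (forall j, ~ In j l -> so' j = so j) /\ sat fo so' phi.
Proof.
  revert so. induction l as [|X l IH]; intros so.
  - split.
    + intros H. exists so. auto.
    + intros (so' & E & H). replace so with so'; auto. apply functional_extensionality. auto.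
  - split.
    + intros H. apply not_all_not_ex in H. destruct H as [S H]. apply IH in H.
      destruct H as (so' & E & H). exists so'. split; auto. intros j Hj.
      rewrite E by (intros ?; apply Hj; now right). unfold upd.
      destruct (Nat.eqb_spec j X) as [->|]; auto. exfalso. apply Hj. now left.
    + intros (so' & E & H) Hn. apply (Hn (so' X)). apply IH. exists so'. split; auto.
      intros j Hj. unfold upd. destruct (Nat.eqb_spec j X) as [->|]; auto.
      apply E. intros [->|]; auto.
Qed.

(** All variables of the formula are below some [b], so quantifying the first [b] members of the
    block suffices: changing the others does not affect its truth. *)
Lemma def_ex_fam s (Q : (nat -> node -> Prop) -> assign_pred) :
  definable (fun fo so => Q (fam s so) fo so) ->
  (forall W fo so, Q W fo (set_fam s so W) <-> Q W fo so) ->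
  definable (fun fo so => exists W, Q W fo so).
Proof.
  intros [p Hp] Hf. destruct (below_exists p) as [b Hb].
  exists (exists_sets (map (fam_index s) (seq 0 b)) p). intros fo so.
  rewrite sat_exists_sets. split.
  - intros (so' & E & H). exists (fam s so'). apply Hf.
    apply Hp in H. revert H. set (W := fam s so').
    replace (set_fam s so W) with so'; auto.
    apply functional_extensionality. intros k.
    assert (Hk : ~ (10 <= k /\ Nat.odd k = s) -> ~ In k (map (fam_index s) (seq 0 b))).
    { intros Hk Hi. apply Hk. apply in_map_iff in Hi. destruct Hi as (j & <- & _).
      split; [unfold fam_index; lia|apply fam_index_odd]. }
    destruct (le_lt_dec 10 k) as [Hle|Hlt].
    + rewrite (fam_index_inv k Hle) at 2. rewrite set_fam_index.
      destruct (Bool.eqb_spec (Nat.odd k) s) as [Es|Es].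
      * unfold W, fam. rewrite (fam_index_inv k Hle) at 1. now rewrite Es.
      * rewrite <- fam_index_inv by auto. apply E. apply Hk. tauto.
    + unfold set_fam. replace (Nat.ltb k 10) with true by (symmetry; now apply Nat.ltb_lt).
      apply E. apply Hk. lia.
  - intros [W H]. apply Hf in H.
    set (so' := fun k => if excluded_middle_informative (In k (map (fam_index s) (seq 0 b)))
                         then set_fam s so W k else so k).
    exists so'. split.
    + intros j Hj. unfold so'. destruct excluded_middle_informative; tauto.
    + apply (sat_agree b p fo fo (set_fam s so W)); auto.
      * intros k Hk. unfold so'. destruct excluded_middle_informative as [|Hn]; auto.
        unfold set_fam. destruct (Nat.ltb_spec k 10) as [|Hle]; auto.
        destruct (Bool.eqb_spec (Nat.odd k) s) as [Es|Es]; auto.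
        exfalso. apply Hn. apply in_map_iff. exists (Nat.div2 (k - 10)).
        split; [symmetry; rewrite <- Es; now apply fam_index_inv|].
        apply in_seq. split; [apply Nat.le_0_l|].
        apply Nat.le_lt_trans with (k - 10); [apply Nat.div2_decr|]; lia.
      * apply Hp. replace (fam s (set_fam s so W)) with W; auto.
        apply functional_extensionality. intros j. unfold fam. rewrite set_fam_index.
        now rewrite Bool.eqb_reflx.
Qed.

(** * The formula expressing the existence of a labelling *)

Ltac is_fresh := intros; reflexivity.

Lemma def_zr x y : definable (fun fo so => zr (fo x) (fo y)).
Proof.
  apply def_ext with (fun fo so => forall S : node -> Prop, S (fo x) ->
    (forall z z', z' = z ++ [false] -> S z -> S z') -> S (fo y)).
  - intros fo so. split.
    + intros H. apply (H (zr (fo x))); [apply zr_refl|].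
      intros z z' -> [i ->]. exists (S i). now rewrite zeros_S.
    + intros [i ->] S H0 HS. induction i as [|i IH]; [now rewrite app_nil_r|].
      rewrite zeros_S. eapply HS; eauto.
  - apply (def_all_set 4); [|is_fresh]. apply def_imp; [apply def_mem|]. apply def_imp; [|apply def_mem].
    apply (def_all 8); [|is_fresh]. apply (def_all 9); [|is_fresh].
    apply def_imp; [apply def_S0|]. apply def_imp; apply def_mem.
Qed.

Lemma def_pre x y : definable (fun fo so => pre (fo x) (fo y)).
Proof.
  apply def_ext with (fun fo so => forall S : node -> Prop, S (fo x) ->
    (forall z z', z' = z ++ [false] \/ z' = z ++ [true] -> S z -> S z') -> S (fo y)).
  - intros fo so. split.
    + intros H. apply (H (pre (fo x))); [apply pre_refl|].
      intros z z' [-> | ->] Hp; eapply pre_trans; eauto using pre_app.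
    + intros [s ->] S H0 HS. induction s as [|b s IH] using rev_ind; [now rewrite app_nil_r|].
      rewrite app_assoc. eapply HS; [|exact IH]. destruct b; auto.
  - apply (def_all_set 4); [|is_fresh]. apply def_imp; [apply def_mem|]. apply def_imp; [|apply def_mem].
    apply (def_all 8); [|is_fresh]. apply (def_all 9); [|is_fresh].
    apply def_imp; [apply def_or; [apply def_S0|apply def_S1]|]. apply def_imp; apply def_mem.
Qed.

Lemma def_even x : definable (fun fo so => even (fo x)).
Proof.
  apply def_ext with (fun fo so => exists S : node -> Prop,
    (forall z, (forall y, z <> y ++ [false] /\ z <> y ++ [true]) -> S z) /\
    (forall y z, z = y ++ [false] -> (S z <-> S y)) /\
    (forall y z, z = y ++ [true] -> (S z <-> ~ S y)) /\ S (fo x)).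
  - intros fo so. split.
    + intros (S & H0 & HF & HT & Hx).
      assert (HS : forall z, S z <-> even z).
      { intros z. induction z as [|b z IH] using rev_ind.
        - split; [reflexivity|]. intros _. apply H0. intros y. split; intros E; destruct y; discriminate.
        - unfold even in *. rewrite odd_ones_app. destruct b; simpl.
          + rewrite (HT z) by auto. rewrite IH. now destruct (odd_ones z).
          + rewrite (HF z) by auto. rewrite IH. now destruct (odd_ones z). }
      now apply HS.
    + intros Hx. exists even. split; [|split; [|split]]; auto.
      * intros z Hz. destruct z as [|b z] using rev_ind; [reflexivity|].
        destruct (Hz z). destruct b; congruence.
      * intros y z ->. apply (even_zeros y 1).
      * intros y z ->. unfold even. rewrite odd_ones_app. now destruct (odd_ones y).
  - apply (def_ex_set 4); [|is_fresh]. repeat apply def_and.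
    + apply (def_all 8); [|is_fresh]. apply def_imp; [|apply def_mem].
      apply (def_all 9); [|is_fresh]. apply def_and; apply def_not; [apply def_S0|apply def_S1].
    + apply (def_all 8); [|is_fresh]. apply (def_all 9); [|is_fresh].
      apply def_imp; [apply def_S0|]. apply def_iff; apply def_mem.
    + apply (def_all 8); [|is_fresh]. apply (def_all 9); [|is_fresh].
      apply def_imp; [apply def_S1|]. apply def_iff; [|apply def_not]; apply def_mem.
    + apply def_mem.
Qed.

(** The detour through a set keeps [fo x] outside all first-order quantifiers, so [x] may coincide
    with a bound variable. *)
Lemma def_start x : definable (fun fo so => start (fo x)).
Proof.
  apply def_ext with (fun fo so => exists S : node -> Prop, S (fo x) /\
    forall z, S z -> forall y, z <> y ++ [false]).
  - intros fo so. split.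
    + intros (S & Hx & HS) y. now apply HS.
    + intros H. exists (fun z => z = fo x). split; auto. intros z ->. exact H.
  - apply (def_ex_set 4); [|is_fresh]. apply def_and; [apply def_mem|].
    apply (def_all 8); [|is_fresh]. apply def_imp; [apply def_mem|].
    apply (def_all 9); [|is_fresh]. apply def_not, def_S0.
Qed.

Lemma def_is_start x : definable (fun fo so => is_start (fo x)).
Proof. apply def_and; [apply def_even|apply def_start]. Qed.

Definition szr (x y : node) : Prop := exists z, z = x ++ [false] /\ zr z y.

Lemma szr_spec x y : szr x y <-> exists i, y = x ++ zeros (S i).
Proof.
  split.
  - intros (z & -> & i & ->). exists i. now rewrite <- app_assoc.
  - intros [i ->]. exists (x ++ [false]). split; auto. exists i. now rewrite <- app_assoc.
Qed.

Lemma def_szr x y : x <> 9 -> y <> 9 -> definable (fun fo so => szr (fo x) (fo y)).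
Proof.
  intros Hx Hy. apply (def_ex 9 (fun z fo so => z = fo x ++ [false] /\ zr z (fo y))).
  - apply def_and; [apply def_S0|apply def_zr].
  - intros. unfold upd. apply Nat.eqb_neq in Hx, Hy. now rewrite Hx, Hy.
Qed.

(** [io] for a path given as a set, with prefixes in place of lengths, which formulas cannot
    mention. *)
Definition io_set (p S : node -> Prop) : Prop :=
  forall v, p v -> exists t, p t /\ pre v t /\ S t.

Lemma io_set_path S w : io_set (path_of w) S <-> io S w.
Proof.
  split.
  - intros H n. destruct (H (take w n) (take_path w n)) as (t & Ht & Hp & HS).
    exists t. apply pre_length in Hp. rewrite take_length in Hp. auto.
  - intros H v Hv. destruct (H (length v)) as (t & Hl & Ht & HS). exists t.
    split; auto. split; auto. now apply path_pre_length with w.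
Qed.

#[local] Instance mu_null_proper :
  Proper (pointwise_relation (nat -> bool) iff ==> iff) mu_null.
Proof. intros N N' H. split; apply null_sub; intros w; apply H. Qed.

Lemma def_io (Q : node -> assign_pred) :
  definable (fun fo so => Q (fo 1) fo so) ->
  (forall u fo so, Q u (upd fo 1 u) so <-> Q u fo so) ->
  (forall v u fo so, Q u (upd fo 0 v) so <-> Q u fo so) ->
  definable (fun fo so => io_set (so 0) (fun t => Q t fo so)).
Proof.
  intros HQ H1 H0. unfold io_set.
  apply (def_all 0 (fun v fo so => so 0 v -> exists t, so 0 t /\ pre v t /\ Q t fo so)).
  - apply def_imp; [apply def_mem|].
    apply (def_ex 1 (fun t fo so => so 0 t /\ pre (fo 0) t /\ Q t fo so)).
    + repeat apply def_and; auto using def_mem, def_pre.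
    + intros. now rewrite H1.
  - intros v fo so. setoid_rewrite H0. reflexivity.
Qed.

Lemma def_unif X : definable (fun fo so => unif (so X)).
Proof.
  apply def_ext with (fun fo so => forall x y, y = x ++ [false] -> (so X x <-> so X y)).
  - intros fo so. split.
    + intros H x. now apply H.
    + intros H x y ->. apply H.
  - apply (def_all 1); [|is_fresh]. apply (def_all 2); [|is_fresh].
    apply def_imp; [apply def_S0|]. apply def_iff; apply def_mem.
Qed.

Lemma def_hit Thr (Q : node -> assign_pred) :
  definable (fun fo so => Q (fo 2) fo so) ->
  (forall u fo so, Q u (upd fo 2 u) so <-> Q u fo so) ->
  definable (fun fo so => hit (so Thr) (fun c => Q c fo so) (fo 1)).
Proof.
  intros HQ H2. unfold hit.
  apply def_and; [apply def_mem|].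
  apply (def_ex 2 (fun c fo so => Q c fo so /\ zr (c ++ [true]) (fo 1))).
  - apply def_and; auto.
    apply def_ext with (fun fo so => exists d, d = fo 2 ++ [true] /\ zr d (fo 1)).
    + intros fo so. split; [intros (d & -> & H); auto|eauto].
    + apply (def_ex 3); [|is_fresh]. apply def_and; [apply def_S1|apply def_zr].
  - intros. now rewrite H2.
Qed.

Lemma def_io_hit Thr X : definable (fun fo so => io_set (so 0) (hit (so Thr) (so X))).
Proof.
  apply (def_io (fun t fo so => hit (so Thr) (so X) t)); [|is_fresh|is_fresh].
  apply (def_hit Thr (fun c fo so => so X c)); [|is_fresh]. apply def_mem.
Qed.

Lemma def_io_hit_restr Thr X Z :
  definable (fun fo so => io_set (so 0) (hit (so Thr) (restr (so X) (so Z)))).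
Proof.
  apply (def_io (fun t fo so => hit (so Thr) (restr (so X) (so Z)) t)); [|is_fresh|is_fresh].
  apply (def_hit Thr (fun c fo so => restr (so X) (so Z) c)); [|is_fresh].
  apply def_and; apply def_mem.
Qed.

(** Indices of the form [5 + t] differ from the bound set variables 0 and 4 by computation, as
    [is_fresh] requires. *)
Lemma def_eqv t x y :
  definable (fun fo so => eqv (so (5 + t)) (so 2) (so (5 + x)) (so (5 + y))).
Proof.
  apply def_ext with (fun fo so => forall Z, unif Z -> mu_null (fun w =>
    ~ (io_set (path_of w) (hit (so (5 + t)) (restr (so (5 + x)) Z)) <->
       io_set (path_of w) (hit (so 2) (restr (so (5 + y)) Z))))).
  - intros fo so. unfold eqv. now setoid_rewrite io_set_path.
  - apply (def_all_set 4); [|is_fresh]. apply def_imp; [apply def_unif|].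
    apply (def_null 0 (fun p fo so => ~ (io_set p (hit (so (5 + t)) (restr (so (5 + x)) (so 4))) <->
       io_set p (hit (so 2) (restr (so (5 + y)) (so 4)))))); [|is_fresh].
    apply def_not. apply def_iff; apply def_io_hit_restr.
Qed.

Lemma def_section X : definable (fun fo so => section (so X)).
Proof.
  apply def_ext with (fun fo so => forall x y, so X x -> so X y -> ~ szr x y).
  - intros fo so. split.
    + intros H x i Hx Hi. destruct i as [|i]; auto. exfalso. apply (H x _ Hx Hi).
      apply szr_spec. now exists i.
    + intros H x y Hx Hy Hs. apply szr_spec in Hs. destruct Hs as [i ->].
      discriminate (H x (S i) Hx Hy).
  - apply (def_all 1); [|is_fresh]. apply (def_all 2); [|is_fresh].
    apply def_imp; [apply def_mem|]. apply def_imp; [apply def_mem|].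
    apply def_not, def_szr; discriminate.
Qed.

Lemma def_subset X Y : definable (fun fo so => forall x, so X x -> so Y x).
Proof. apply (def_all 1); [|is_fresh]. apply def_imp; apply def_mem. Qed.

Lemma def_bounded : definable (fun fo so => bounded_cond (so 1)).
Proof.
  apply def_ext with (fun fo so => forall Z, unif Z -> mu_null (fun w =>
    io_set (path_of w) (restr even Z) /\
    ~ io_set (path_of w) (fun c => restr even Z c /\ ~ so 1 c))).
  - intros fo so. unfold bounded_cond. now setoid_rewrite io_set_path.
  - apply (def_all_set 4); [|is_fresh]. apply def_imp; [apply def_unif|].
    apply (def_null 0 (fun p fo so => io_set p (restr even (so 4)) /\
      ~ io_set p (fun c => restr even (so 4) c /\ ~ so 1 c))); [|is_fresh].
    apply def_and; [|apply def_not].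
    + apply (def_io (fun t fo so => restr even (so 4) t)); [|is_fresh|is_fresh].
      apply def_and; [apply def_even|apply def_mem].
    + apply (def_io (fun t fo so => restr even (so 4) t /\ ~ so 1 t)); [|is_fresh|is_fresh].
      apply def_and; [apply def_and; [apply def_even|apply def_mem]|apply def_not, def_mem].
Qed.

Lemma def_thick : definable (fun fo so => thick_cond (so 1) (so 2)).
Proof.
  apply def_ext with (fun fo so => forall Y, (forall y, Y y -> so 1 y) ->
    (forall u, is_start u -> exists y, Y y /\ zr u y) ->
    mu_null (fun w => ~ io_set (path_of w) (hit (so 2) Y))).
  - intros fo so. unfold thick_cond. now setoid_rewrite io_set_path.
  - apply (def_all_set 5); [|is_fresh]. apply def_imp; [apply def_subset|]. apply def_imp.
    + apply (def_all 1); [|is_fresh]. apply def_imp; [apply def_is_start|].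
      apply (def_ex 2); [|is_fresh]. apply def_and; [apply def_mem|apply def_zr].
    + apply (def_null 0 (fun p fo so => ~ io_set p (hit (so 2) (so 5)))); [|is_fresh].
      apply def_not, def_io_hit.
Qed.

Lemma def_distinct : definable (fun fo so => distinct_cond (so 1) (so 2)).
Proof.
  apply def_ext with (fun fo so => forall X Y, (forall x, X x -> so 1 x) -> (forall y, Y y -> so 1 y) ->
    section X -> section Y -> (forall x, X x -> exists y, Y y /\ szr x y) ->
    (forall Z, unif Z -> mu_null (fun w =>
       ~ (io_set (path_of w) (hit (so 2) (restr X Z)) -> io_set (path_of w) (hit (so 2) (restr Y Z))))) ->
    mu_null (fun w => io_set (path_of w) (hit (so 2) X))).
  - intros fo so. unfold distinct_cond. setoid_rewrite io_set_path.
    assert (E : forall X Y : node -> Prop, (forall x, X x -> exists y, Y y /\ szr x y) <->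
                  (forall x, X x -> exists i, Y (x ++ zeros (S i)))).
    { intros X Y. split; intros H x Hx; destruct (H x Hx) as [y Hy].
      - destruct Hy as [Hy Hs]. apply szr_spec in Hs. destruct Hs as [i ->]. eauto.
      - exists (x ++ zeros (S y)). split; auto. apply szr_spec. eauto. }
    setoid_rewrite E. reflexivity.
  - apply (def_all_set 5); [|is_fresh]. apply (def_all_set 6); [|is_fresh].
    apply def_imp; [apply def_subset|]. apply def_imp; [apply def_subset|].
    apply def_imp; [apply def_section|]. apply def_imp; [apply def_section|].
    apply def_imp; [|apply def_imp].
    + apply (def_all 1); [|is_fresh]. apply def_imp; [apply def_mem|].
      apply (def_ex 2); [|is_fresh]. apply def_and; [apply def_mem|apply def_szr; discriminate].
    + apply (def_all_set 4); [|is_fresh]. apply def_imp; [apply def_unif|].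
      apply (def_null 0 (fun p fo so => ~ (io_set p (hit (so 2) (restr (so 5) (so 4))) ->
                            io_set p (hit (so 2) (restr (so 6) (so 4)))))); [|is_fresh].
      apply def_not. apply def_imp; apply def_io_hit_restr.
    + apply (def_null 0 (fun p fo so => io_set p (hit (so 2) (so 5)))); [|is_fresh].
      apply def_io_hit.
Qed.

Section Formula.

Context {T : Type}.
Variables (rules : list (rule T)) (V : nat).

(** Each block holds two interleaved families: [Thr] and [L] in block [false], [M] and [B] in block
    [true]. Of the single variables, 1 is [Act], 2 is [ThrM], 3 the input and 5 the section [Y]. *)
Definition fam_even (W : nat -> node -> Prop) (j : nat) : node -> Prop := W (2 * j).
Definition fam_odd (W : nat -> node -> Prop) (j : nat) : node -> Prop := W (S (2 * j)).

Lemma def_con c : definable (fun fo so => con_sem (so 3) (fam_even (fam true so)) c).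
Proof.
  unfold fam_even, fam. destruct c as [v|v v'|v]; simpl con_sem.
  - apply (def_all 1); [|is_fresh]. apply def_imp; [apply def_mem|apply def_start].
  - apply (def_all 1); [|is_fresh]. apply (def_all 2); [|is_fresh].
    apply def_imp; [apply def_mem|]. apply def_imp; [apply def_mem|].
    apply def_imp; [|apply def_S0]. apply def_or; apply def_zr.
  - apply def_subset.
Qed.

Lemma def_atom k at_ :
  definable (fun fo so => atom_sem rules (so 2) (fam_even (fam false so)) (fam_odd (fam false so))
               (so 5) (fam_even (fam true so)) (fam_odd (fam true so) k) at_).
Proof.
  unfold fam_even, fam_odd, fam. apply def_and; [apply def_section|].
  apply def_and; [|apply def_and].
  - apply (def_all 1); [|is_fresh]. apply def_imp; [apply def_mem|].
    apply def_exists_nth. intros i r. repeat (apply def_and; [apply def_const|]). apply def_mem.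
  - apply def_ext with (fun fo so => forall y, so 5 y ->
      exists b, so (fam_index true (S (2 * k))) b /\ szr y b).
    + intros fo so. split; intros H y Hy; destruct (H y Hy) as [b Hb].
      * destruct Hb as [Hb Hs]. apply szr_spec in Hs. destruct Hs as [i ->]. eauto.
      * exists (y ++ zeros (S b)). split; auto. apply szr_spec. eauto.
    + apply (def_all 1); [|is_fresh]. apply def_imp; [apply def_mem|].
      apply (def_ex 2); [|is_fresh]. apply def_and; [apply def_mem|apply def_szr; discriminate].
  - apply def_forall_nth. intros a v _.
    (* After adding 5 these are the indices of [Thr a], [B k] and [M v]. *)
    exact (def_eqv (5 + 2 * (2 * a)) (6 + 2 * (S (2 * k))) (6 + 2 * (2 * v))).
Qed.

Lemma fam_merge (Q : (nat -> node -> Prop) -> (nat -> node -> Prop) -> Prop) :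
  (exists M B, Q M B) <-> exists W, Q (fam_even W) (fam_odd W).
Proof.
  split.
  - intros (M & B & H).
    exists (fun j => if Nat.odd j then B (Nat.div2 j) else M (Nat.div2 j)).
    assert (EM : fam_even (fun j => if Nat.odd j then B (Nat.div2 j) else M (Nat.div2 j)) = M).
    { apply functional_extensionality. intros j. unfold fam_even.
      now rewrite Nat.odd_mul, Nat.div2_double. }
    assert (EB : fam_odd (fun j => if Nat.odd j then B (Nat.div2 j) else M (Nat.div2 j)) = B).
    { apply functional_extensionality. intros j. unfold fam_odd.
      now rewrite Nat.odd_succ, Nat.even_mul, Nat.div2_succ_double. }
    now rewrite EM, EB.
  - intros [W H]. eauto.
Qed.

Lemma def_clause i r :
  definable (fun fo so => clause_sem rules V (so 3) (so 1) (so 2)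
               (fam_even (fam false so)) (fam_odd (fam false so)) i r).
Proof.
  unfold clause_sem. apply (def_all_set 5); [|is_fresh]. cbv beta.
  apply def_imp; [apply def_subset|]. apply def_imp; [apply def_section|].
  eapply def_ext; [intros fo so; symmetry; apply fam_merge|].
  apply (def_ex_fam true).
  2:{ intros W fo so. pose proof (fam_set_other true so W) as E. simpl negb in E. rewrite E. reflexivity. }
  cbv beta. apply def_and; [|apply def_and; [|apply def_and]].
  - apply def_forall_lt. intros v. apply def_and; [apply def_section|].
    apply def_and; [apply def_subset|].
    apply (def_all 1); [|is_fresh]. apply def_imp; [apply def_mem|].
    apply (def_ex 2); [|is_fresh]. apply def_and; [apply def_mem|].
    apply def_or; apply def_zr.
  - apply def_forall_nth. intros k at_ _. apply def_atom.
  - apply def_forall_In. intros c _. apply def_con.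
  - apply def_forall_nth. intros a v _.
    exact (def_eqv (5 + 2 * (2 * a)) 0 (6 + 2 * (2 * v))).
Qed.

Lemma def_labelling : definable (fun fo so => labelling_ok rules V (so 3) (so 1) (so 2)
               (fam_even (fam false so)) (fam_odd (fam false so))).
Proof.
  apply def_ext with (fun fo so =>
    ((forall c, so 1 c -> even c) /\ (forall x y, y = x ++ [false] -> so 1 y -> so 1 x) /\
     (forall x, even x -> exists y, zr x y /\ ~ so 1 y)) /\
    ((forall i, i < length rules -> forall c, fam_odd (fam false so) i c -> so 1 c) /\
     (forall u, is_start u -> fam_odd (fam false so) 0 u)) /\
    bounded_cond (so 1) /\ thick_cond (so 1) (so 2) /\ distinct_cond (so 1) (so 2) /\
    forall i r, nth_error rules i = Some r -> clause_sem rules V (so 3) (so 1) (so 2)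
               (fam_even (fam false so)) (fam_odd (fam false so)) i r).
  - intros fo so. split.
    + intros ((H1 & H2 & H3) & (H4 & H5) & H6 & H7 & H8 & H9). split; eauto.
      intros x Hx. destruct (H3 x Hx) as (y & [i ->] & Hy). eauto.
    + intros [H1 H2 H3 H4 H5 H6 H7 H8 H9]. repeat split; auto; try (intros; now apply H9).
      * intros x y -> . apply H2.
      * intros x Hx. destruct (H3 x Hx) as [i Hi]. exists (x ++ zeros i). split; auto. now exists i.
      * intros i Hi c. now apply H4.
  - unfold fam_odd at 1 2, fam at 1 2.
    apply def_and; [apply def_and; [|apply def_and]|apply def_and; [apply def_and|]].
    + apply (def_all 1); [|is_fresh]. apply def_imp; [apply def_mem|apply def_even].
    + apply (def_all 1); [|is_fresh]. apply (def_all 2); [|is_fresh].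
      apply def_imp; [apply def_S0|]. apply def_imp; apply def_mem.
    + apply (def_all 1); [|is_fresh]. apply def_imp; [apply def_even|].
      apply (def_ex 2); [|is_fresh]. apply def_and; [apply def_zr|apply def_not, def_mem].
    + apply def_forall_lt. intros i. apply def_subset.
    + apply (def_all 1); [|is_fresh]. apply def_imp; [apply def_is_start|apply def_mem].
    + apply def_and; [apply def_bounded|]. apply def_and; [apply def_thick|].
      apply def_and; [apply def_distinct|].
      apply def_forall_nth. intros i r _. apply def_clause.
Qed.

Theorem def_exists_labelling : definable (fun fo so =>
  exists Act ThrM Thr L, labelling_ok rules V (so 3) Act ThrM Thr L).
Proof.
  apply def_ext with (fun fo so => exists Act ThrM, exists W,
    labelling_ok rules V (so 3) Act ThrM (fam_even W) (fam_odd W)).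
  - intros fo so. setoid_rewrite <- (fam_merge (labelling_ok rules V (so 3) _ _)). reflexivity.
  - apply (def_ex_set 1); [|is_fresh]. apply (def_ex_set 2); [|is_fresh].
    apply (def_ex_fam false); [|is_fresh]. apply def_labelling.
Qed.

End Formula.

(** * Recursive functions as Horn programs *)

Section EvalInduction.

Variables (P : rf -> list nat -> nat -> Prop) (Q : list rf -> list nat -> list nat -> Prop).
Hypothesis Pzero : forall v, P RZero v 0.
Hypothesis Psucc : forall x v, P RSucc (x :: v) (S x).
Hypothesis Pproj : forall i v, i < length v -> P (RProj i) v (nth i v 0).
Hypothesis Pcomp : forall f gs v ys z, eval_list gs v ys -> Q gs v ys -> eval f ys z -> P f ys z ->
  P (RComp f gs) v z.
Hypothesis Pprec0 : forall f g v z, eval f v z -> P f v z -> P (RPrec f g) (0 :: v) z.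
Hypothesis PprecS : forall f g n v r z, eval (RPrec f g) (n :: v) r -> P (RPrec f g) (n :: v) r ->
  eval g (n :: r :: v) z -> P g (n :: r :: v) z -> P (RPrec f g) (S n :: v) z.
Hypothesis Pmu : forall f v n, eval f (n :: v) 0 -> P f (n :: v) 0 ->
  (forall m, m < n -> exists k, eval f (m :: v) (S k) /\ P f (m :: v) (S k)) -> P (RMu f) v n.
Hypothesis Qnil : forall v, Q [] v [].
Hypothesis Qcons : forall g gs v y ys, eval g v y -> P g v y -> eval_list gs v ys -> Q gs v ys ->
  Q (g :: gs) v (y :: ys).

(** The premise of [ev_mu] hides evaluations under an existential quantifier; the recursion reaches
    them by matching on the witness. *)
Fixpoint eval_nested_ind f v z (H : eval f v z) {struct H} : P f v z :=
  match H in eval f v z return P f v z with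
  | ev_zero v => Pzero v
  | ev_succ x v => Psucc x v
  | ev_proj i v Hi => Pproj i v Hi
  | ev_comp f gs v ys z Hg Hf =>
      Pcomp f gs v ys z Hg (eval_list_nested_ind gs v ys Hg) Hf (eval_nested_ind f ys z Hf)
  | ev_prec0 f g v z H0 => Pprec0 f g v z H0 (eval_nested_ind f v z H0)
  | ev_precS f g n v r z Hr Hz =>
      PprecS f g n v r z Hr (eval_nested_ind _ _ r Hr) Hz (eval_nested_ind g _ z Hz)
  | ev_mu f v n H0 Hm =>
      Pmu f v n H0 (eval_nested_ind f _ 0 H0)
        (fun m Hlt => match Hm m Hlt with
                      | ex_intro _ k Hk => ex_intro _ k (conj Hk (eval_nested_ind f _ _ Hk))
                      end)
  end
with eval_list_nested_ind gs v ys (H : eval_list gs v ys) {struct H} : Q gs v ys :=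
  match H in eval_list gs v ys return Q gs v ys with
  | evl_nil v => Qnil v
  | evl_cons g gs v y ys Hy Hys =>
      Qcons g gs v y ys Hy (eval_nested_ind g v y Hy) Hys (eval_list_nested_ind gs v ys Hys)
  end.

End EvalInduction.

Lemma eval_deterministic f v z z' : eval f v z -> eval f v z' -> z = z'.
Proof.
  intros H. revert z'.
  apply (eval_nested_ind (fun f v z => forall z', eval f v z' -> z = z')
                         (fun gs v ys => forall ys', eval_list gs v ys' -> ys = ys'));
    try exact H; clear.
  - intros v z' H. now inversion H.
  - intros x v z' H. now inversion H.
  - intros i v _ z' H. now inversion H.
  - intros f gs v ys z _ IHg _ IHf z' H. inversion H; subst.
    match goal with Hg : eval_list _ _ _ |- _ => apply IHg in Hg; subst end. auto.
  - intros f g v z _ IH z' H. inversion H; subst. auto.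
  - intros f g n v r z _ IHr _ IHz z' H. inversion H; subst.
    match goal with Hr : eval (RPrec _ _) (n :: v) _ |- _ => apply IHr in Hr; subst end. auto.
  - intros f v n _ IH0 Hm n' H. inversion H; subst.
    destruct (lt_eq_lt_dec n n') as [[Hlt|]|Hlt]; auto; exfalso.
    + match goal with H' : forall m, m < n' -> _ |- _ => destruct (H' n Hlt) as [k Hk] end.
      apply IH0 in Hk. discriminate.
    + destruct (Hm n' Hlt) as (k & _ & Hk).
      match goal with H' : eval f (n' :: v) 0 |- _ => apply Hk in H' end. discriminate.
  - intros v ys' H. now inversion H.
  - intros g gs v y ys _ IHy _ IHys ys' H. inversion H; subst. f_equal; auto.
Qed.

Inductive tag : Type :=
| TGoal
| TEval (f : rf)
| TList (gs : list rf)
| TBelow (f : rf).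

(* The argument list of [TEval f] is [z :: v] for [eval f v z], that of [TList gs] is
   [ys ++ v] for [eval_list gs v ys], and [TBelow f] on [n :: v] says that [f] is positive
   on [m :: v] for all [m < n]. *)
Fixpoint rules_eval (f : rf) (n : nat) : list (rule tag) :=
  match f with
  | RZero => [Rule (TEval RZero) (0 :: seq 1 n) [] [CZero 0]]
  | RSucc =>
      match n with
      | 0 => []
      | S m => [Rule (TEval RSucc) (0 :: 1 :: seq 2 m) [] [CSucc 1 0]]
      end
  | RProj i => if Nat.ltb i n then [Rule (TEval (RProj i)) (S i :: seq 1 n) [] []] else []
  | RComp f gs =>
      let b := length gs in
      Rule (TEval (RComp f gs)) (0 :: seq (S b) n)
        [(TList gs, seq 1 b ++ seq (S b) n); (TEval f, 0 :: seq 1 b)] [] ::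
      rules_eval f b ++
      (fix rules_list gs := match gs with
         | [] => [Rule (TList []) (seq 0 n) [] []]
         | g :: gs' =>
             let b := length gs' in
             Rule (TList gs) (0 :: seq 1 b ++ seq (S b) n)
               [(TEval g, 0 :: seq (S b) n); (TList gs', seq 1 b ++ seq (S b) n)] [] ::
             rules_eval g n ++ rules_list gs'
         end) gs
  | RPrec f g =>
      match n with
      | 0 => []
      | S m =>
          Rule (TEval (RPrec f g)) (0 :: 1 :: seq 4 m) [(TEval f, 0 :: seq 4 m)] [CZero 1] ::
          Rule (TEval (RPrec f g)) (0 :: 1 :: seq 4 m)
            [(TEval (RPrec f g), 2 :: 3 :: seq 4 m); (TEval g, 0 :: 3 :: 2 :: seq 4 m)]
            [CSucc 3 1] ::
          rules_eval f m ++ rules_eval g (S (S m))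
      end
  | RMu f =>
      Rule (TEval (RMu f)) (0 :: seq 4 n)
        [(TEval f, 1 :: 0 :: seq 4 n); (TBelow f, 0 :: seq 4 n)] [CZero 1] ::
      Rule (TBelow f) (0 :: seq 4 n) [] [CZero 0] ::
      Rule (TBelow f) (0 :: seq 4 n)
        [(TBelow f, 1 :: seq 4 n); (TEval f, 2 :: 1 :: seq 4 n)] [CSucc 1 0; CSucc 3 2] ::
      rules_eval f (S n)
  end.

(** A named copy of the inner fixpoint of [rules_eval], convertible to it, so that lemmas can speak
    about it. *)
Definition rules_list (n : nat) : list rf -> list (rule tag) :=
  fix rules_list gs := match gs with
    | [] => [Rule (TList []) (seq 0 n) [] []]
    | g :: gs' =>
        let b := length gs' in
        Rule (TList gs) (0 :: seq 1 b ++ seq (S b) n)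
          [(TEval g, 0 :: seq (S b) n); (TList gs', seq 1 b ++ seq (S b) n)] [] ::
        rules_eval g n ++ rules_list gs'
    end.

(** The model used for soundness. [TList] quantifies over splittings because its arguments are one
    flat list. *)
Definition meaning (g : rf) (n : nat) (t : tag) (l : list nat) : Prop :=
  match t with
  | TGoal => eval g [n] 1
  | TEval f => match l with z :: v => eval f v z | [] => True end
  | TList gs => forall ys v, length ys = length gs -> l = ys ++ v -> eval_list gs v ys
  | TBelow f =>
      match l with z :: v => forall m, m < z -> exists k, eval f (m :: v) (S k) | [] => True end
  end.

Definition rule_sound (g : rf) (n : nat) (r : rule tag) : Prop :=
  forall env, (forall c, In c (cons_of r) -> con_holds n env c) ->
    (forall at_, In at_ (body r) -> meaning g n (fst at_) (map env (snd at_))) ->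
    meaning g n (htag r) (map env (hvars r)).

Lemma app_inj_length {A : Type} (l1 l1' l2 l2' : list A) :
  length l1 = length l1' -> l1 ++ l2 = l1' ++ l2' -> l1 = l1' /\ l2 = l2'.
Proof.
  revert l1'. induction l1 as [|a l1 IH]; intros [|a' l1'] Hl H; simpl in *; try discriminate; auto.
  injection H as -> H. injection Hl as Hl. destruct (IH _ Hl H). subst. auto.
Qed.

(** Induction on size reaches the functions inside the list of [RComp]. *)
Fixpoint rf_size (f : rf) : nat :=
  match f with
  | RZero | RSucc | RProj _ => 1
  | RComp f gs => S (rf_size f + list_sum (map rf_size gs))
  | RPrec f g => S (rf_size f + rf_size g)
  | RMu f => S (rf_size f)
  end.

Lemma rules_list_sound g0 n0 n gs :
  (forall f, In f gs -> Forall (rule_sound g0 n0) (rules_eval f n)) ->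
  Forall (rule_sound g0 n0) (rules_list n gs).
Proof.
  induction gs as [|g gs IH]; intros H.
  - constructor; [|constructor]. intros env _ _ [|y ys] v Hl E; [|discriminate]. constructor.
  - cbn [rules_list]. constructor; [|apply Forall_app; split; [apply H; now left|]].
    + intros env _ Hb. cbn [htag hvars body cons_of] in *.
      assert (Hg := Hb _ (or_introl eq_refl)). assert (Hgs := Hb _ (or_intror (or_introl eq_refl))).
      clear Hb. cbn [fst snd meaning] in *.
      intros ys v Hl E. simpl in E. rewrite map_app in *.
      destruct ys as [|y ys]; [discriminate|]. injection E as Ey E. injection Hl as Hl.
      apply app_inj_length in E; [|now rewrite length_map, length_seq].
      destruct E as [<- <-]. subst y. constructor; [exact Hg|].
      now apply Hgs.
    + apply IH. intros f Hf. apply H. now right.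
Qed.

Lemma rules_eval_sound g0 n0 f n : Forall (rule_sound g0 n0) (rules_eval f n).
Proof.
  remember (rf_size f) as s eqn:Es. revert f n Es.
  induction s as [s IH] using (well_founded_induction lt_wf). intros f n ->.
  destruct f as [| |i|f gs|f g|f]; cbn [rules_eval].
  - constructor; [|constructor]. intros env Hc _. pose proof (Hc _ (or_introl eq_refl)) as H0.
    simpl in *. rewrite H0. constructor.
  - destruct n as [|m]; [constructor|]. constructor; [|constructor]. intros env Hc _.
    pose proof (Hc _ (or_introl eq_refl)) as H0. simpl in *. rewrite H0. constructor.
  - destruct (Nat.ltb_spec i n) as [Hi|]; [|constructor]. constructor; [|constructor].
    intros env _ _. simpl.
    replace (env (S i)) with (nth i (map env (seq 1 n)) 0).
    + constructor. now rewrite length_map, length_seq.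
    + rewrite nth_indep with (d' := env 0) by now rewrite length_map, length_seq.
      rewrite map_nth, seq_nth by auto. reflexivity.
  - constructor; [|apply Forall_app; split].
    + intros env _ Hb. cbn [htag hvars body cons_of] in *.
      assert (Hgs := Hb _ (or_introl eq_refl)). assert (Hf := Hb _ (or_intror (or_introl eq_refl))).
      clear Hb. cbn [fst snd meaning map] in *. rewrite map_app in Hgs.
      apply ev_comp with (2 := Hf). apply Hgs; auto. now rewrite length_map, length_seq.
    + eapply IH; [|reflexivity]. simpl. lia.
    + apply rules_list_sound. intros g Hg. eapply IH; [|reflexivity]. simpl.
      enough (rf_size g <= list_sum (map rf_size gs)) by lia.
      clear - Hg. induction gs as [|h gs IHg]; [destruct Hg|]. simpl.
      destruct Hg as [->|Hg]; [lia|]. specialize (IHg Hg). lia.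
  - destruct n as [|m]; [constructor|]. constructor; [|constructor; [|apply Forall_app; split]].
    + intros env Hc Hb. assert (H1 := Hc _ (or_introl eq_refl)).
      assert (Hf := Hb _ (or_introl eq_refl)). clear Hb Hc. simpl in *. rewrite H1. now constructor.
    + intros env Hc Hb. assert (H1 := Hc _ (or_introl eq_refl)).
      assert (Hr := Hb _ (or_introl eq_refl)).
      assert (Hg := Hb _ (or_intror (or_introl eq_refl))). clear Hb Hc. simpl in *.
      rewrite H1. econstructor; eauto.
    + eapply IH; [|reflexivity]. simpl. lia.
    + eapply IH; [|reflexivity]. simpl. lia.
  - constructor; [|constructor; [|constructor]].
    + intros env Hc Hb. assert (H1 := Hc _ (or_introl eq_refl)).
      assert (Hf := Hb _ (or_introl eq_refl)).
      assert (Hl := Hb _ (or_intror (or_introl eq_refl))). clear Hb Hc. simpl in *.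
      rewrite H1 in Hf. now constructor.
    + intros env Hc _. assert (H0 := Hc _ (or_introl eq_refl)). simpl in *. rewrite H0.
      intros m Hm. lia.
    + intros env Hc Hb. assert (H0 := Hc _ (or_introl eq_refl)).
      assert (H1 := Hc _ (or_intror (or_introl eq_refl))).
      assert (Hl := Hb _ (or_introl eq_refl)).
      assert (Hf := Hb _ (or_intror (or_introl eq_refl))). clear Hb Hc. simpl in *.
      intros m Hm. destruct (Nat.eq_dec m (env 1)) as [->|Hne].
      * rewrite H1 in Hf. eauto.
      * apply Hl. lia.
    + eapply IH; [|reflexivity]. simpl. lia.
Qed.

(** * Derivations and their linearisation into certificates *)

Inductive derivable (rs : list (rule tag)) (n : nat) : tag -> list nat -> Prop :=
| der_rule r env : In r rs -> (forall c, In c (cons_of r) -> con_holds n env c) ->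
    (forall at_, In at_ (body r) -> derivable rs n (fst at_) (map env (snd at_))) ->
    derivable rs n (htag r) (map env (hvars r)).

Definition env_of (l : list nat) (j : nat) : nat := nth j l 0.

Lemma map_env_of p v s : map (env_of (p ++ v ++ s)) (seq (length p) (length v)) = v.
Proof.
  revert p. induction v as [|x v IH]; intros p; simpl; auto. f_equal.
  - unfold env_of. now rewrite nth_middle.
  - specialize (IH (p ++ [x])). rewrite <- app_assoc, length_app, Nat.add_comm in IH. exact IH.
Qed.

Lemma map_env_of_end p v n a : n = length v -> a = length p -> map (env_of (p ++ v)) (seq a n) = v.
Proof. intros -> ->. pose proof (map_env_of p v []) as H. now rewrite app_nil_r in H. Qed.

Lemma derivable_by rs n r env t l :
  In r rs -> t = htag r -> l = map env (hvars r) -> Forall (con_holds n env) (cons_of r) ->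
  Forall (fun at_ => derivable rs n (fst at_) (map env (snd at_))) (body r) ->
  derivable rs n t l.
Proof.
  intros Hr -> -> Hc Hb. constructor; auto; now apply Forall_forall.
Qed.

(** Any list [rs] that includes the rules of [f] is allowed, so the induction can descend to
    subfunctions. For lists of functions the length of [ys] is carried along, as it fixes which
    variables hold [v]. *)
Lemma eval_derivable rs n f v z :
  eval f v z -> incl (rules_eval f (length v)) rs -> derivable rs n (TEval f) (z :: v).
Proof.
  intros H.
  apply (eval_nested_ind
    (fun f v z => incl (rules_eval f (length v)) rs -> derivable rs n (TEval f) (z :: v))
    (fun gs v ys => length ys = length gs /\
       (incl (rules_list (length v) gs) rs -> derivable rs n (TList gs) (ys ++ v))));
    try exact H; clear.
  - intros v Hi. eapply (derivable_by rs n _ (env_of ([0] ++ v)));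
      [apply Hi; now left|reflexivity| | |]; simpl.
    + f_equal. symmetry. now apply (map_env_of_end [0]).
    + repeat constructor.
    + constructor.
  - intros x v Hi. eapply (derivable_by rs n _ (env_of ([S x; x] ++ v)));
      [apply Hi; now left|reflexivity| | |]; simpl.
    + do 2 f_equal. symmetry. now apply (map_env_of_end [S x; x]).
    + repeat constructor.
    + constructor.
  - intros i v Hlt Hi. cbn [rules_eval] in Hi.
    rewrite (proj2 (Nat.ltb_lt _ _) Hlt) in Hi.
    eapply (derivable_by rs n _ (env_of ([0] ++ v))); [apply Hi; now left|reflexivity| | |]; simpl.
    + f_equal. symmetry. now apply (map_env_of_end [0]).
    + constructor.
    + constructor.
  - intros f gs v ys z _ [Hlen IHg] _ IHf Hi. cbn [rules_eval] in Hi.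
    apply incl_cons_inv in Hi. destruct Hi as [Hr Hi]. apply incl_app_inv in Hi.
    destruct Hi as [Hif Hig].
    assert (E1 : map (env_of ([z] ++ ys ++ v)) (seq 1 (length gs)) = ys).
    { rewrite <- Hlen. apply (map_env_of [z]). }
    assert (E2 : map (env_of ([z] ++ ys ++ v)) (seq (S (length gs)) (length v)) = v).
    { rewrite app_assoc. apply map_env_of_end; auto. rewrite length_app. simpl. lia. }
    eapply (derivable_by rs n _ (env_of ([z] ++ ys ++ v))); [exact Hr|reflexivity| | |];
      cbn [hvars body cons_of map].
    + now rewrite E2.
    + constructor.
    + constructor; [|constructor; [|constructor]]; cbn [fst snd map].
      * rewrite map_app, E1, E2. now apply IHg.
      * rewrite E1. apply IHf. now rewrite Hlen.
  - intros f g v z _ IH Hi. cbn [rules_eval length] in Hi.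
    apply incl_cons_inv in Hi. destruct Hi as [Hr Hi]. apply incl_cons_inv in Hi.
    destruct Hi as [_ Hi]. apply incl_app_inv in Hi.
    (* Variable 0 is the result and 1 the recursion argument; the other two zeros are padding, since
       the parameters begin at variable 4. *)
    assert (E : map (env_of ([z; 0; 0; 0] ++ v)) (seq 4 (length v)) = v).
    { now apply map_env_of_end. }
    eapply (derivable_by rs n _ (env_of ([z; 0; 0; 0] ++ v))); [exact Hr|reflexivity| | |];
      cbn [hvars body cons_of map].
    + now rewrite E.
    + repeat constructor.
    + constructor; [|constructor]. cbn [fst snd map]. rewrite E. now apply IH.
  - intros f g m v r z _ IHr _ IHz Hi. pose proof (IHr Hi) as Hdr.
    cbn [rules_eval length] in Hi.
    apply incl_cons_inv in Hi. destruct Hi as [_ Hi]. apply incl_cons_inv in Hi.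
    destruct Hi as [Hr Hi]. apply incl_app_inv in Hi.
    assert (E : map (env_of ([z; S m; r; m] ++ v)) (seq 4 (length v)) = v).
    { now apply map_env_of_end. }
    eapply (derivable_by rs n _ (env_of ([z; S m; r; m] ++ v))); [exact Hr|reflexivity| | |];
      cbn [hvars body cons_of map].
    + now rewrite E.
    + repeat constructor.
    + constructor; [|constructor; [|constructor]]; cbn [fst snd map]; rewrite E; auto.
      now apply IHz.
  - intros f v m _ IH0 Hm Hi. cbn [rules_eval] in Hi.
    apply incl_cons_inv in Hi. destruct Hi as [Hr Hi].
    apply incl_cons_inv in Hi. destruct Hi as [Hb0 Hi].
    apply incl_cons_inv in Hi. destruct Hi as [HbS Hi].
    assert (E : forall a b c d, map (env_of ([a; b; c; d] ++ v)) (seq 4 (length v)) = v).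
    { intros. now apply map_env_of_end. }
    assert (Hbelow : forall j, j <= m -> derivable rs n (TBelow f) (j :: v)).
    { induction j as [|j IHj]; intros Hj.
      - eapply (derivable_by rs n _ (env_of ([0; 0; 0; 0] ++ v))); [exact Hb0|reflexivity| | |];
          cbn [hvars body cons_of map].
        + now rewrite E.
        + repeat constructor.
        + constructor.
      - destruct (Hm j Hj) as (k & _ & Hk).
        eapply (derivable_by rs n _ (env_of ([S j; j; S k; k] ++ v))); [exact HbS|reflexivity| | |];
          cbn [hvars body cons_of map].
        + now rewrite E.
        + repeat constructor.
        + constructor; [|constructor; [|constructor]]; cbn [fst snd map]; rewrite E.
          * apply IHj. lia.
          * now apply Hk. }
    eapply (derivable_by rs n _ (env_of ([m; 0; 0; 0] ++ v))); [exact Hr|reflexivity| | |];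
      cbn [hvars body cons_of map].
    + now rewrite E.
    + repeat constructor.
    + constructor; [|constructor; [|constructor]]; cbn [fst snd map]; rewrite E; auto.
  - intros v. split; auto. intros Hi.
    eapply (derivable_by rs n _ (env_of ([] ++ v))); [apply Hi; now left|reflexivity| | |];
      cbn [hvars body cons_of map].
    + symmetry. now apply map_env_of_end.
    + constructor.
    + constructor.
  - intros g gs v y ys _ IHy _ [Hlen IHys]. split; [simpl; auto|]. intros Hi.
    cbn [rules_list] in Hi. apply incl_cons_inv in Hi. destruct Hi as [Hr Hi].
    apply incl_app_inv in Hi. destruct Hi as [Hig Higs].
    assert (E1 : map (env_of ([y] ++ ys ++ v)) (seq 1 (length gs)) = ys).
    { rewrite <- Hlen. apply (map_env_of [y]). }
    assert (E2 : map (env_of ([y] ++ ys ++ v)) (seq (S (length gs)) (length v)) = v).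
    { rewrite app_assoc. apply map_env_of_end; auto. rewrite length_app. simpl. lia. }
    eapply (derivable_by rs n _ (env_of ([y] ++ ys ++ v))); [exact Hr|reflexivity| | |];
      cbn [hvars body cons_of map].
    + now rewrite map_app, E1, E2.
    + constructor.
    + constructor; [|constructor; [|constructor]]; cbn [fst snd map].
      * rewrite E2. now apply IHy.
      * rewrite map_app, E1, E2. now apply IHys.
Qed.

Definition good (rs : list (rule tag)) (n : nat) (C : list (nat * (nat -> nat))) : Prop :=
  forall p i env, nth_error C p = Some (i, env) -> entry_ok rs n C p i env.

Definition derived_in (rs : list (rule tag)) (C : list (nat * (nat -> nat))) (t : tag) (l : list nat) : Prop :=
  exists q i env r, nth_error C q = Some (i, env) /\ nth_error rs i = Some r /\
    htag r = t /\ map env (hvars r) = l.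

(** Justifications are relative forward offsets, so an entry added in front disturbs none of the
    existing ones. *)
Lemma good_cons rs n C i env r :
  good rs n C -> nth_error rs i = Some r -> (forall c, In c (cons_of r) -> con_holds n env c) ->
  (forall at_, In at_ (body r) -> derived_in rs C (fst at_) (map env (snd at_))) ->
  good rs n ((i, env) :: C).
Proof.
  intros HC Hr Hc Hb p i' env' E. destruct p as [|p].
  - injection E as <- <-. exists r. auto.
  - destruct (HC p i' env' E) as (r' & H1 & H2 & H3). exists r'. split; auto.
Qed.

Lemma good_app rs n C C' : good rs n C -> good rs n C' -> good rs n (C ++ C').
Proof.
  intros HC HC' p i env E. destruct (le_lt_dec (length C) p) as [Hle|Hlt].
  - rewrite nth_error_app2 in E by auto. destruct (HC' _ _ _ E) as (r & H1 & H2 & H3).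
    exists r. split; auto. split; auto. intros at_ Hat.
    destruct (H3 at_ Hat) as (q & i' & env' & r' & Hq & H). exists q, i', env', r'. split; auto.
    rewrite nth_error_app2 by lia. rewrite <- Hq. f_equal. lia.
  - rewrite nth_error_app1 in E by auto. destruct (HC _ _ _ E) as (r & H1 & H2 & H3).
    exists r. split; auto. split; auto. intros at_ Hat.
    destruct (H3 at_ Hat) as (q & i' & env' & r' & Hq & H). exists q, i', env', r'. split; auto.
    rewrite nth_error_app1; auto. apply nth_error_Some. congruence.
Qed.

Lemma derived_in_app rs C C' t l :
  derived_in rs C t l \/ derived_in rs C' t l -> derived_in rs (C ++ C') t l.
Proof.
  intros [(q & i & env & r & Hq & H)|(q & i & env & r & Hq & H)].
  - exists q, i, env, r. split; auto. rewrite nth_error_app1; auto.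
    apply nth_error_Some. congruence.
  - exists (length C + q), i, env, r. split; auto. rewrite nth_error_app2 by lia.
    rewrite <- Hq. f_equal. lia.
Qed.

Lemma derivable_all_certificate rs n (env : nat -> nat) (atoms : list (tag * list nat)) :
  (forall at_, In at_ atoms ->
     exists C, good rs n C /\ derived_in rs C (fst at_) (map env (snd at_))) ->
  exists C, good rs n C /\
    forall at_, In at_ atoms -> derived_in rs C (fst at_) (map env (snd at_)).
Proof.
  induction atoms as [|a atoms IH]; intros H.
  - exists []. split; [intros [|p] i env' E; discriminate|intros at_ []].
  - destruct IH as (C & HC & HD). { intros at_ Hat. apply H. now right. }
    destruct (H a (or_introl eq_refl)) as (C' & HC' & HD').
    exists (C' ++ C). split; [now apply good_app|].
    intros at_ [<-|Hat]; apply derived_in_app; auto.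
Qed.

Lemma derivable_certificate rs n t l :
  derivable rs n t l -> exists C, good rs n C /\ derived_in rs C t l.
Proof.
  induction 1 as [r env Hr Hc _ IH].
  destruct (derivable_all_certificate rs n env (body r) IH) as (C & HC & HD).
  destruct (In_nth_error _ _ Hr) as [i Hi].
  exists ((i, env) :: C). split; [now apply good_cons with r|].
  exists 0, i, env, r. auto.
Qed.

(** Variable 1 is the input, and variable 0 is 1, being the successor of the zero in variable 2. *)
Definition goal_rule (g : rf) : rule tag :=
  Rule TGoal [] [(TEval g, [0; 1])] [CIn 1; CSucc 2 0; CZero 2].

Definition program (g : rf) : list (rule tag) := goal_rule g :: rules_eval g 1.

Lemma var_bound_exists (rs : list (rule tag)) : exists V, vars_bounded rs V.
Proof.
  assert (Hl : forall l : list nat, exists V, forall v, In v l -> v < V).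
  { induction l as [|a l [V HV]]; [exists 0; intros v []|].
    exists (S (a + V)). intros v [<-|Hv]; [lia|]. specialize (HV v Hv). lia. }
  induction rs as [|r rs [V HV]]; [exists 0; intros r []|].
  destruct (Hl (hvars r ++ flat_map snd (body r) ++
    flat_map (fun c => match c with CZero v | CIn v => [v] | CSucc v w => [v; w] end) (cons_of r)))
    as [V' HV'].
  exists (V + V'). intros r' [<-|Hr].
  - split; [|split].
    + intros v Hv. enough (v < V') by lia. apply HV'. apply in_app_iff. now left.
    + intros at_ Hat v Hv. enough (v < V') by lia. apply HV'. apply in_app_iff. right.
      apply in_app_iff. left. apply in_flat_map. eauto.
    + intros c Hc.
      assert (H : forall v, In v match c with CZero v | CIn v => [v] | CSucc v w => [v; w] end ->
                  v < V + V').
      { intros v Hv. enough (v < V') by lia. apply HV'. apply in_app_iff. right.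
        apply in_app_iff. right. apply in_flat_map. eauto. }
      destruct c; [| split |]; apply H; simpl; auto.
  - destruct (HV r' Hr) as (H1 & H2 & H3). split; [|split].
    + intros v Hv. specialize (H1 v Hv). lia.
    + intros at_ Hat v Hv. specialize (H2 at_ Hat v Hv). lia.
    + intros c Hc. specialize (H3 c Hc). destruct c; lia.
Qed.

Lemma env_bound V (env : nat -> nat) : exists k, forall v, v < V -> env v < k.
Proof.
  induction V as [|V [k Hk]]; [exists 0; lia|].
  exists (S (k + env V)). intros v Hv. destruct (Nat.eq_dec v V) as [->|]; [lia|].
  specialize (Hk v ltac:(lia)). lia.
Qed.

Lemma cert_bound V (C : list (nat * (nat -> nat))) :
  exists k, 2 <= k /\ length C <= k /\
    forall p i env v, nth_error C p = Some (i, env) -> v < V -> env v < k.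
Proof.
  induction C as [|[i env] C (k & H2 & Hl & He)].
  - exists 2. simpl. split; auto. split; auto. intros [|p] i env v E; discriminate.
  - destruct (env_bound V env) as [k' Hk']. exists (S (k + k')). simpl.
    split; [lia|]. split; [lia|]. intros [|p] i' env' v E Hv.
    + injection E as <- <-. specialize (Hk' v Hv). lia.
    + specialize (He p i' env' v E Hv). lia.
Qed.

Lemma eval_labelling g V n : vars_bounded (program g) V ->
  (eval g [n] 1 <-> exists Act ThrM Thr L,
     labelling_ok (program g) V (input_set n) Act ThrM Thr L).
Proof.
  intros HV. split.
  - intros H. apply (eval_derivable (program g) n) in H; [|apply incl_tl, incl_refl].
    destruct (derivable_certificate _ _ _ _ H) as (C & HC & HD).
    set (env0 := env_of [1; n; 0]).
    assert (HG : good (program g) n ((0, env0) :: C)).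
    { apply good_cons with (goal_rule g); auto.
      - intros c [<-|[<-|[<-|[]]]]; reflexivity.
      - intros at_ [<-|[]]. exact HD. }
    destruct (cert_bound V ((0, env0) :: C)) as (k & Hk2 & Hkl & Hke).
    do 4 eexists. apply (completeness (program g) V n ((0, env0) :: C)) with (k := k); auto.
    now exists env0.
  - intros (Act & ThrM & Thr & L & ok).
    destruct (soundness (program g) V n Act ThrM Thr L ok HV (meaning g n)) with (r0 := goal_rule g)
      as (vals & _ & H); auto.
    intros r env Hr. destruct Hr as [<-|Hr].
    + intros Hc Hb. assert (H0 := Hc _ (or_introl eq_refl)).
      assert (H1 := Hc _ (or_intror (or_introl eq_refl))).
      assert (H2 := Hc _ (or_intror (or_intror (or_introl eq_refl)))).
      assert (H3 := Hb _ (or_introl eq_refl)). simpl in *. congruence.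
    + apply (proj1 (Forall_forall _ _) (rules_eval_sound g n g 1) r Hr).
Qed.

(** * Diagonalisation *)

Definition computable1 (h : nat -> nat) : Prop := exists f, forall x, eval f [x] (h x).
Definition computable2 (h : nat -> nat -> nat) : Prop :=
  exists f, forall x y, eval f [x; y] (h x y).

Lemma eval_proj i v z : i < length v -> nth i v 0 = z -> eval (RProj i) v z.
Proof. intros H <-. now constructor. Qed.

Lemma eval_comp1 f g v y z : eval g v y -> eval f [y] z -> eval (RComp f [g]) v z.
Proof. intros Hg Hf. apply ev_comp with [y]; auto. repeat constructor. auto. Qed.

Lemma eval_comp2 f g g' v y y' z :
  eval g v y -> eval g' v y' -> eval f [y; y'] z -> eval (RComp f [g; g']) v z.
Proof. intros Hg Hg' Hf. apply ev_comp with [y; y']; auto. repeat constructor; auto. Qed.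

Lemma computable_id : computable1 (fun x => x).
Proof. exists (RProj 0). intros x. apply eval_proj; [simpl; lia|reflexivity]. Qed.

Lemma computable_const c : computable1 (fun _ => c).
Proof.
  induction c as [|c [f Hf]].
  - exists RZero. intros x. constructor.
  - exists (RComp RSucc [f]). intros x. apply eval_comp1 with c; auto. constructor.
Qed.

Lemma computable_comp h h1 h2 :
  computable2 h -> computable1 h1 -> computable1 h2 -> computable1 (fun x => h (h1 x) (h2 x)).
Proof.
  intros [f Hf] [f1 H1] [f2 H2]. exists (RComp f [f1; f2]).
  intros x. eapply eval_comp2; eauto.
Qed.

Lemma computable_add : computable2 Nat.add.
Proof.
  exists (RPrec (RProj 0) (RComp RSucc [RProj 1])). intros x y. induction x as [|x IH].
  - constructor. apply eval_proj; [simpl; lia|reflexivity].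
  - eapply ev_precS; [exact IH|]. apply eval_comp1 with (x + y); [|constructor].
    apply eval_proj; [simpl; lia|reflexivity].
Qed.

Fixpoint triangle (n : nat) : nat := match n with 0 => 0 | S n => triangle n + S n end.

Lemma computable_triangle : computable1 triangle.
Proof.
  destruct computable_add as [f Hf].
  exists (RPrec RZero (RComp f [RProj 1; RComp RSucc [RProj 0]])). intros x. induction x as [|x IH].
  - repeat constructor.
  - eapply ev_precS; [exact IH|]. eapply eval_comp2; [| |apply Hf].
    + apply eval_proj; [simpl; lia|reflexivity].
    + apply eval_comp1 with x; [|constructor]. apply eval_proj; [simpl; lia|reflexivity].
Qed.

(** Without the division, the pairing is easily computed by primitive recursion and its injectivity
    is a matter of comparing triangular numbers. *)
Lemma cpair_triangle a b : cpair a b = triangle (a + b) + b.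
Proof.
  unfold cpair. f_equal.
  assert (H : forall n, n * (n + 1) = triangle n * 2).
  { induction n as [|n IH]; simpl triangle; lia. }
  rewrite H. apply Nat.div_mul. discriminate.
Qed.

Lemma computable_cpair : computable2 cpair.
Proof.
  destruct computable_add as [f Hf], computable_triangle as [g Hg].
  exists (RComp f [RComp g [f]; RProj 1]). intros x y. rewrite cpair_triangle.
  eapply eval_comp2; [| |apply Hf].
  - eapply eval_comp1; [apply Hf|apply Hg].
  - apply eval_proj; [simpl; lia|reflexivity].
Qed.

(** Self-application needs the same number twice: as the code of the formula and as the number of
    shifts. *)
Lemma computable_iter h : computable1 h -> computable1 (fun n => Nat.iter n h n).
Proof.
  intros [f Hf]. apply (computable_comp (fun n x => Nat.iter n h x));
    auto using computable_id.
  exists (RPrec (RProj 0) (RComp f [RProj 1])). intros n x. induction n as [|n IH].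
  - constructor. apply eval_proj; [simpl; lia|reflexivity].
  - eapply ev_precS; [exact IH|]. simpl Nat.iter. apply eval_comp1 with (2 := Hf _).
    apply eval_proj; [simpl; lia|reflexivity].
Qed.

(** * Injectivity of the coding, and sentences from definable predicates *)

Lemma triangle_mono a b : a <= b -> triangle a <= triangle b.
Proof. induction 1; simpl; lia. Qed.

Lemma cpair_inj a b a' b' : cpair a b = cpair a' b' -> a = a' /\ b = b'.
Proof.
  rewrite !cpair_triangle. intros H.
  assert (Hlt : forall s s', s < s' -> triangle s + s < triangle s').
  { intros s s' Hs. apply (triangle_mono (S s)) in Hs. simpl in Hs. lia. }
  destruct (lt_eq_lt_dec (a + b) (a' + b')) as [[Hs|Hs]|Hs].
  - apply Hlt in Hs. lia.
  - rewrite Hs in H. lia.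
  - apply Hlt in Hs. lia.
Qed.

Lemma code_inj phi psi : code phi = code psi -> phi = psi.
Proof.
  revert psi. induction phi; intros []; cbn [code]; intros H; apply cpair_inj in H;
    destruct H as [Ht H]; try discriminate; try (apply cpair_inj in H; destruct H);
    f_equal; auto.
Qed.

(** A formula obtained from [definable] may have stray free variables on which its truth does not
    depend; quantifying them universally removes them and preserves the meaning. *)
Fixpoint close (keep : nat -> bool) (b : nat) (phi : form) : form :=
  match b with
  | 0 => phi
  | S b => FAllFO b (if keep b then close keep b phi else FAllSO b (close keep b phi))
  end.

Lemma fo_free_below z b phi : below b phi -> fo_free z phi -> z < b.
Proof. induction phi; simpl; intuition lia. Qed.

Lemma so_free_below z b phi : below b phi -> so_free z phi -> z < b.
Proof. induction phi; simpl; intuition lia. Qed.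

Lemma close_free keep z b phi :
  (fo_free z (close keep b phi) -> b <= z /\ fo_free z phi) /\
  (so_free z (close keep b phi) -> keep z = true \/ (b <= z /\ so_free z phi)).
Proof.
  induction b as [|b [IH1 IH2]]; simpl.
  - split; intros; [|right]; split; auto; lia.
  - destruct (keep b) eqn:E; simpl.
    + split; [intros [Hne H]; apply IH1 in H; intuition lia|].
      intros H. destruct (Nat.eq_dec z b) as [->|]; auto. apply IH2 in H. intuition lia.
    + split; intros [Hne H]; [apply IH1 in H|apply IH2 in H]; intuition lia.
Qed.

Lemma sat_close keep b phi (Q : assign_pred) fo so :
  (forall fo so, sat fo so phi <-> Q fo so) ->
  (forall fo so fo' so', (forall Z, keep Z = true -> so Z = so' Z) -> Q fo so -> Q fo' so') ->
  (sat fo so (close keep b phi) <-> Q fo so).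
Proof.
  intros H HQ. revert fo so. induction b as [|b IH]; intros fo so; simpl; auto.
  assert (Hu : forall S, keep b = false -> forall Z, keep Z = true -> upd so b S Z = so Z).
  { intros S E Z HZ. unfold upd. destruct (Nat.eqb_spec Z b); congruence. }
  destruct (keep b) eqn:E; simpl; split.
  - intros Hs. specialize (Hs (fo b)). apply IH in Hs. revert Hs. apply HQ. auto.
  - intros Hq u. apply IH. revert Hq. apply HQ. auto.
  - intros Hs. specialize (Hs (fo b) (so b)). apply IH in Hs. revert Hs. apply HQ. auto.
  - intros Hq u S. apply IH. revert Hq. apply HQ. intros Z HZ. symmetry. auto.
Qed.

Lemma definable_closed keep (Q : assign_pred) :
  definable Q ->
  (forall fo so fo' so', (forall Z, keep Z = true -> so Z = so' Z) -> Q fo so -> Q fo' so') ->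
  exists phi, (forall fo so, sat fo so phi <-> Q fo so) /\
    (forall z, ~ fo_free z phi) /\ (forall Z, so_free Z phi -> keep Z = true).
Proof.
  intros [phi H] HQ. destruct (below_exists phi) as [b Hb].
  exists (close keep b phi). split; [|split].
  - intros fo so. now apply sat_close.
  - intros z Hz. apply close_free in Hz. destruct Hz as [Hz Hf].
    apply (fo_free_below z b) in Hf; auto. lia.
  - intros Z HZ. apply close_free in HZ. destruct HZ as [|[HZ Hf]]; auto.
    apply (so_free_below Z b) in Hf; auto. lia.
Qed.

Lemma cpair_computable h h' :
  computable1 h -> computable1 h' -> computable1 (fun x => cpair (h x) (h' x)).
Proof. intros. apply computable_comp; auto using computable_cpair. Qed.

Definition FExSO (X : nat) (phi : form) : form := FNeg (FAllSO X (FNeg phi)).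

Definition code_ex_and (X c0 c : nat) : nat :=
  cpair 3 (cpair 6 (cpair X (cpair 3 (cpair 4 (cpair c0 c))))).

Lemma code_FExSO X psi phi : code (FExSO X (FAnd psi phi)) = code_ex_and X (code psi) (code phi).
Proof. reflexivity. Qed.

Lemma sat_FExSO X psi phi fo so :
  sat fo so (FExSO X (FAnd psi phi)) <->
  exists S, sat fo (upd so X S) psi /\ sat fo (upd so X S) phi.
Proof.
  simpl. split.
  - intros H. apply not_all_not_ex in H. exact H.
  - intros [S H] Hn. now apply (Hn S).
Qed.

Definition shift (P : node -> Prop) (y : node) : Prop := exists x, y = x ++ [false] /\ P x.

Lemma iter_shift n : Nat.iter n shift start = input_set n.
Proof.
  induction n as [|n IH]; apply functional_extensionality; intros y; apply propositional_extensionality.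
  - simpl. split.
    + intros H. exists y. split; auto. now rewrite app_nil_r.
    + intros (u & Hu & ->). now rewrite app_nil_r.
  - simpl Nat.iter. rewrite IH. split.
    + intros (x & -> & u & Hu & ->). exists u. split; auto. now rewrite zeros_S.
    + intros (u & Hu & ->). exists (u ++ zeros n). rewrite zeros_S. split; auto. now exists u.
Qed.

Lemma def_start_set : definable (fun fo so => so 3 = start).
Proof.
  apply def_ext with (fun fo so => forall x, so 3 x <-> start x).
  - intros fo so. split.
    + intros H. apply functional_extensionality. intros x. apply propositional_extensionality. auto.
    + intros ->. reflexivity.
  - apply (def_all 1); [|is_fresh]. apply def_iff; [apply def_mem|apply def_start].
Qed.

Lemma def_shift_set : definable (fun fo so => so 4 = shift (so 3)).
Proof.
  apply def_ext with (fun fo so => forall y, so 4 y <-> exists x, y = x ++ [false] /\ so 3 x).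
  - intros fo so. split.
    + intros H. apply functional_extensionality. intros x. apply propositional_extensionality.
      rewrite H. reflexivity.
    + intros ->. reflexivity.
  - apply (def_all 1); [|is_fresh]. apply def_iff; [apply def_mem|].
    apply (def_ex 2); [|is_fresh]. apply def_and; [apply def_S0|apply def_mem].
Qed.

Lemma def_copy_set : definable (fun fo so => so 3 = so 4).
Proof.
  apply def_ext with (fun fo so => forall x, so 3 x <-> so 4 x).
  - intros fo so. split.
    + intros H. apply functional_extensionality. intros x. apply propositional_extensionality. auto.
    + intros ->. reflexivity.
  - apply (def_all 1); [|is_fresh]. apply def_iff; apply def_mem.
Qed.

Definition keep_input (Z : nat) : bool := Nat.eqb Z 3.
Definition keep_both (Z : nat) : bool := Nat.eqb Z 3 || Nat.eqb Z 4.

(* A formula is applied to its own code [N] by moving its argument, the set [so 3], from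
   the run starts [N] steps to the left. *)
Theorem diagonal_formula : exists d, forall A : (node -> Prop) -> Prop,
  definable (fun fo so => A (so 3)) ->
  exists N G, sentence G /\ (true_in_tree G <-> A (input_set N)) /\ eval d [N] (code G).
Proof.
  destruct (definable_closed keep_input _ def_start_set) as (fs & Hs & Fs & Ss).
  { intros fo so fo' so' H E. now rewrite <- (H 3). }
  destruct (definable_closed keep_both _ def_shift_set) as (fm & Hm & Fm & Sm).
  { intros fo so fo' so' H E. now rewrite <- (H 3), <- (H 4). }
  destruct (definable_closed keep_both _ def_copy_set) as (fc & Hc & Fc & Sc).
  { intros fo so fo' so' H E. now rewrite <- (H 3), <- (H 4). }
  (* Variable 3 is replaced by its own shift, so the new value is first computed in variable 4 and
     then copied. *)
  set (move := fun psi => FExSO 4 (FAnd fm (FExSO 3 (FAnd fc psi)))).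
  set (move_code := fun c => code_ex_and 4 (code fm) (code_ex_and 3 (code fc) c)).
  assert (Hcomp : computable1 (fun n => code_ex_and 3 (code fs) (Nat.iter n move_code n))).
  { assert (Hex : forall X c0 h, computable1 h -> computable1 (fun x => code_ex_and X c0 (h x))).
    { intros X c0 h Hh. unfold code_ex_and.
      repeat apply cpair_computable; auto using computable_const. }
    apply (Hex 3 (code fs) (fun n => Nat.iter n move_code n)), computable_iter.
    exact (Hex 4 _ _ (Hex 3 (code fc) _ computable_id)). }
  (* [d] is fixed before [A], so that [A] may be a statement about a program that contains [d]. *)
  destruct Hcomp as [d Hd]. exists d. intros A HA.
  destruct (definable_closed keep_input _ HA) as (phi & Hphi & Fphi & Sphi).
  { intros fo so fo' so' H. now rewrite <- (H 3). }
  set (N := code phi).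
  assert (Hmove : forall psi D, (forall fo so, sat fo so psi <-> D (so 3)) ->
            forall fo so, sat fo so (move psi) <-> D (shift (so 3))).
  { intros psi D HD fo so. unfold move. rewrite sat_FExSO. split.
    - intros (Q & H1 & H2). apply sat_FExSO in H2. destruct H2 as (P & H2 & H3).
      apply Hm in H1. apply Hc in H2. apply HD in H3. cbn in H1, H2, H3. now subst.
    - intros H. exists (shift (so 3)). split; [now apply Hm|]. apply sat_FExSO.
      exists (shift (so 3)). split; [now apply Hc|]. now apply HD. }
  assert (Hiter : forall n fo so, sat fo so (Nat.iter n move phi) <-> A (Nat.iter n shift (so 3))).
  { induction n as [|n IH]; intros fo so; [apply Hphi|].
    rewrite (Nat.iter_succ_r n _ shift). simpl Nat.iter at 1.
    apply (Hmove _ (fun P => A (Nat.iter n shift P))). exact IH. }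
  assert (Hcode : forall n, code (Nat.iter n move phi) = Nat.iter n move_code N).
  { induction n as [|n IH]; auto. change (code (move (Nat.iter n move phi)) = move_code (Nat.iter n move_code N)).
    rewrite <- IH. unfold move at 1. now rewrite !code_FExSO. }
  assert (Hfree : forall n, (forall z, ~ fo_free z (Nat.iter n move phi)) /\
                            (forall Z, so_free Z (Nat.iter n move phi) -> Z = 3)).
  { induction n as [|n [IH1 IH2]].
    - split; auto. intros Z HZ. now apply Nat.eqb_eq, Sphi.
    - simpl. split.
      + intros z. specialize (Fm z). specialize (Fc z). specialize (IH1 z). tauto.
      + intros Z (H4 & [H|[H3 [H|H]]]).
        * apply Sm, Bool.orb_true_iff in H. rewrite !Nat.eqb_eq in H. tauto.
        * apply Sc, Bool.orb_true_iff in H. rewrite !Nat.eqb_eq in H. tauto.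
        * now apply IH2. }
  exists N, (FExSO 3 (FAnd fs (Nat.iter N move phi))). split; [|split].
  - destruct (Hfree N) as [H1 H2]. split; simpl.
    + intros z. specialize (Fs z). specialize (H1 z). tauto.
    + intros Z [H3 [H|H]]; [apply Ss, Nat.eqb_eq in H|apply H2 in H]; contradiction.
  - unfold true_in_tree. rewrite sat_FExSO, <- iter_shift. split.
    + intros (S & H1 & H2). apply Hs in H1. apply Hiter in H2. cbn in H1, H2. now subst.
    + intros H. exists start. split; [now apply Hs|now apply Hiter].
  - rewrite code_FExSO, Hcode. apply Hd.
Qed.

Theorem theorem4p1 : ~ decidable_set theory.
Proof.
  intros [f Hf]. destruct diagonal_formula as [d Hd].
  (* On input [N], [g] runs the supposed decision procedure on the code of [G], and [G] says that
     the answer is not 1. *)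
  set (g := RComp f [d]).
  destruct (var_bound_exists (program g)) as [V HV].
  destruct (Hd (fun P => ~ exists Act ThrM Thr L, labelling_ok (program g) V P Act ThrM Thr L))
    as (N & G & HG & Htrue & Hcode).
  { apply def_not. apply (def_exists_labelling (program g) V). }
  rewrite <- eval_labelling in Htrue by exact HV.
  destruct (Hf (code G)) as [H1 H0].
  assert (Hg : forall z, eval f [code G] z -> eval g [N] z).
  { intros z Hz. now apply eval_comp1 with (code G). }
  destruct (classic (theory (code G))) as [Ht|Hn].
  - destruct Ht as (phi & E & _ & Hphi). apply code_inj in E. subst phi.
    apply (proj1 Htrue Hphi), Hg, H1. exists G. auto.
  - apply Hn. exists G. split; auto. split; auto. apply Htrue. intros He.
    discriminate (eval_deterministic g [N] 0 1 (Hg 0 (H0 Hn)) He).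
Qed.
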